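(* Let $A$ be a compact abelian Lie group equipped with the metric $d_A$, and let $s\ge0$, $\ell\ge1$ be given. Then there exists $\varepsilon=\varepsilon(s,\ell,A)>0$ such that the following holds. Let $\beta\colon X\to Y$ be any fibration of degree $s$ between compact ergodic cubespaces $X$ and $Y$ that obey the glueing axiom. Let $\rho$ be a continuous $\ell$-cocycle on $X$ with values in $A$, let $0<\delta\le\varepsilon$ be given and suppose that $d_A(\rho(c),\rho(c'))\le\delta$ whenever $c,c'\in C^\ell(X)$ satisfy $\beta(c)=\beta(c')$. Then $\rho=\partial^\ell f+\tilde\rho\circ\beta$, where $f\colon X\to A$ is continuous and satisfies $d_A(f(x),f(y))\lesssim_{s,\ell}\delta$ (that is, $d_A(f(x),f(y))\le C\delta$ for a constant $C=C(s,\ell)>0$ depending only on $s,\ell$) whenever $\beta(x)=\beta(y)$, and $\tilde\rho$ is a continuous $\ell$-cocycle on $Y$ with values in $A$.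
   Context: Cubespaces. A morphism of discrete cubes $\{0,1\}^m\to\{0,1\}^n$ is a map each of whose coordinate functions is one of $\omega\mapsto 0$, $1$, $\omega_i$, $1-\omega_i$ (for some $i$). A compact cubespace is a compact metric space $X$ with closed subsets $C^n(X)\subseteq X^{\{0,1\}^n}$, $n\ge 0$ (elements are called $n$-cubes), such that $C^0(X)=X$ and $c\circ f\in C^m(X)$ for every $c\in C^n(X)$ and every morphism of discrete cubes $f\colon\{0,1\}^m\to\{0,1\}^n$. $X$ is ergodic if $C^1(X)=X\times X$. For configurations $c,c'\colon\{0,1\}^{n}\to X$, $[c,c']$ denotes the concatenation along a coordinate: the configuration $\{0,1\}^{n+1}\to X$ equal to $c$ on the face where a chosen coordinate is $0$ and $c'$ on the face where it is $1$ (the chosen coordinate may be any of the $n+1$ coordinates, the same one in all concatenations within a given condition). $X$ obeys the glueing axiom if whenever $[c_1,c_2]$ and $[c_2,c_3]$ are cubes, so is $[c_1,c_3]$. Fibrations. An $n$-corner is a map $\lambda\colon\{0,1\}^n\setminus\{\vec 1\}\to X$ whose restriction to each face $\{\omega:\omega_i=0\}$ is an $(n-1)$-cube. A cubespace morphism is a continuous map taking cubes to cubes (pointwise application). A morphism $\beta\colon X\to Y$ is a fibration if for every $n\ge0$, every $n$-corner $\lambda$ of $X$ and every $n$-cube $c$ of $Y$ with $c(\omega)=\beta(\lambda(\omega))$ for $\omega\ne\vec1$, there is an $n$-cube $c'$ of $X$ extending $\lambda$ with $\beta(c')=c$. It is a fibration of degree $s$ if in addition any $c,c'\in C^{s+1}(X)$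 with $\beta(c)=\beta(c')$ that agree on $\{0,1\}^{s+1}\setminus\{\vec1\}$ are equal. Cocycles. An $\ell$-cocycle on a cubespace $X$ with values in an abelian group $A$ is a continuous function $\rho\colon C^\ell(X)\to A$ such that (concatenation along any coordinate): (i) if $[c_0,c_1],[c_1,c_2],[c_0,c_2]$ are $\ell$-cubes then $\rho([c_0,c_2])=\rho([c_0,c_1])+\rho([c_1,c_2])$; (ii) $\rho([c_0,c_1])=-\rho([c_1,c_0])$ for every $\ell$-cube $[c_0,c_1]$; (iii) $\rho([c_0,c_0])=0$. For $f\colon X\to A$, $\partial^\ell f(c)=\sum_{\omega\in\{0,1\}^\ell}(-1)^{|\omega|}f(c(\omega))$ for $c\in C^\ell(X)$, where $|\omega|=\sum_i\omega_i$. Metric. For a compact abelian Lie group $A$ fix an identification $A\cong(\mathbb{R}/\mathbb{Z})^d\times K$, $K$ finite; $d_A((t,k),(t',k'))=(1-[k=k'])+\inf\{\|x-x'\|_2: x,x'\in\mathbb{R}^d,\ x\equiv t,\ x'\equiv t'\pmod 1\}$, where $[k=k']$ is $1$ if $k=k'$ and $0$ otherwise. *)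

(* Defs.v *)
From HB Require Import structures.
From mathcomp Require Import all_boot all_order all_algebra.
From mathcomp Require Import all_classical all_reals all_analysis.

Set Implicit Arguments.
Unset Strict Implicit.
Unset Printing Implicit Defensive.

Import Order.TTheory GRing.Theory Num.Theory.
Import numFieldNormedType.Exports.

Local Open Scope classical_set_scope.
Local Open Scope ring_scope.

(* A vertex of {0,1}^n; [true] stands for the coordinate value 1. *)
Definition vertex (n : nat) := {ffun 'I_n -> bool}.

Definition vtop (n : nat) : vertex n := [ffun _ => true].

Definition weight n (w : vertex n) : nat := (\sum_(i < n) w i)%N.

Definition vins n (i : 'I_n) (b : bool) (v : vertex n.-1) : vertex n :=
  [ffun j => if unlift i j is Some k then v k else b].

Definition vdel n (i : 'I_n) (w : vertex n) : vertex n.-1 :=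
  [ffun j => w (lift i j)].

Definition cube_morphism m n (phi : vertex m -> vertex n) : Prop :=
  forall j : 'I_n,
    [\/ forall w, phi w j = false,
        forall w, phi w j = true,
        exists i : 'I_m, forall w, phi w j = w i |
        exists i : 'I_m, forall w, phi w j = ~~ w i].

(* X^{{0,1}^n} with the product topology. *)
Definition config n (X : topologicalType) : topologicalType :=
  prod_topology (fun _ : vertex n => X).

(* [c, c'], the concatenation along the i-th coordinate.  As i : 'I_n, this
   only exists for n >= 1, where n.-1 is the dimension of c and c'. *)
Definition concat (X : topologicalType) n (i : 'I_n) (c c' : config n.-1 X) :
    config n X :=
  fun w => if w i then c' (vdel i w) else c (vdel i w).

Record compact_cubespace (R : realType) := CompactCubespace {
  cs_car :> metricType R;
  cs_compact : compact [set: cs_car];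
  cubes : forall n, set (config n cs_car);
  cubes_closed : forall n, closed (@cubes n);
  cubes_dim0 : @cubes 0 = setT;
  cubes_comp : forall m n (c : config n cs_car) (phi : vertex m -> vertex n),
    @cubes n c -> cube_morphism phi -> @cubes m (c \o phi)
}.
Arguments cubes {R} X n _ : rename.

Definition ergodic (R : realType) (X : compact_cubespace R) : Prop :=
  cubes X 1 = setT.

Definition glueing_axiom (R : realType) (X : compact_cubespace R) : Prop :=
  forall n (i : 'I_n) (c1 c2 c3 : config n.-1 X),
    cubes X n (concat i c1 c2) -> cubes X n (concat i c2 c3) ->
    cubes X n (concat i c1 c3).

Definition punctured (n : nat) := {w : vertex n | w != vtop n}.

Lemma vins_false_neq_top n (i : 'I_n) (v : vertex n.-1) :
  vins i false v != vtop n.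
Proof.
by apply/eqP => /ffunP /(_ i); rewrite !ffunE unlift_none.
Qed.

(* The face {w | w i = 0}, which avoids the top vertex. *)
Definition lower_face n (i : 'I_n) (v : vertex n.-1) : punctured n :=
  exist _ (vins i false v) (vins_false_neq_top i v).

Definition corner (R : realType) (X : compact_cubespace R) n
    (lam : punctured n -> X) : Prop :=
  forall i : 'I_n, cubes X n.-1 (lam \o lower_face i).

Definition cubespace_morphism (R : realType) (X Y : compact_cubespace R)
    (beta : X -> Y) : Prop :=
  continuous beta /\
  forall n (c : config n X), cubes X n c -> cubes Y n (beta \o c).

Definition fibration (R : realType) (X Y : compact_cubespace R)
    (beta : X -> Y) : Prop :=
  cubespace_morphism beta /\
  forall n (lam : punctured n -> X) (c : config n Y),
    corner lam -> cubes Y n c -> (forall w, c (val w) = beta (lam w)) ->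
    exists c' : config n X,
      [/\ cubes X n c', forall w, c' (val w) = lam w & beta \o c' = c].

Definition fibration_of_degree (s : nat) (R : realType)
    (X Y : compact_cubespace R) (beta : X -> Y) : Prop :=
  fibration beta /\
  forall c c' : config s.+1 X,
    cubes X s.+1 c -> cubes X s.+1 c' -> beta \o c = beta \o c' ->
    (forall w, w != vtop s.+1 -> c w = c' w) -> c = c'.

(* A cocycle is given by a total function on configurations of which only the
   restriction to the cubes matters. *)
Definition cocycle (R : realType) (X : compact_cubespace R)
    (A : topologicalZmodType) (l : nat) (rho : config l X -> A) : Prop :=
  {within cubes X l, continuous rho} /\
  forall i : 'I_l,
    [/\ forall c0 c1 c2 : config l.-1 X,
          cubes X l (concat i c0 c1) -> cubes X l (concat i c1 c2) ->
          cubes X l (concat i c0 c2) ->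
          rho (concat i c0 c2) = rho (concat i c0 c1) + rho (concat i c1 c2),
        forall c0 c1 : config l.-1 X, cubes X l (concat i c0 c1) ->
          rho (concat i c0 c1) = - rho (concat i c1 c0) &
        forall c0 : config l.-1 X, cubes X l (concat i c0 c0) ->
          rho (concat i c0 c0) = 0].

Definition coboundary (X : topologicalType) (A : zmodType) (l : nat)
    (f : X -> A) (c : config l X) : A :=
  \sum_(w : vertex l) f (c w) *~ (-1) ^+ weight w.

(* R/Z, as a group and with the quotient topology; Num.int_num_subdef is the
   boolean predicate underlying Num.int. *)
Definition circle_quot (R : realType) :=
  Quotient.quot (GRing.ZmodClosed.clone R (@Num.int_num_subdef R) _).

Definition circle (R : realType) : Type := circle_quot R.

HB.instance Definition _ (R : realType) :=
  Topological.copy (circle R) (quotient_topology (circle_quot R)).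
(* Not a copy of the group structure of circle_quot, whose underlying choiceType
   is not convertible to the one that comes with the quotient topology. *)
HB.instance Definition _ (R : realType) :=
  @GRing.isZmodule.Build (circle R) (0 : circle_quot R) (@GRing.opp (circle_quot R))
    (@GRing.add (circle_quot R)) (@addrA (circle_quot R)) (@addrC (circle_quot R))
    (@add0r (circle_quot R)) (@addNr (circle_quot R)).

Definition to_circle (R : realType) (x : R) : circle R :=
  (\pi_(circle_quot R) x)%qT.

HB.instance Definition _ (K : finZmodType) :=
  GRing.Zmodule.copy (discrete_topology K) K.

(* By the structure theorem, the compact abelian Lie groups are the
   topological abelian groups isomorphic to some (R/Z)^d x K with K finite.
   The isomorphism is recorded because the metric depends on it. *)
Record compact_abelian_lie_group (R : realType) := CompactAbelianLieGroup {
  lie_car :> topologicalZmodType;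
  lie_dim : nat;
  lie_comp : finZmodType;
  lie_iso : lie_car -> 'rV[circle R]_lie_dim * discrete_topology lie_comp;
  lie_inv : 'rV[circle R]_lie_dim * discrete_topology lie_comp -> lie_car;
  lie_isoD : {morph lie_iso : a b / a + b >-> a + b};
  lie_isoK : cancel lie_iso lie_inv;
  lie_invK : cancel lie_inv lie_iso;
  lie_iso_continuous : continuous lie_iso;
  lie_inv_continuous : continuous lie_inv
}.

Definition l2norm (R : realType) d (x : 'rV[R]_d) : R :=
  Num.sqrt (\sum_(j < d) x 0 j ^+ 2).

Definition torus_dist (R : realType) d (t t' : 'rV[circle R]_d) : R :=
  inf [set r | exists x x' : 'rV[R]_d,
    [/\ map_mx (@to_circle R) x = t, map_mx (@to_circle R) x' = t' &
        r = l2norm (x - x')]].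

Definition lie_dist (R : realType) (A : compact_abelian_lie_group R)
    (a b : A) : R :=
  (1 - ((lie_iso a).2 == (lie_iso b).2)%:R)
    + torus_dist (lie_iso a).1 (lie_iso b).1.

(* Main.v *)
Require Import Defs.
From HB Require Import structures.
From mathcomp Require Import all_boot all_order all_algebra.
From mathcomp Require Import all_classical all_reals all_analysis.
From mathcomp Require Import generic_quotient zify ring lra.

Set Implicit Arguments.
Unset Strict Implicit.
Unset Printing Implicit Defensive.

Import Order.TTheory GRing.Theory Num.Theory.
Import numFieldNormedType.Exports.

Local Open Scope classical_set_scope.
Local Open Scope ring_scope.

(* The differences [rho c' - rho c] over cubes with the same image in Y are small, hence
   lift to an R^d-valued function r, additive in (c, c') and under glueing.  It suffices to
   write r c c' = d f c' - d f c with f continuous and bounded by O(delta), since then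
   rho - d (exp f) is constant on the fibres and descends to Y.

   This is done by induction on the degree s.  The fibration of degree s has a commutative
   group of translations, and two cubes with the same image in the quotient of degree s - 1
   differ by a function h from the vertices to that group.  Let f x be the mean of
   r (const x) (h (const x)) over all such h that are trivial at the vertex 0.  Subdividing
   a cube c in all directions, with the new vertices moved by h, expresses r c c' as an
   alternating sum over the corners, and invariance of the mean shows that the corner w
   contributes f (c' w) - f (c w) as soon as c and c' agree in the quotient.  Hence r - d f
   descends to the quotient of degree s - 1.

   Only a translation-invariant mean on bounded functions on a discrete commutative group
   is needed, not Haar measure: continuity of f follows from compactness, because "x and y
   are moved by the same h" is a closed condition. *)

(** A mean needs values in a vector space, which is why the lift to R^d precedes the induction. The
    lift is also the only step that uses the smallness of delta: identities between logarithms hold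
    modulo Z^d, and become exact because the vectors involved have total norm below 1. From there on
    everything is linear in [r], so 1/16 serves as epsilon for all s, l and A. Bounds are carried in
    the Euclidean norm throughout, which keeps the dimension of A out of the constant.

    The successive quotients are bare types. Topology enters only through the fixed compact space X
    above them, and closed conditions are transported by projecting along compact factors. Lifts are
    not chosen continuously, so continuity on a quotient is proved for all lifts at once, by a tube
    argument.

    The algebra rests on the uniqueness of the top vertex of a cube of dimension above s: it makes a
    translation determined by one value and makes translations commute. *)

(** * Vertices and morphisms of cubes indexed by finite types *)

Definition vert (I : finType) := {ffun I -> bool}.

Definition vone (I : finType) : vert I := [ffun=> true].

Definition vset (I : finType) (i : I) (b : bool) (v : vert I) : vert I :=
  [ffun j => if j == i then b else v j].

(** As [v] varies, [vmeet v w] runs over the vertices below [w], and [vmeet v w != w] singles out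
    those strictly below. Composing a cube with it restricts to the face below [w] without changing
    the index type. *)
Definition vmeet (I : finType) (v w : vert I) : vert I :=
  [ffun i => v i && w i].

Definition vsupp (I : finType) (v : vert I) : {set I} := [set i | v i].

Definition vert_morphism (I J : finType) (phi : vert I -> vert J) : Prop :=
  forall j, [\/ forall w, phi w j = false,
    forall w, phi w j = true,
    exists i, forall w, phi w j = w i |
    exists i, forall w, phi w j = ~~ w i].

Definition set_top (I : finType) (Q : Type) (c : vert I -> Q) (z : Q) :
    vert I -> Q :=
  fun v => if v == vone I then z else c v.

Section Vertices.
Variables I J : finType.
Implicit Types (i : I) (v w : vert I).

Lemma vsetE i b v j : vset i b v j = if j == i then b else v j.
Proof. by rewrite ffunE. Qed.

Lemma vset_id i v : vset i (v i) v = v.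
Proof. by apply/ffunP => j; rewrite ffunE; case: eqP => [->|]. Qed.

Lemma vset_vset i a b v : vset i a (vset i b v) = vset i a v.
Proof. by apply/ffunP => j; rewrite !ffunE; case: eqP. Qed.

Lemma vset_false_neq_top i v : vset i false v != vone I.
Proof. by apply/eqP => /ffunP/(_ i); rewrite !ffunE eqxx. Qed.

Lemma neq_vone v : v != vone I -> exists i, v i = false.
Proof.
case: (pickP (fun i => ~~ v i)) => [i /negbTE vi _|v1]; first by exists i.
by case/eqP; apply/ffunP => i; rewrite ffunE; apply/negbFE/v1.
Qed.

Lemma vone_supp : vsupp (vone I) = [set: I]%SET.
Proof. by apply/setP => i; rewrite !inE ffunE. Qed.

Lemma vmeet1 v : vmeet v (vone I) = v.
Proof. by apply/ffunP => i; rewrite !ffunE andbT. Qed.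

Lemma vmeetC v w : vmeet v w = vmeet w v.
Proof. by apply/ffunP => i; rewrite !ffunE andbC. Qed.

Lemma vmeet_vset i v w : vmeet v (vset i false w) = vset i false (vmeet v w).
Proof.
by apply/ffunP => j; rewrite !ffunE; case: (j == i) => //; rewrite andbF.
Qed.

Lemma vset_meet i v : vset i false v = vmeet v (vset i false (vone I)).
Proof. by rewrite vmeet_vset vmeet1. Qed.

Lemma vmeet_supp v w : vsupp (vmeet v w) = vsupp v :&: vsupp w.
Proof. by apply/setP => i; rewrite !inE ffunE. Qed.

Lemma vmeet_neq_size v w : vmeet v w != w -> (#|vsupp (vmeet v w)| < #|vsupp w|)%N.
Proof.
move=> vw; apply: proper_card; rewrite vmeet_supp properE finset.subsetIr /=.
apply: contra vw => /fintype.subsetP sub; apply/eqP/ffunP => i; rewrite ffunE.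
case wi: (w i); last by rewrite andbF.
by have := sub i; rewrite !inE wi => /(_ isT)/andP[->].
Qed.

Lemma vert_morphism_vset i b : vert_morphism (vset i b : vert I -> vert I).
Proof.
move=> j; case: (eqVneq j i) => [->|ji]; last first.
  by constructor 3; exists j => w; rewrite ffunE (negbTE ji).
by case: b; [constructor 2|constructor 1] => w; rewrite ffunE eqxx.
Qed.

Lemma vert_morphism_meet w : vert_morphism (fun v : vert I => vmeet v w).
Proof.
move=> j; case wj: (w j).
  by constructor 3; exists j => v; rewrite ffunE wj andbT.
by constructor 1 => v; rewrite ffunE wj andbF.
Qed.

Lemma vert_morphism_id : vert_morphism (@id (vert I)).
Proof. by move=> j; constructor 3; exists j. Qed.

Lemma vert_morphism_cst w : vert_morphism (fun _ : vert J => w).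
Proof. by move=> j; case wj: (w j); [constructor 2|constructor 1]. Qed.

Lemma vert_morphism_comap (f : J -> I) :
  vert_morphism (fun v : vert I => [ffun j => v (f j)]).
Proof. by move=> j; constructor 3; exists (f j) => w; rewrite ffunE. Qed.

End Vertices.

Lemma vert_morphism_comp (I J K : finType) (phi : vert J -> vert K)
    (psi : vert I -> vert J) :
  vert_morphism phi -> vert_morphism psi -> vert_morphism (phi \o psi).
Proof.
move=> mphi mpsi k; have [p|p|[j p]|[j p]] := mphi k.
- by constructor 1 => w; rewrite /= p.
- by constructor 2 => w; rewrite /= p.
- have [q|q|[i q]|[i q]] := mpsi j.
  + by constructor 1 => w; rewrite /= p q.
  + by constructor 2 => w; rewrite /= p q.
  + by constructor 3; exists i => w; rewrite /= p q.
  + by constructor 4; exists i => w; rewrite /= p q.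
- have [q|q|[i q]|[i q]] := mpsi j.
  + by constructor 2 => w; rewrite /= p q.
  + by constructor 1 => w; rewrite /= p q.
  + by constructor 4; exists i => w; rewrite /= p q.
  + by constructor 3; exists i => w; rewrite /= p q negbK.
Qed.

Definition vflip (I : finType) (i : I) (v : vert I) : vert I :=
  vset i (~~ v i) v.

Lemma vert_morphism_flip (I : finType) (i : I) : vert_morphism (vflip i).
Proof.
move=> j; case: (eqVneq j i) => [->|ji].
  by constructor 4; exists i => w; rewrite ffunE eqxx.
by constructor 3; exists j => w; rewrite ffunE (negbTE ji).
Qed.

(** Translations act along maps to the cube of dimension exactly [s]. A face of smaller codimension
    is brought to this form by padding with coordinates constantly 1. *)
Lemma face_morphism (I : finType) (S : {set I}) s : (#|S| <= s)%N ->
  exists2 psi : vert I -> vert 'I_s, vert_morphism psi &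
    forall v, (psi v == vone 'I_s) = (S \subset vsupp v).
Proof.
move=> Ss; have [S0|[i0 i0S]] := finset.set_0Vmem S.
  exists (fun=> vone _); first exact: vert_morphism_cst.
  by move=> v; rewrite eqxx S0 finset.sub0set.
exists (fun v => [ffun k : 'I_s => v (nth i0 (enum S) k) || (#|S| <= k)%N]).
  move=> k; case: (leqP #|S| k) => kS.
    by constructor 2 => w; rewrite ffunE kS orbT.
  by constructor 3; exists (nth i0 (enum S) k) => w; rewrite ffunE leqNgt kS orbF.
move=> v; apply/eqP/fintype.subsetP => [e i iS|sub].
  have ki : (index i (enum S) < #|S|)%N by rewrite cardE index_mem mem_enum.
  have /ffunP/(_ (Ordinal (leq_trans ki Ss))) := e; rewrite !ffunE /=.
  by rewrite nth_index ?mem_enum// leqNgt ki orbF inE.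
apply/ffunP => k; rewrite !ffunE; case: (leqP #|S| k) => kS; first by rewrite orbT.
have /sub : nth i0 (enum S) k \in S by rewrite -mem_enum mem_nth -?cardE.
by rewrite inE => ->.
Qed.

(* Cubes are indexed by arbitrary finite types, so that faces and products of cubes need
   no reindexing. *)
Definition cubesys (Q : Type) := forall I : finType, (vert I -> Q) -> Prop.

Definition edge (Q : Type) (x y : Q) (v : vert unit) : Q :=
  if v tt then y else x.

(* Faces and concatenations are encoded by total configurations: [lam] is a corner when
   each [lam \o vset i false] is a cube (its value at the top is irrelevant), and the
   base [Y] only enters through cubes lying over it. *)
Record cubespace_axioms (Q Y : Type) (C : cubesys Q) (b : Q -> Y) : Prop := {
  ax_comp : forall (I J : finType) (phi : vert I -> vert J) (c : vert J -> Q),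
    vert_morphism phi -> C J c -> C I (fun v => c (phi v));
  ax_edge : forall x y, C unit (edge x y);
  ax_glue : forall (I : finType) (i : I) (p q : vert I -> Q), C I p -> C I q ->
    (forall v, p (vset i true v) = q (vset i false v)) ->
    C I (fun v => if v i then q v else p v);
  ax_fib : forall (I : finType) (lam e : vert I -> Q),
    (forall i : I, C I (fun v => lam (vset i false v))) -> C I e ->
    (forall v, v != vone I -> b (lam v) = b (e v)) ->
    exists2 w, b w = b (e (vone I)) & C I (set_top lam w)
}.

Definition has_degree (s : nat) (Q Y : Type) (C : cubesys Q) (b : Q -> Y) :=
  forall c c' : vert 'I_s.+1 -> Q, C _ c -> C _ c' ->
    (forall v, b (c v) = b (c' v)) ->
    (forall v, v != vone 'I_s.+1 -> c v = c' v) ->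
    c (vone 'I_s.+1) = c' (vone 'I_s.+1).

(** * Translations of a fibration of finite degree *)

Section SumVertices.
Variables I J : finType.

Definition vinl (v : vert (I + J)%type) : vert I := [ffun i => v (inl i)].
Definition vinr (v : vert (I + J)%type) : vert J := [ffun j => v (inr j)].
Definition vpair (u : vert I) (w : vert J) : vert (I + J)%type :=
  [ffun k => match k with inl i => u i | inr j => w j end].

Lemma vpairl u w : vinl (vpair u w) = u.
Proof. by apply/ffunP => i; rewrite !ffunE. Qed.

Lemma vpairr u w : vinr (vpair u w) = w.
Proof. by apply/ffunP => i; rewrite !ffunE. Qed.

Lemma vone_sum v : (v == vone _) = (vinl v == vone I) && (vinr v == vone J).
Proof.
apply/eqP/andP => [->|[/eqP/ffunP l /eqP/ffunP r]].
  by split; apply/eqP/ffunP => i; rewrite !ffunE.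
by apply/ffunP => -[i|j]; [have := l i|have := r j]; rewrite !ffunE.
Qed.

Lemma vinr_vset_inl i a v : vinr (vset (inl i) a v) = vinr v.
Proof. by apply/ffunP => j; rewrite !ffunE. Qed.

Lemma vinl_vset_inl i a v : vinl (vset (inl i) a v) = vset i a (vinl v).
Proof. by apply/ffunP => j; rewrite !ffunE. Qed.

Lemma vinl_vset_inr j a v : vinl (vset (inr j) a v) = vinl v.
Proof. by apply/ffunP => i; rewrite !ffunE. Qed.

Lemma vinr_vset_inr j a v : vinr (vset (inr j) a v) = vset j a (vinr v).
Proof. by apply/ffunP => i; rewrite !ffunE. Qed.

Lemma vert_morphism_inl : vert_morphism vinl.
Proof. exact: vert_morphism_comap. Qed.

Lemma vert_morphism_inr : vert_morphism vinr.
Proof. exact: vert_morphism_comap. Qed.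

Lemma vert_morphism_pair (K : finType) (phi : vert K -> vert I)
    (psi : vert K -> vert J) : vert_morphism phi -> vert_morphism psi ->
  vert_morphism (fun v => vpair (phi v) (psi v)).
Proof.
move=> mphi mpsi [i|j].
  have [p|p|[k p]|[k p]] := mphi i.
  - by constructor 1 => w; rewrite ffunE.
  - by constructor 2 => w; rewrite ffunE.
  - by constructor 3; exists k => w; rewrite ffunE.
  - by constructor 4; exists k => w; rewrite ffunE.
have [p|p|[k p]|[k p]] := mpsi j.
- by constructor 1 => w; rewrite ffunE.
- by constructor 2 => w; rewrite ffunE.
- by constructor 3; exists k => w; rewrite ffunE.
- by constructor 4; exists k => w; rewrite ffunE.
Qed.

End SumVertices.

Section Translations.
Variables (s : nat) (Q Y : Type) (C : cubesys Q) (b : Q -> Y).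
Hypotheses (ax : cubespace_axioms C b) (deg : has_degree s C b).

Lemma cube_ext (I : finType) (c c' : vert I -> Q) :
  C c -> (forall v, c v = c' v) -> C c'.
Proof. by move=> + /funext <-. Qed.

Lemma cube_cst (I : finType) (x : Q) : C (fun _ : vert I => x).
Proof.
have H := ax_comp ax (vert_morphism_cst I (vone unit)) (ax_edge ax x x).
by apply: cube_ext H _ => v; rewrite /edge; case: ifP.
Qed.

(** Choose [s.+1] directions in the support of [w] and freeze all others at their value in [w]: this
    gives a face of dimension [s.+1] with top [w], whose other vertices lie strictly below [w]. *)
Lemma degree_vertex (I : finType) (c c' : vert I -> Q) (w : vert I) :
  C c -> C c' -> (s < #|vsupp w|)%N ->
  (forall v, vmeet v w != w -> c (vmeet v w) = c' (vmeet v w)) ->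
  b (c w) = b (c' w) -> c w = c' w.
Proof.
move=> Cc Cc' sw cc' bcc'.
have [i0 i0w] : exists i, i \in vsupp w by apply/card_gt0P; exact: leq_trans sw.
pose f (k : 'I_s.+1) := nth i0 (enum (vsupp w)) k.
have f_inj : injective f.
  have ks (k : 'I_s.+1) : (k < size (enum (vsupp w)))%N.
    by rewrite -cardE; exact: leq_trans (ltn_ord k) sw.
  by move=> k k' /eqP; rewrite nth_uniq ?enum_uniq ?ks// => /eqP/val_inj.
have fw k : w (f k).
  have : f k \in vsupp w.
    by rewrite -mem_enum mem_nth// -cardE; exact: leq_trans (ltn_ord k) sw.
  by rewrite inE.
pose phi (u : vert 'I_s.+1) : vert I :=
  [ffun j => if [pick k | f k == j] is Some k then u k else w j].
have mphi : vert_morphism phi.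
  move=> j; case: (pickP (fun k => f k == j)) => [k fk|nk].
    constructor 3; exists k => u; rewrite ffunE.
    by case: pickP => [k' /eqP fk'|/(_ k)]; rewrite ?fk//; congr (u _); apply: f_inj;
      rewrite fk' (eqP fk).
  case wj: (w j); [constructor 2|constructor 1] => u; rewrite ffunE;
    by case: pickP => [k'|]; rewrite ?nk.
have phif u k : phi u (f k) = u k.
  rewrite ffunE; case: pickP => [k' /eqP/f_inj->//|/(_ k)]; by rewrite eqxx.
have phi1 : phi (vone _) = w.
  apply/ffunP => j; rewrite ffunE; case: pickP => [k /eqP <-|//].
  by rewrite ffunE fw.
have phile u : vmeet (phi u) w = phi u.
  apply/ffunP => j; rewrite !ffunE; case: pickP => [k /eqP <-|_]; last by rewrite andbb.
  by rewrite fw andbT.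
have agree u : u != vone _ -> c (phi u) = c' (phi u).
  move=> /neq_vone[k uk]; rewrite -phile; apply: cc'.
  by rewrite phile; apply/eqP => pw; have := fw k; rewrite -pw phif uk.
have := deg (ax_comp ax mphi Cc) (ax_comp ax mphi Cc').
rewrite phi1; apply => // u.
by have [->|/agree->] := eqVneq u (vone _); rewrite ?phi1.
Qed.

Lemma degree_top (I : finType) (c c' : vert I -> Q) :
  C c -> C c' -> (s < #|I|)%N ->
  (forall v, v != vone I -> c v = c' v) ->
  b (c (vone I)) = b (c' (vone I)) -> c (vone I) = c' (vone I).
Proof.
move=> Cc Cc' sI cc'; apply: degree_vertex => //; first by rewrite vone_supp cardsT.
by move=> v; rewrite vmeet1; apply: cc'.
Qed.

(** Glue the reflection of [e] in direction [i] to [set_top e z]: both outer faces are then the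
    upper face of [e], and only the top is changed. *)
Lemma set_top_glue (I : finType) (i : I) (e : vert I -> Q) z :
  C e -> C (set_top e z) -> C (set_top (fun v => e (vset i true v)) z).
Proof.
move=> Ce Cez; have Cf := ax_comp ax (vert_morphism_flip i) Ce.
apply: cube_ext (ax_glue ax (i := i) Cf Cez _) _ => v.
  rewrite /set_top (negbTE (vset_false_neq_top _ _)) /vflip.
  by rewrite vsetE eqxx vset_vset.
rewrite /set_top /vflip; case vi: (v i); first by rewrite -[X in vset i X v]vi vset_id.
by case: eqP => // v1; move: vi; rewrite v1 ffunE.
Qed.

(* Two cubes agreeing off the top have tops related by a corner that is constant
   off the top: glueing collapses one direction at a time. *)
Lemma set_top_cst (I : finType) (e : vert I -> Q) z :
  C e -> C (set_top e z) -> C (set_top (fun _ : vert I => e (vone I)) z).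
Proof.
move=> Ce Cez.
have H (l : seq I) : forall e' : vert I -> Q, C e' -> C (set_top e' z) ->
    C (set_top (fun v => e' (foldr (fun i => vset i true) v l)) z).
  elim: l => [//|i l IH] e' Ce' Cez' /=; apply: (IH (fun v => e' (vset i true v))).
    exact: (ax_comp ax (vert_morphism_vset i true) Ce').
  exact: set_top_glue.
apply: cube_ext (H (enum I) _ Ce Cez) _ => v; rewrite /set_top; case: eqP => // _.
congr e; apply/ffunP => i; rewrite ffunE.
have : i \in enum I by rewrite mem_enum.
elim: (enum I) => //= j l IH; rewrite inE vsetE; case: eqP => //= _; exact: IH.
Qed.

(* These form the structure group of the fibration: they may be applied to any face
   [psi v = vone] of codimension at most [s]. *)
Definition translation (g : Q -> Q) : Prop :=
  (forall x, b (g x) = b x) /\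
  forall (I : finType) (psi : vert I -> vert 'I_s) (e : vert I -> Q),
    vert_morphism psi -> C e ->
    C (fun v => if psi v == vone 'I_s then g (e v) else e v).

Lemma translation_id : translation id.
Proof.
by split=> // I psi e _ Ce; apply: cube_ext Ce _ => v; case: (psi v == _).
Qed.

Lemma translation_comp g h :
  translation g -> translation h -> translation (g \o h).
Proof.
move=> [bg Cg] [bh Ch]; split=> [x|I psi e mpsi Ce]; first by rewrite /= bg bh.
have H := Cg _ _ _ mpsi (Ch _ _ _ mpsi Ce).
apply: cube_ext H _ => v.
by case: (psi v == _).
Qed.

(** A cube of dimension [s.+1] joining two corners, one constantly [x] with top [z], one constantly
    [y] with top [w]. Being a cube says that [z] is obtained from [x] by the same translation as [w]
    from [y]. *)
Definition square (x z y w : Q) (v : vert (unit + 'I_s)%type) : Q :=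
  if vinr v == vone 'I_s then (if v (inl tt) then w else z)
  else (if v (inl tt) then y else x).

Lemma card_square : (s < #|{: unit + 'I_s}|)%N.
Proof. by rewrite card_sum card_unit card_ord. Qed.

Lemma vone_square (v : vert (unit + 'I_s)%type) :
  (v == vone _) = v (inl tt) && (vinr v == vone 'I_s).
Proof.
rewrite vone_sum; congr andb; apply/eqP/idP => [/ffunP/(_ tt)|vt].
  by rewrite !ffunE => ->.
by apply/ffunP => -[]; rewrite !ffunE.
Qed.

Lemma edge_cube (I : finType) (i : I) x y :
  C (fun v : vert I => if v i then y else x).
Proof.
have m := vert_morphism_comap (fun _ : unit => i).
by apply: cube_ext (ax_comp ax m (ax_edge ax x y)) _ => v; rewrite /edge ffunE.
Qed.

Lemma square_translation g x y : translation g -> C (square x (g x) y (g y)).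
Proof.
move=> [_ Cg].
have := Cg _ _ _ (@vert_morphism_inr unit 'I_s) (edge_cube (inl tt) x y).
by move=> /cube_ext; apply => v; rewrite /square; case: ifP; case: ifP.
Qed.

Lemma square_unique x z y w w' : b w = b w' ->
  C (square x z y w) -> C (square x z y w') -> w = w'.
Proof.
move=> bw Cw Cw'; have := degree_top Cw Cw' card_square.
have E u : square x z y u (vone _) = u.
  have := vone_square (vone _); rewrite eqxx => /esym/andP[v1 v2].
  by rewrite /square v1 v2.
rewrite !E; apply=> // v; rewrite vone_square negb_and /square.
by case: (v (inl tt)) => //= /negbTE->.
Qed.

(** The action is free: [square x (g x) y _] has a single completion in the fibre of [y]. *)
Lemma translation_eq g h x : translation g -> translation h ->
  g x = h x -> forall y, g y = h y.
Proof.
move=> Tg Th gx y; apply: (@square_unique x (g x) y).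
- by rewrite (proj1 Tg) (proj1 Th).
- exact: square_translation.
- by rewrite gx; exact: square_translation.
Qed.

Lemma translation_corner g x : translation g -> C (set_top (fun _ : vert 'I_s => x) (g x)).
Proof. by move=> [_ Cg]; exact: Cg (@vert_morphism_id _) (cube_cst _ x). Qed.

Lemma square_flip x z y w : C (square x z y w) -> C (square y w x z).
Proof.
move=> Cs; apply: cube_ext (ax_comp ax (vert_morphism_flip (inl tt)) Cs) _ => v.
rewrite /square /vflip vinr_vset_inl vsetE eqxx.
by case: (v (inl tt)).
Qed.

Lemma square_glue x z y w u t :
  C (square x z y w) -> C (square y w u t) -> C (square x z u t).
Proof.
move=> C1 C2; apply: cube_ext (ax_glue ax (i := inl tt) C1 C2 _) _ => v.
  by rewrite /square !vinr_vset_inl !vsetE eqxx.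
by rewrite /square; case: (v (inl tt)).
Qed.

Section Extension.
Variables (x z : Q) (g : Q -> Q).
Hypotheses (bg : forall y, b (g y) = b y)
  (Cg : forall y y', C (square y (g y) y' (g y'))).

(* The top vertex is the only one that the corner does not determine; it is identified
   by uniqueness on the square spanned by the diagonal of [I]. *)
Lemma shear_cube n (I : finType) (e : vert I -> Q) : #|I| = n -> C e ->
  C (fun v : vert (I + 'I_s)%type =>
       if vinr v == vone 'I_s then g (e (vinl v)) else e (vinl v)).
Proof.
elim: n I e => [|n IH] I e cI Ce.
  have ev u : e u = e (vone I).
    by congr e; apply/ffunP => i; have := card0_eq cI i; rewrite inE.
  have m := vert_morphism_pair (vert_morphism_cst _ (vone unit)) (@vert_morphism_inr I 'I_s).
  apply: cube_ext (ax_comp ax m (Cg (e (vone I)) (e (vone I)))) _ => v.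
  by rewrite /square vpairr !ev; case: ifP; case: ifP.
pose lam (v : vert (I + 'I_s)%type) :=
  if vinr v == vone 'I_s then g (e (vinl v)) else e (vinl v).
have CI := ax_comp ax (@vert_morphism_inl I 'I_s) Ce.
have [] := ax_fib ax (lam := lam) _ CI.
(* A face in a direction of ['I_s] never meets the top of that factor, so it is a copy of [e]; a
   face in a direction of [I] is the induction hypothesis. *)
- move=> [i|k]; last first.
    apply: cube_ext CI _ => v; rewrite /lam vinr_vset_inr.
    by rewrite (negbTE (vset_false_neq_top _ _)) vinl_vset_inr.
  pose I' := {j : I | j != i}.
  pose inc (u : vert I') : vert I :=
    [ffun j => if insub j is Some k then u k else false].
  have minc : vert_morphism inc.
    move=> j; case: (insubP I' j) => [k _ <-|ji].
      by constructor 3; exists k => w; rewrite ffunE valK.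
    by constructor 1 => w; rewrite ffunE insubN.
  have cI' : #|{: I'}| = n.
    have := cardC1 i; rewrite cI => /= <-.
    by rewrite card_sig; apply: eq_card => j; rewrite !inE.
  have m := vert_morphism_pair
    (vert_morphism_comp (vert_morphism_comap (val : I' -> I)) (@vert_morphism_inl I 'I_s))
    (@vert_morphism_inr I 'I_s).
  apply: cube_ext (ax_comp ax m (IH _ _ cI' (ax_comp ax minc Ce))) _ => v /=.
  rewrite vpairr vpairl /lam vinr_vset_inl vinl_vset_inl.
  suff -> : inc [ffun j => vinl v (val j)] = vset i false (vinl v) by [].
  apply/ffunP => j; rewrite !ffunE; case: (insubP I' j) => [k kj <-|].
    by rewrite ffunE (negbTE (valP k)) ffunE.
  by rewrite negbK => ->.
- by move=> v _; rewrite /lam; case: ifP => // _; rewrite bg.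
move=> w bw Cw; apply: (cube_ext Cw) => v; rewrite /set_top.
case: eqP => // ->; have := vone_sum (vone (I + 'I_s)%type).
rewrite eqxx => /esym/andP[/eqP v1 v2]; rewrite v1 v2 /=.
have [i0 _] : exists i, i \in I by apply/card_gt0P; rewrite cI.
pose rho (u : vert (unit + 'I_s)%type) : vert (I + 'I_s)%type :=
  vpair [ffun=> u (inl tt)] (vinr u).
have mrho : vert_morphism rho.
  apply: vert_morphism_pair; last exact: vert_morphism_inr.
  by move=> i; constructor 3; exists (inl tt) => u; rewrite ffunE.
apply: (@square_unique (e [ffun=> false]) (g (e [ffun=> false])) (e (vone I))) => //.
  by rewrite bw bg v1.
apply: cube_ext (ax_comp ax mrho Cw) _ => u.
have r1 : (rho u == vone _) = (u == vone _).
  rewrite vone_sum vone_square /rho vpairl vpairr; congr andb.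
  apply/eqP/idP => [/ffunP/(_ i0)|ut]; first by rewrite !ffunE.
  by apply/ffunP => i; rewrite !ffunE ut.
rewrite /set_top r1 vone_square /square /lam /rho vpairl vpairr.
case: (u (inl tt)) => /=.
  by rewrite -/(vone I); case: (vinr u == _).
by [].
Qed.

(** Pull the sheared cube back along the graph of [psi]. *)
Lemma translation_of_squares : translation g.
Proof.
split=> // I psi e mpsi Ce.
have m := vert_morphism_pair (@vert_morphism_id I) mpsi.
apply: cube_ext (ax_comp ax m (shear_cube erefl Ce)) _ => v.
by rewrite vpairl vpairr.
Qed.

End Extension.

(** The value at [y] is the completion of [square x z y _] in the fibre of [y]. Squares for two
    arbitrary points [y] and [y'] come from glueing along the common edge at [x]. *)
Lemma translation_exists x z : b z = b x ->
  C (set_top (fun _ : vert 'I_s => x) z) -> exists2 g, translation g & g x = z.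
Proof.
move=> bz Cxz.
have mr := @vert_morphism_inr unit 'I_s.
have ex y : exists w, b w = b y /\ C (square x z y w).
  have [] := ax_fib ax (lam := square x z y y) _ (edge_cube (inl tt) x y).
  - move=> [[]|k].
      apply: cube_ext (ax_comp ax mr Cxz) _ => v.
      by rewrite /square vinr_vset_inl vsetE eqxx /set_top; case: ifP.
    apply: cube_ext (edge_cube (inl tt) x y) _ => v.
    rewrite /square vinr_vset_inr (negbTE (vset_false_neq_top _ _)).
    by rewrite vsetE.
  - by move=> v _; rewrite /square; case: ifP => //; case: ifP.
  move=> w; have := vone_square (vone _); rewrite eqxx => /esym/andP[-> _] bw Cw.
  exists w; split=> //; apply: cube_ext Cw _ => v.
  rewrite /set_top vone_square /square.
  by case: (v (inl tt)); case: (vinr v == _).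
have /choice[g Hg] := ex; exists g.
  apply: translation_of_squares => [y|y y']; first by case: (Hg y).
  exact: square_glue (square_flip (proj2 (Hg y))) (proj2 (Hg y')).
have [bgx Cgx] := Hg x; apply: (square_unique _ Cgx); first by rewrite bgx.
apply: cube_ext (ax_comp ax mr Cxz) _ => v.
by rewrite /square /set_top; case: (v (inl tt)); case: ifP.
Qed.

Definition vertical x z := exists2 g, translation g & z = g x.

(** The right-hand side does not quantify over translations: it is a closed condition on the pair,
    and set in this form the relation can be reversed with [set_top_cst]. *)
Lemma verticalP x z :
  vertical x z <-> b z = b x /\ C (set_top (fun _ : vert 'I_s => x) z).
Proof.
split=> [[g Tg ->]|[bz Cz]].
  by split; [case: Tg|exact: translation_corner].
by have [g Tg <-] := translation_exists bz Cz; exists g.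
Qed.

Lemma vertical_refl x : vertical x x.
Proof. by exists id => //; exact: translation_id. Qed.

Lemma vertical_sym x z : vertical x z -> vertical z x.
Proof.
rewrite !verticalP => -[bz Cz]; split=> //.
have := set_top_cst Cz; rewrite /set_top eqxx; apply.
apply: cube_ext (cube_cst _ x) _ => v.
by case: (v == _).
Qed.

Lemma vertical_trans x y z : vertical x y -> vertical y z -> vertical x z.
Proof.
move=> [g Tg ->] [h Th ->]; exists (h \o g) => //; exact: translation_comp.
Qed.

Lemma vertical_fiber x z : vertical x z -> b z = b x.
Proof. by case/verticalP. Qed.

Lemma translation_inverse g (x : Q) : translation g ->
  exists2 h, translation h & forall y, h (g y) = y.
Proof.
move=> Tg; have [|h Th hx] := @vertical_sym x (g x); first by exists g.
exists h => // y; apply: (@translation_eq (h \o g) id x) => //.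
  exact: translation_comp.
exact: translation_id.
Qed.

(** On a product of two cubes of dimension [s], apply [g] over the top of one factor and [h] over
    the top of the other. The order matters only at the common top, which is unique because
    [s + s > s]. *)
Lemma translationC g h (x : Q) : (0 < s)%N -> translation g -> translation h ->
  g (h x) = h (g x).
Proof.
move=> s0 Tg Th.
have [[bg Cg] [bh Ch]] := (Tg, Th).
have ml := @vert_morphism_inl 'I_s 'I_s; have mr := @vert_morphism_inr 'I_s 'I_s.
have C0 := cube_cst ('I_s + 'I_s)%type x.
have := degree_top (Cg _ _ _ ml (Ch _ _ _ mr C0)) (Ch _ _ _ mr (Cg _ _ _ ml C0)).
have := vone_sum (vone ('I_s + 'I_s)%type); rewrite eqxx => /esym/andP[-> ->].
apply; last by rewrite bg !bh bg.
  by rewrite card_sum card_ord -{1}[s]addn0 ltn_add2l.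
by move=> v; rewrite vone_sum; case: ifP; case: ifP.
Qed.

End Translations.

(** * Vertical shifts and the quotient of degree one less *)

Definition downset (I : finType) (D : {set vert I}) : Prop :=
  forall v w, w \in D -> vmeet v w \in D.

Lemma downsetU1 (I : finType) (D : {set vert I}) (w : vert I) :
  downset D -> (forall v, vmeet v w != w -> vmeet v w \in D) -> downset (w |: D).
Proof.
move=> dD lt v u; rewrite !inE => /predU1P[->|uD]; last by rewrite dD// orbT.
by have [//|/lt->] := eqVneq (vmeet v w) w; rewrite orbT.
Qed.

Lemma exists_minimal (I : finType) (D : {set vert I}) (w0 : vert I) : w0 \in D ->
  exists2 w, w \in D & forall v, vmeet v w != w -> vmeet v w \notin D.
Proof.
move=> w0D; pose P := [pred v | v \in D]; have P0 : P w0 by [].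
have [w wD wmin] := arg_minnP (fun v : vert I => #|vsupp v|) P0.
exists w => // v vw; apply: contraTN (vmeet_neq_size vw) => vwD.
by rewrite -leqNgt; exact: wmin.
Qed.

(** * Lifting cubes along a map with the corner-filling property *)

Section DownsetLifting.
Variables (Q1 Q2 : Type) (C1 : cubesys Q1) (C2 : cubesys Q2) (m : Q1 -> Q2).
Hypothesis comp1 : forall (I J : finType) (phi : vert I -> vert J) (c : vert J -> Q1),
  vert_morphism phi -> C1 c -> C1 (fun v => c (phi v)).
Hypothesis comp2 : forall (I J : finType) (phi : vert I -> vert J) (c : vert J -> Q2),
  vert_morphism phi -> C2 c -> C2 (fun v => c (phi v)).
Hypothesis fib : forall (I : finType) (lam : vert I -> Q1) (e : vert I -> Q2),
  (forall i : I, C1 (fun v => lam (vset i false v))) -> C2 e ->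
  (forall v, v != vone I -> m (lam v) = e v) ->
  exists2 w, m w = e (vone I) & C1 (set_top lam w).

(** The face below [w] is a cube indexed by the support of [w]. All its vertices but [w] are already
    lifted and form a corner, which [fib] fills. *)
Lemma lift_vertex (I : finType) (d : vert I -> Q2) (lam : vert I -> Q1) (w : vert I) :
  C2 (fun v => d (vmeet v w)) ->
  (forall v, vmeet v w != w -> C1 (fun u => lam (vmeet u (vmeet v w))) /\
     m (lam (vmeet v w)) = d (vmeet v w)) ->
  exists2 z, m z = d w &
    C1 (fun v => if vmeet v w == w then z else lam (vmeet v w)).
Proof.
move=> Cd Clam; pose I' := {i : I | w i}.
pose inc (u : vert I') : vert I := [ffun j => if insub j is Some k then u k else false].
pose res (v : vert I) : vert I' := [ffun k => v (val k)].
have minc : vert_morphism inc.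
  move=> j; case: (insubP I' j) => [k _ <-|ji].
    by constructor 3; exists k => u; rewrite ffunE valK.
  by constructor 1 => u; rewrite ffunE insubN.
have mres : vert_morphism res by exact: vert_morphism_comap.
have incres v : inc (res v) = vmeet v w.
  apply/ffunP => j; rewrite !ffunE; case: (insubP I' j) => [k _ <-|].
    by rewrite ffunE (valP k) andbT.
  by move/negbTE->; rewrite andbF.
have incw u : vmeet (inc u) w = inc u.
  apply/ffunP => j; rewrite !ffunE; case: (insubP I' j) => [k _ <-|//].
  by rewrite (valP k) andbT.
have inc1 : inc (vone _) = w.
  apply/ffunP => j; rewrite ffunE; case: (insubP I' j) => [k _ <-|/negbTE->//].
  by rewrite ffunE (valP k).
have res1 v : (res v == vone _) = (vmeet v w == w).
  apply/eqP/eqP => [r1|r]; first by rewrite -incres r1.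
  apply/ffunP => k; rewrite !ffunE; have /ffunP/(_ (val k)) := r.
  by rewrite ffunE (valP k) andbT => ->.
have lt u : u != vone _ -> vmeet (inc u) w != w.
  move=> /neq_vone[k uk]; apply/eqP => /ffunP/(_ (val k)).
  by rewrite incw ffunE valK uk (valP k).
have [] := fib (lam := fun u => lam (inc u)) (e := fun u => d (inc u)).
- move=> k; have kw : vmeet (vset (val k) false w) w != w.
    apply/eqP => /ffunP/(_ (val k)).
    by rewrite ffunE vsetE eqxx (valP k).
  have [C1k _] := Clam _ kw; have := comp1 minc C1k.
  congr C1; apply/funext => u; congr lam; apply/ffunP => j; rewrite !ffunE.
  case: (insubP I' j) => [k' _ <-|//]; rewrite ffunE (inj_eq val_inj) (valP k') andbT.
  by case: eqP; rewrite ?andbF ?andbT.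
- by have := comp2 minc Cd; congr C2; apply/funext => u; rewrite incw.
- by move=> u /lt; rewrite -{2 3}[inc u]incw => /Clam[].
move=> z mz Cz; exists z; first by rewrite mz inc1.
have := comp1 mres Cz; congr C1; apply/funext => v.
by rewrite /set_top res1 incres.
Qed.

(** Add a minimal vertex of the complement at each step: everything strictly below it is already
    lifted, so [lift_vertex] applies, and the domain stays a downset. *)
Lemma lift_downset (I : finType) (d : vert I -> Q2) (D D' : {set vert I})
    (lam : vert I -> Q1) :
  downset D -> downset D' -> D \subset D' ->
  (forall w, w \in D' -> C2 (fun v => d (vmeet v w))) ->
  (forall w, w \in D -> C1 (fun v => lam (vmeet v w)) /\ m (lam w) = d w) ->
  exists lam', (forall w, w \in D -> lam' w = lam w) /\
    forall w, w \in D' -> C1 (fun v => lam' (vmeet v w)) /\ m (lam' w) = d w.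
Proof.
move=> + dD' + Cd; have [n] := ubnP #|D' :\: D|; elim: n D lam => // n IH D lam.
rewrite ltnS => Dn dD DD' Clam.
have [D'D|[w0 w0D]] := finset.set_0Vmem (D' :\: D).
  exists lam; split=> // w wD'; apply: Clam.
  have : w \notin D' :\: D by rewrite D'D finset.in_set0.
  by rewrite inE wD' andbT negbK.
have [w wD wmin] := exists_minimal w0D.
have [wnD wD'] : w \notin D /\ w \in D' by move: wD; rewrite inE => /andP.
have lt v : vmeet v w != w -> vmeet v w \in D.
  by move=> /wmin; rewrite inE dD'// andbT negbK.
have [z mz Cz] := lift_vertex (lam := lam) (Cd _ wD') (fun v vw => Clam _ (lt v vw)).
pose lam1 v := if v == w then z else lam v.
have lam1D v : v \in D -> lam1 v = lam v.
  by rewrite /lam1; case: eqP => // ->; rewrite (negbTE wnD).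
have [| | | |lam' [lam'D lam'P]] := IH (w |: D) lam1.
- apply: leq_trans Dn; apply: proper_card; apply/properP; split.
    by apply: finset.setDS; apply: finset.subsetUr.
  by exists w; rewrite ?inE ?eqxx// wnD.
- exact: downsetU1.
- by rewrite finset.subUset finset.sub1set wD'.
- move=> u; rewrite !inE => /predU1P[->|uD].
    by split; [have := Cz; congr C1; apply/funext => v|rewrite /lam1 eqxx].
  have [Cu mu] := Clam u uD; split; last by rewrite lam1D.
  by have := Cu; congr C1; apply/funext => v; rewrite lam1D// dD.
by exists lam'; split=> // u uD; rewrite lam'D ?lam1D// !inE uD orbT.
Qed.

Lemma lift_cube (I : finType) (d : vert I -> Q2) : (exists lam : vert I -> Q1, True) ->
  C2 d -> exists2 c, C1 c & forall v, m (c v) = d v.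
Proof.
move=> [lam0 _] Cd; have [|||||lam [_ lamP]] := @lift_downset I d finset.set0 finset.setT lam0.
- by move=> v w; rewrite finset.in_set0.
- by move=> v w; rewrite !finset.in_setT.
- exact: finset.sub0set.
- by move=> w _; exact: comp2 (vert_morphism_meet w) Cd.
- by move=> w; rewrite finset.in_set0.
exists lam => [|v]; last by have [] := lamP v (finset.in_setT _).
have [C _] := lamP (vone I) (finset.in_setT _).
by have := C; congr C1; apply/funext => v; rewrite vmeet1.
Qed.

Lemma lift_cube_face (I : finType) (i : I) (d : vert I -> Q2) (p : vert I -> Q1) :
  C2 d -> C1 p -> (forall v, m (p (vset i false v)) = d (vset i false v)) ->
  exists c, [/\ C1 c, forall v, m (c v) = d v &
    forall v, c (vset i false v) = p (vset i false v)].
Proof.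
move=> Cd Cp pd.
have [|||||lam [lamD lamP]] := @lift_downset I d [set v : vert I | ~~ v i]%SET finset.setT p.
- by move=> v w; rewrite !inE ffunE => /negbTE->; rewrite andbF.
- by move=> v w; rewrite !finset.in_setT.
- exact: finset.subsetT.
- by move=> w _; exact: comp2 (vert_morphism_meet w) Cd.
- move=> w; rewrite inE => /negbTE wi; split; first exact: comp1 (vert_morphism_meet w) Cp.
  by rewrite -(vset_id i w) wi pd.
exists lam; split=> [|v|v]; last by apply: lamD; rewrite inE vsetE eqxx.
  have [C _] := lamP (vone I) (finset.in_setT _).
  by have := C; congr C1; apply/funext => v; rewrite vmeet1.
by have [] := lamP v (finset.in_setT _).
Qed.

(** This reduces filling a corner of the quotient to filling a corner upstairs. *)
Lemma lift_corner (I : finType) (d : vert I -> Q2) : (exists lam : vert I -> Q1, True) ->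
  (forall i : I, C2 (fun v => d (vset i false v))) ->
  exists lam : vert I -> Q1, (forall i : I, C1 (fun v => lam (vset i false v))) /\
    forall v, v != vone I -> m (lam v) = d v.
Proof.
move=> [lam0 _] Cd.
have [|||||lam [_ lamP]] :=
    @lift_downset I d finset.set0 [set v : vert I | v != vone I]%SET lam0.
- by move=> v w; rewrite finset.in_set0.
- move=> v w; rewrite !inE => /neq_vone[i wi]; apply/eqP => /ffunP/(_ i).
  by rewrite !ffunE wi andbF.
- exact: finset.sub0set.
- move=> w; rewrite inE => /neq_vone[i wi].
  have := comp2 (vert_morphism_meet w) (Cd i); congr C2; apply/funext => v.
  by rewrite -vmeet_vset -{2}(vset_id i w) wi.
- by move=> w; rewrite finset.in_set0.
exists lam; split=> [i|v vN1]; last by have [|] := lamP v; rewrite ?inE.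
have [|C _] := lamP (vset i false (vone I)).
  by rewrite inE vset_false_neq_top.
by have := C; congr C1; apply/funext => v; rewrite -vset_meet.
Qed.

End DownsetLifting.

Section Shifts.
Variables (s : nat) (Q Y : Type) (C : cubesys Q) (b : Q -> Y).
Hypotheses (ax : cubespace_axioms C b) (deg : has_degree s C b).

Local Notation translation := (translation s C b).
Local Notation vertical := (vertical s C b).

(* For [c] a cube these [h] parametrize the cubes in the same fibre of the top quotient,
   see [vertical_shift]; closure under pullback is built into the definition. *)
Definition shift (I : finType) (h : vert I -> Q -> Q) : Prop :=
  (forall v, translation (h v)) /\
  forall (J : finType) (phi : vert J -> vert I) (e : vert J -> Q),
    vert_morphism phi -> C e -> C (fun v => h (phi v) (e v)).

Lemma shift_cube (I : finType) (h : vert I -> Q -> Q) (e : vert I -> Q) :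
  shift h -> C e -> C (fun v => h v (e v)).
Proof. by move=> [_ Ch] Ce; exact: Ch (@vert_morphism_id I) Ce. Qed.

Lemma shift_comap (I J : finType) (phi : vert J -> vert I) (h : vert I -> Q -> Q) :
  vert_morphism phi -> shift h -> shift (fun v => h (phi v)).
Proof.
move=> mphi [Th Ch]; split=> // K psi e mpsi; apply: (Ch _ (phi \o psi)).
exact: vert_morphism_comp.
Qed.

Lemma shift_comp (I : finType) (h k : vert I -> Q -> Q) :
  shift h -> shift k -> shift (fun v => h v \o k v).
Proof.
move=> [Th Ch] [Tk Ck]; split=> [v|J phi e mphi Ce]; first exact: translation_comp.
exact: Ch mphi (Ck _ _ _ mphi Ce).
Qed.

Lemma shift_face (I : finType) (S : {set I}) g : (#|S| <= s)%N -> translation g ->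
  shift (fun v => if S \subset vsupp v then g else id).
Proof.
move=> Ss Tg; split=> [v|J phi e mphi Ce].
  by case: ifP => // _; exact: translation_id.
have [psi mpsi psiE] := face_morphism Ss.
have := proj2 Tg _ _ _ (vert_morphism_comp mpsi mphi) Ce.
by congr C; apply/funext => v; rewrite /= psiE; case: ifP.
Qed.

Lemma shift_cst (I : finType) g : translation g -> shift (fun _ : vert I => g).
Proof.
move=> Tg; have := @shift_face I finset.set0 g; rewrite cards0 => /(_ isT Tg).
by congr shift; apply/funext => v; rewrite finset.sub0set.
Qed.

Lemma shift_id (I : finType) : shift (fun _ : vert I => id).
Proof. by apply: shift_cst; exact: translation_id. Qed.

(** Correct the vertices upwards, [D] being those that already agree. At a vertex [w] of weight at
    most [s], apply the required translation on the whole face above [w], which does not meet [D].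
    At a vertex of larger weight uniqueness forces agreement. *)
Lemma vertical_shift (I : finType) (c c' : vert I -> Q) : C c -> C c' ->
  (forall v, vertical (c v) (c' v)) ->
  exists2 h, shift h & forall v, c' v = h v (c v).
Proof.
move=> + Cc'.
suff H n (D : {set vert I}) c0 : (#|~: D| < n)%N -> downset D ->
    (forall v, v \in D -> c0 v = c' v) -> C c0 -> (forall v, vertical (c0 v) (c' v)) ->
    exists2 h, shift h & forall v, c' v = h v (c0 v).
  move=> Cc; apply: (H _ finset.set0 c (leqnn _)) => // [v w|v]; by rewrite inE.
elim: n D c0 => // n IH D c0; rewrite ltnS => Dn dD c0D Cc0 vc0.
have [D0|[w0 w0D]] := finset.set_0Vmem (~: D).
  exists (fun=> id); first exact: shift_id.
  move=> v; rewrite c0D//; have : v \notin ~: D by rewrite D0 finset.in_set0.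
  by rewrite inE negbK.
have [w wD wmin] := exists_minimal w0D.
have lt v : vmeet v w != w -> vmeet v w \in D.
  by move=> /wmin; rewrite inE negbK.
have [g Tg cw] := vc0 w; rewrite inE in wD.
have proper : (#|~: (w |: D)| < #|~: D|)%N.
  apply: proper_card; apply/properP; split.
    by rewrite finset.setCS finset.subsetUr.
  by exists w; rewrite !inE ?eqxx// wD.
have dD1 := downsetU1 dD lt.
have [ws|sw] := leqP #|vsupp w| s; last first.
  apply: (IH (w |: D)) => //; first exact: leq_trans Dn.
  move=> v; rewrite !inE => /predU1P[->|/c0D//].
  apply: (degree_vertex ax deg Cc0 Cc' sw) => [v' v'w|]; first exact/c0D/lt.
  by rewrite cw (proj1 Tg).
have Sk := shift_face ws Tg; set k := fun v => _ in Sk.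
have subw v : (vsupp w \subset vsupp v) -> vmeet v w = w.
  move=> /fintype.subsetP sub; apply/ffunP => i; rewrite ffunE.
  by case wi: (w i); rewrite ?andbF//; have := sub i; rewrite !inE wi => ->.
have kD v : v \in D -> k v = id.
  move=> vD; rewrite /k; case: ifP => // /subw vw; move: wD.
  by rewrite -vw vmeetC dD.
have [| | | | |h Sh hc] := IH (w |: D) (fun v => k v (c0 v)) => //.
- exact: leq_trans Dn.
- move=> v; rewrite !inE => /predU1P[->|vD]; last by rewrite kD// c0D.
  by rewrite /k fintype.subxx.
- exact: shift_cube.
- move=> v; apply: (vertical_trans _ (vc0 v)); apply: (vertical_sym ax deg).
  by exists (k v) => //; case: Sk.
by exists (fun v => h v \o k v); first exact: shift_comp.
Qed.

(* Directions are treated one at a time: the shift correcting the face [v i = false]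
   is pulled back along the projection to that face, hence is trivial wherever the
   previous faces already agree. *)
Lemma vertical_fill (I : finType) (lam e : vert I -> Q) :
  (forall i : I, C (fun v => lam (vset i false v))) -> C e ->
  (forall v, v != vone I -> vertical (e v) (lam v)) ->
  exists c, [/\ C c, forall v, v != vone I -> c v = lam v &
    forall v, vertical (e v) (c v)].
Proof.
move=> Clam Ce elam.
suff [c [Cc ec cl]] : exists c, [/\ C c, forall v, vertical (e v) (c v) &
    forall i (v : vert I), i \in enum I -> v i = false -> c v = lam v].
  exists c; split=> // v /neq_vone[i vi]; apply: (cl i) => //.
  by rewrite mem_enum.
elim: (enum I) => [|i l [c [Cc ec cl]]].
  by exists e; split=> // v; exact: vertical_refl.
have [||| h Sh hc] := @vertical_shift I (fun v => c (vset i false v))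
    (fun v => lam (vset i false v)).
- exact: (ax_comp ax (vert_morphism_vset i false) Cc).
- exact: Clam.
- move=> v; apply: (@vertical_trans _ _ _ _ _ _ (e (vset i false v))).
    exact: (vertical_sym ax deg).
  by apply: elam; exact: vset_false_neq_top.
exists (fun v => h (vset i false v) (c v)); split.
- exact: (shift_cube (shift_comap (vert_morphism_vset i false) Sh) Cc).
- move=> v; apply: (vertical_trans (ec v)); exists (h (vset i false v)) => //.
  by case: Sh.
move=> j v; have hi (u : vert I) : u i = false -> h (vset i false u) (c u) = lam u.
  by move=> ui; have := hc u; rewrite -[X in vset i X u]ui vset_id => ->.
rewrite inE => /predU1P[-> /hi//|jl vj].
(* The point [vset i false v] also has coordinate [j] equal to 0, where [c] was correct before. So
   the new shift fixes a point there, and by freeness it is the identity. *)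
have fix_id : h (vset i false v) (lam (vset i false v)) = lam (vset i false v).
  have := hc (vset i false v); rewrite vset_vset => {2}->.
  rewrite (cl j)// vsetE; by case: eqP.
rewrite (cl j)//.
exact: (translation_eq ax deg (proj1 Sh _) (translation_id s C b) fix_id).
Qed.

Section Quotient.
Variables (Q' : Type) (m : Q -> Q') (b' : Q' -> Y).
Hypotheses (m_surj : forall q, exists x, m x = q)
  (mP : forall x y, m x = m y <-> vertical x y)
  (b'm : forall x, b' (m x) = b x).

Definition quotient_cubes : cubesys Q' :=
  fun I c' => exists2 c : vert I -> Q, C c & forall v, m (c v) = c' v.

Lemma quotient_comp (I J : finType) (phi : vert I -> vert J) (c : vert J -> Q') :
  vert_morphism phi -> quotient_cubes c -> quotient_cubes (fun v => c (phi v)).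
Proof.
by move=> mphi [c1 Cc1 c1c]; exists (fun v => c1 (phi v)) => //; exact: (ax_comp ax mphi Cc1).
Qed.

(** The quotient map itself fills corners, so the lifting lemmas for downsets apply to it. *)
Lemma quotient_fib (I : finType) (lam : vert I -> Q) (e : vert I -> Q') :
  (forall i : I, C (fun v => lam (vset i false v))) -> quotient_cubes e ->
  (forall v, v != vone I -> m (lam v) = e v) ->
  exists2 w, m w = e (vone I) & C (set_top lam w).
Proof.
move=> Clam [e1 Ce1 e1e] lame.
have [v vN1|c [Cc cl ec]] := vertical_fill Clam Ce1.
  by apply/mP; rewrite e1e lame.
exists (c (vone I)); first by rewrite -e1e; apply/esym/mP.
have := Cc; congr C; apply/funext => v; rewrite /set_top.
by case: eqP => [->//|/eqP/cl].
Qed.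

(** Arbitrary lifts differ on the common face by a shift. Extended constantly in direction [i], it
    moves the first lift to one that matches the second. *)
Lemma quotient_glue_lift (I : finType) (i : I) (p q : vert I -> Q') :
  quotient_cubes p -> quotient_cubes q ->
  (forall v, p (vset i true v) = q (vset i false v)) ->
  exists p1 q1, [/\ C p1, C q1, forall v, m (p1 v) = p v, forall v, m (q1 v) = q v &
    forall v, p1 (vset i true v) = q1 (vset i false v)].
Proof.
move=> [p1 Cp1 p1p] [q1 Cq1 q1q] pq.
have [||| h Sh hc] := @vertical_shift I (fun v => p1 (vset i true v))
    (fun v => q1 (vset i false v)).
- exact: (ax_comp ax (vert_morphism_vset i true) Cp1).
- exact: (ax_comp ax (vert_morphism_vset i false) Cq1).
- by move=> v; apply/mP; rewrite p1p q1q.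
exists (fun v => h (vset i true v) (p1 v)), q1; split=> //.
- exact: (shift_cube (shift_comap (vert_morphism_vset i true) Sh) Cp1).
- move=> v; rewrite -p1p; apply/esym/mP; exists (h (vset i true v)) => //.
  by case: Sh.
move=> v; have := hc (vset i true v); rewrite !vset_vset => ->.
by [].
Qed.

Lemma quotient_axioms : cubespace_axioms quotient_cubes b'.
Proof.
split.
- exact: quotient_comp.
- move=> x y; have [[x1 <-] [y1 <-]] := (m_surj x, m_surj y).
  by exists (edge x1 y1) => [|v]; [exact: (ax_edge ax)|rewrite /edge; case: ifP].
- move=> I i p q Cp Cq pq.
  have [p1 [q1 [Cp1 Cq1 p1p q1q pq1]]] := quotient_glue_lift Cp Cq pq.
  exists (fun v : vert I => if v i then q1 v else p1 v); first exact: (ax_glue ax Cp1 Cq1 pq1).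
  by move=> v; case: ifP.
move=> I lam e Clam [e1 Ce1 e1e] lame.
have [|lam1 [Clam1 lam1P]] :=
    lift_corner (ax_comp ax) quotient_comp quotient_fib _ Clam.
  by exists e1.
have [v vN1|w bw Cw] := ax_fib ax Clam1 Ce1.
  by rewrite -b'm lam1P// lame// -e1e b'm.
exists (m w); first by rewrite b'm bw -e1e b'm.
exists (set_top lam1 w) => // v; rewrite /set_top; case: eqP => [//|/eqP].
exact: lam1P.
Qed.

(** Lift both cubes and move one lift within its vertical class until the two agree off the top. By
    [set_top_cst] the tops are then joined by a corner constant off the top, which is exactly
    verticality. *)
Lemma quotient_degree (c c' : vert 'I_s -> Q') :
  quotient_cubes c -> quotient_cubes c' -> (forall v, b' (c v) = b' (c' v)) ->
  (forall v, v != vone 'I_s -> c v = c' v) -> c (vone 'I_s) = c' (vone 'I_s).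
Proof.
move=> [c1 Cc1 c1c] [c2 Cc2 c2c] bcc' cc'.
have [i|v vN1|c3 [Cc3 c31 c23]] := @vertical_fill _ c1 c2 _ Cc2.
- exact: (ax_comp ax (vert_morphism_vset i false) Cc1).
- by apply/mP; rewrite c1c c2c cc'.
rewrite -c1c -c2c; have -> : m (c2 (vone _)) = m (c3 (vone _)) by exact/mP.
apply/mP/(verticalP ax deg); split.
  by rewrite -!b'm c1c -(proj2 (mP _ _) (c23 _)) c2c.
apply: (set_top_cst ax) => //; have := Cc3; congr C; apply/funext => v.
by rewrite /set_top; case: eqP => [->//|/eqP/c31].
Qed.

End Quotient.
End Shifts.

(** * Invariant means *)

Section InvariantMean.
Variables (R : realType) (S : Type).
Implicit Types (F G : S -> R) (t u : S -> S).

Definition fbounded F : Prop := exists B, forall x, `|F x| <= B.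

Record positive_functional (M : (S -> R) -> R) : Prop := {
  pf_add : forall F G, M (fun x => F x + G x) = M F + M G;
  pf_scale : forall a F, M (fun x => a * F x) = a * M F;
  pf_le : forall F B, (forall x, F x <= B) -> M F <= B
}.

Lemma pf_norm M F B : positive_functional M -> (forall x, `|F x| <= B) -> `|M F| <= B.
Proof.
move=> pM FB; rewrite ler_norml; apply/andP; split.
  rewrite lerNl -mulN1r -(pf_scale pM); apply: (pf_le pM) => x.
  by rewrite mulN1r lerNl; have := FB x; rewrite ler_norml => /andP[].
by apply: (pf_le pM) => x; exact: le_trans (ler_norm _) (FB x).
Qed.

(** Average the previous functional over the first [N] iterates of the new map. The sum telescopes
    for that map, and commutation preserves the estimates for the earlier ones. *)
Lemma almost_invariant_functional (s0 : S) (ts : nat -> S -> S) (k N : nat) :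
  (0 < N)%N -> (forall i j x, (i < k)%N -> (j < k)%N -> ts i (ts j x) = ts j (ts i x)) ->
  exists2 M, positive_functional M &
    forall i F B, (i < k)%N -> (forall x, `|F x| <= B) ->
      `|M (F \o ts i) - M F| <= 2 * B / N%:R.
Proof.
move=> N0; elim: k => [|k IH] comm.
  by exists (fun F => F s0).
have [|M pM MT] := IH; first by move=> i j x ik jk; apply: comm; rewrite ltnS ltnW.
pose t := ts k; pose M' F := N%:R^-1 * \sum_(j < N) M (F \o iter j t).
have N0' : N%:R != 0 :> R by rewrite pnatr_eq0 -lt0n.
have iN0 : 0 <= (N%:R : R)^-1 by rewrite invr_ge0 ler0n.
exists M'.
  split=> [F G|a F|F B FB].
  - rewrite /M' -mulrDr -big_split /=; congr (_ * _); apply: eq_bigr => j _.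
    exact: (pf_add pM).
  - rewrite /M' mulrCA; congr (_ * _); rewrite mulr_sumr; apply: eq_bigr => j _.
    exact: (pf_scale pM).
  - rewrite /M' ler_pdivrMl ?ltr0n//.
    apply: (@le_trans _ _ (\sum_(j < N) B)); last by rewrite sumr_const card_ord mulr_natl.
    apply: ler_sum => j _.
    by apply: (pf_le pM) => x; exact: FB.
move=> i F B; rewrite ltnS leq_eqVlt => /orP[/eqP ->|ik] FB.
  rewrite /M' -mulrBr -sumrB.
  have -> : \sum_(j < N) (M ((F \o ts k) \o iter j t) - M (F \o iter j t)) =
      M (F \o iter N t) - M F.
    rewrite -(big_mkord xpredT (fun j => M ((F \o ts k) \o iter j t) - M (F \o iter j t))).
    by rewrite -(telescope_sumr (fun j => M (F \o iter j t)) (leq0n N)).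
  rewrite normrM ger0_norm// mulrC ler_wpM2r// mulr_natl mulr2n.
  apply: le_trans (ler_normB _ _) _; apply: lerD; apply: (pf_norm pM) => x //.
  exact: FB.
rewrite /M' -mulrBr -sumrB normrM ger0_norm// ler_pdivrMl ?ltr0n// mulrC.
apply: le_trans (ler_norm_sum _ _ _) _.
apply: (@le_trans _ _ (\sum_(j < N) (2 * B / N%:R))); last first.
  by rewrite sumr_const card_ord mulr_natr.
apply: ler_sum => j _.
have -> : (F \o ts i) \o iter j t = (F \o iter j t) \o ts i.
  apply/funext => x /=; congr F; elim: (val j) => //= n <-.
  by rewrite comm// ltnS ltnW.
by apply: MT => // x; exact: FB.
Qed.

(* A limit, along an ultrafilter, of averages over ever larger boxes. *)
Lemma invariant_mean_exists (s0 : S) (T : set (S -> S)) :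
  (forall t u x, T t -> T u -> t (u x) = u (t x)) ->
  exists M : (S -> R) -> R,
    [/\ forall F G, fbounded F -> fbounded G -> M (fun x => F x + G x) = M F + M G,
        forall a F, fbounded F -> M (fun x => a * F x) = a * M F,
        forall F B, fbounded F -> (forall x, F x <= B) -> M F <= B &
        forall t F, T t -> fbounded F -> M (F \o t) = M F].
Proof.
move=> comm.
pose base (k N : nat) (ts : nat -> S -> S) : set ((S -> R) -> R) :=
  [set M | positive_functional M /\ forall i F B, (i < k)%N ->
    (forall x, `|F x| <= B) -> `|M (F \o ts i) - M F| <= 2 * B / N%:R].
(* Generated by the sets of functionals almost invariant under a finite list of maps, to precision
   of order 1/N. *)
pose Flt : set_system ((S -> R) -> R) :=
  [set P | exists k N ts, [/\ (0 < N)%N, forall i, (i < k)%N -> T (ts i) &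
    base k N ts `<=` P]].
have FltP : ProperFilter Flt.
  split.
    move=> [k [N [ts [N0 Tts sub]]]].
    have [|M pM MT] := @almost_invariant_functional s0 ts k N N0.
      by move=> i j x ik jk; exact: (comm _ _ _ (Tts i ik) (Tts j jk)).
    exact: (sub M).
  split.
  - by exists 0%N, 1%N, (fun _ => id); split.
  - move=> P P' [k [N [ts [N0 Tts sub]]]] [k' [N' [ts' [N0' Tts' sub']]]].
    (* Concatenating the lists and multiplying the precisions refines both base sets. *)
    exists (k + k')%N, (N * N')%N, (fun i => if (i < k)%N then ts i else ts' (i - k)%N).
    split=> [|i ik|M [pM MT]]; first by rewrite muln_gt0 N0.
      case: ltnP => ki; first exact: Tts.
      by apply: Tts'; rewrite ltn_subLR.
    have le1 B (n n' : nat) F : (forall x, `|F x| <= B) -> (0 < n)%N -> (0 < n')%N ->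
        2 * B / (n * n')%:R <= 2 * B / n%:R.
      move=> FB n0 n'0; have B0 : 0 <= B by exact: (le_trans (normr_ge0 _) (FB s0)).
      apply: ler_wpM2l; first by rewrite mulr_ge0.
      by rewrite lef_pV2 ?posrE ?ltr0n ?muln_gt0 ?n0// ler_nat leq_pmulr.
    split.
      apply: sub; split=> // i F B ik FB; apply: (le_trans _ (le1 B N N' F FB N0 N0')).
      by have := MT i F B; rewrite ik; apply => //; exact: ltn_addr.
    apply: sub'; split=> // i F B ik FB; apply: (le_trans _ (le1 B N' N F FB N0' N0)).
    have := MT (k + i)%N F B; rewrite [(k + i < k)%N]ltnNge leq_addr/= addKn mulnC.
    by apply => //; rewrite ltn_add2l.
  - move=> P P' PP' [k [N [ts [N0 Tts sub]]]]; exists k, N, ts; split=> //.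
    exact: subset_trans PP'.
have [U [UU FU]] := ultraFilterLemma FltP.
have UP : U (fun M => positive_functional M).
  by apply: FU; exists 0%N, 1%N, (fun _ => id); split=> // M [].
(* The values stay in the compact segment from -B to B, where an ultrafilter converges. *)
have cv F : fbounded F -> cvg (M F @[M --> U]).
  move=> [B FB]; have UB : U [set M | `[- B, B]%classic (M F)].
    apply: filterS UP => M pM /=.
    by rewrite in_itv /= -ler_norml; exact: (pf_norm pM).
  have [l [_ cl]] := @segment_compact R (- B) B (M F @[M --> U]) _ UB.
  apply/cvg_ex; exists l => V Vl.
  have [//|nV] := in_ultra_setVsetC ((fun M => M F) @^-1` V) UU.
  by have [x [nVx Vx]] := cl (~` V) V nV Vl.
have UL F (G : ((S -> R) -> R) -> R) : fbounded F -> U (fun M => M F = G M) ->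
    lim (M F @[M --> U]) = lim (G M @[M --> U]).
  move=> bF FG; symmetry; apply: cvg_lim => //.
  apply: cvg_trans (cv F bF); apply: near_eq_cvg; exact: FG.
have bD F G : fbounded F -> fbounded G -> fbounded (fun x => F x + G x).
  move=> [B FB] [B' GB]; exists (B + B') => x.
  by apply: le_trans (ler_normD _ _) _; exact: lerD.
exists (fun F => lim (M F @[M --> U])); split.
- move=> F G bF bG; rewrite -limD; [|exact: cv|exact: cv].
  apply: (UL _ (fun M => M F + M G)); first exact: bD.
  by apply: filterS UP => M pM; exact: (pf_add pM).
- move=> a F bF; apply: cvg_lim => //.
  apply: (cvg_trans _ (cvgM (cvg_cst a) (cv F bF))); apply: near_eq_cvg.
  by apply: filterS UP => M pM; rewrite /= (pf_scale pM).
- move=> F B bF FB; apply: limr_le; first exact: cv.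
  by apply: filterS UP => M pM; exact: (pf_le pM).
move=> t F Tt bF; have bFt : fbounded (F \o t).
  by case: bF => B FB; exists B => x; exact: FB.
apply/eqP; rewrite -subr_eq0; apply/eqP.
apply: (cvg_unique _ (cvgB (cv _ bFt) (cv _ bF))) => //.
apply/cvgr0Pnorm_le => e e0.
have [B FB] := bF; have B0 : 0 <= B by exact: (le_trans (normr_ge0 _) (FB s0)).
(* Chosen so that the defect of invariance [2 * B / N] is at most [e]. *)
pose N := (Num.truncn (2 * B / e)).+1.
apply: FU; exists 1%N, N, (fun=> t); split=> // M [pM MT].
apply: le_trans (MT 0%N F B isT FB) _.
rewrite ler_pdivrMr ?ltr0n// -ler_pdivrMl// mulrC.
by apply: ltW; rewrite truncnS_gt.
Qed.

End InvariantMean.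

(** * The Euclidean norm and means of vector-valued functions *)

Section L2norm.
Variables (R : realType) (d : nat).
Implicit Types x y : 'rV[R]_d.

Definition dotrow x y : R := \sum_(j < d) x 0 j * y 0 j.

Lemma l2norm_ge0 x : 0 <= l2norm x.
Proof. exact: sqrtr_ge0. Qed.

Lemma l2norm_sq x : l2norm x ^+ 2 = dotrow x x.
Proof.
rewrite /l2norm sqr_sqrtr; first by apply: eq_bigr => j _; rewrite expr2.
by apply: sumr_ge0 => j _; exact: sqr_ge0.
Qed.

Lemma l2norm_coord x j : `|x 0 j| <= l2norm x.
Proof.
rewrite -ler_sqr ?nnegrE ?l2norm_ge0// l2norm_sq real_normK ?num_real//.
rewrite /dotrow (bigD1 j)//= -expr2 lerDl; apply: sumr_ge0 => k _.
by rewrite -expr2 sqr_ge0.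
Qed.

(** Cauchy-Schwarz, by expanding the squared norm of [|y|^2 x - (x.y) y]. *)
Lemma dotrow_le x y : dotrow x y <= l2norm x * l2norm y.
Proof.
have [y0|yN0] := eqVneq (l2norm y) 0.
  rewrite y0 mulr0 /dotrow big1// => j _.
  have := l2norm_coord y j; rewrite y0 normr_le0 => /eqP->; by rewrite mulr0.
have y_gt0 : 0 < l2norm y by rewrite lt_neqAle eq_sym yN0 l2norm_ge0.
have H : 0 <= \sum_(j < d) (l2norm y ^+ 2 * x 0 j - dotrow x y * y 0 j) ^+ 2.
  by apply: sumr_ge0 => j _; exact: sqr_ge0.
have E : \sum_(j < d) (l2norm y ^+ 2 * x 0 j - dotrow x y * y 0 j) ^+ 2 =
    l2norm y ^+ 2 * (l2norm x ^+ 2 * l2norm y ^+ 2 - dotrow x y ^+ 2).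
  set Y := l2norm y ^+ 2; set c := dotrow x y.
  transitivity (\sum_(j < d) (Y ^+ 2 * (x 0 j * x 0 j) - 2 * Y * c * (x 0 j * y 0 j)
      + c ^+ 2 * (y 0 j * y 0 j))); first by apply: eq_bigr => j _; ring.
  have D (u w : 'rV[R]_d) : \sum_(j < d) u 0 j * w 0 j = dotrow u w by [].
  rewrite big_split sumrB -!mulr_sumr !D -/c -!l2norm_sq -/Y /=; ring.
rewrite E pmulr_rge0 ?exprn_gt0// subr_ge0 -exprMn in H.
apply: le_trans (ler_norm _) _.
by rewrite -ler_sqr ?nnegrE ?mulr_ge0 ?l2norm_ge0// real_normK ?num_real.
Qed.

Lemma ler_l2normD x y : l2norm (x + y) <= l2norm x + l2norm y.
Proof.
rewrite -ler_sqr ?nnegrE ?addr_ge0 ?l2norm_ge0// l2norm_sq.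
have -> : dotrow (x + y) (x + y) = dotrow x x + 2 * dotrow x y + dotrow y y.
  rewrite /dotrow mulr_sumr -!big_split; apply: eq_bigr => j _ /=.
  rewrite !mxE; ring.
rewrite -!l2norm_sq sqrrD lerD2r lerD2l mulr_natl.
by rewrite lerMn2r dotrow_le orbT.
Qed.

Lemma l2normN x : l2norm (- x) = l2norm x.
Proof. by congr Num.sqrt; apply: eq_bigr => j _; rewrite mxE sqrrN. Qed.

Lemma l2norm0 : l2norm (0 : 'rV[R]_d) = 0.
Proof. by rewrite /l2norm big1 ?sqrtr0// => j _; rewrite mxE expr0n. Qed.

Lemma ler_l2norm_sum (I : Type) (s : seq I) (F : I -> 'rV[R]_d) :
  l2norm (\sum_(i <- s) F i) <= \sum_(i <- s) l2norm (F i).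
Proof.
elim: s => [|i s IH]; first by rewrite !big_nil l2norm0.
by rewrite !big_cons; apply: le_trans (ler_l2normD _ _) _; rewrite lerD2l.
Qed.

Lemma l2norm_le_sum x : l2norm x <= \sum_(j < d) `|x 0 j|.
Proof.
rewrite -ler_sqr ?nnegrE ?l2norm_ge0 ?sumr_ge0// l2norm_sq /dotrow.
elim: (index_enum _) => [|j k IH]; first by rewrite !big_nil expr0n.
rewrite !big_cons sqrrD -addrA lerD//.
  by rewrite -expr2 real_normK ?num_real.
apply: le_trans IH _; rewrite lerDr mulrn_wge0// mulr_ge0//.
by apply: sumr_ge0.
Qed.

End L2norm.

Section VectorMean.
Variables (R : realType) (d : nat) (S : Type).

Definition l2bounded (F : S -> 'rV[R]_d) : Prop := exists B, forall x, l2norm (F x) <= B.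

(** The mean is taken by coordinates, but bounding it by coordinates would cost a factor depending
    on [d]. Instead, for v = M F, |v|^2 is the scalar mean of the products v.F, hence at most |v|
    B. *)
Lemma vector_mean_exists (s0 : S) (T : set (S -> S)) :
  (forall t u x, T t -> T u -> t (u x) = u (t x)) ->
  exists M : (S -> 'rV[R]_d) -> 'rV[R]_d,
    [/\ forall F G, l2bounded F -> l2bounded G -> M (fun x => F x + G x) = M F + M G,
        forall F, l2bounded F -> M (fun x => - F x) = - M F,
        forall v, M (fun=> v) = v,
        forall t F, T t -> l2bounded F -> M (F \o t) = M F &
        forall F B, (forall x, l2norm (F x) <= B) -> l2norm (M F) <= B].
Proof.
move=> /(@invariant_mean_exists R S s0)[m [mD mZ mle mT]].
have mcst a : m (fun=> a) = a.
  have ba c : fbounded (fun _ : S => c : R) by exists `|c|.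
  apply/eqP; rewrite eq_le mle//=.
  have H : m (fun=> - 1 * a) <= - a by apply: mle => // x; rewrite mulN1r.
  by rewrite (mZ (- 1) (fun=> a))// mulN1r lerN2 in H.
have bF F j : l2bounded F -> fbounded (fun x => F x 0 j).
  by move=> [B FB]; exists B => x; exact: (le_trans (l2norm_coord _ _) (FB x)).
exists (fun F => \row_j m (fun x => F x 0 j)); split.
- move=> F G lF lG; apply/rowP => j; rewrite !mxE -mD; [|exact: bF|exact: bF].
  by congr m; apply/funext => x; rewrite mxE.
- move=> F lF; apply/rowP => j; rewrite !mxE -mulN1r -mZ; last exact: bF.
  by congr m; apply/funext => x; rewrite mxE mulN1r.
- by move=> v; apply/rowP => j; rewrite mxE mcst.
- by move=> t F Tt lF; apply/rowP => j; rewrite !mxE; exact: (mT t (fun x => F x 0 j) Tt (bF F j lF)).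
move=> F B FB; set v := \row_j _.
have lF : l2bounded F by exists B.
have B0 : 0 <= B by exact: (le_trans (l2norm_ge0 _) (FB s0)).
have bsum (k : seq 'I_d) : fbounded (fun x => \sum_(j <- k) v 0 j * F x 0 j).
  exists (\sum_(j <- k) `|v 0 j| * B) => x; apply: le_trans (ler_norm_sum _ _ _) _.
  apply: ler_sum => j _; rewrite normrM ler_wpM2l//.
  exact: (le_trans (l2norm_coord _ _) (FB x)).
have msum (k : seq 'I_d) : m (fun x => \sum_(j <- k) v 0 j * F x 0 j) =
    \sum_(j <- k) v 0 j * v 0 j.
  elim: k => [|j k IH].
    by rewrite big_nil -[RHS]mcst; congr m; apply/funext => x; rewrite big_nil.
  have vj : v 0 j = m (fun x => F x 0 j) by rewrite mxE.
  rewrite big_cons -IH [X in _ * X + _]vj -mZ; last exact: bF.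
  rewrite -mD; first by congr m; apply/funext => x; rewrite big_cons.
    have := bsum [:: j]; congr fbounded; apply/funext => x.
    by rewrite big_seq1.
  exact: bsum.
have H : l2norm v ^+ 2 <= l2norm v * B.
  rewrite l2norm_sq /dotrow -msum; apply: mle; first exact: bsum.
  move=> x; apply: le_trans (dotrow_le _ _) _.
  by rewrite ler_wpM2l ?l2norm_ge0.
have [->//|vN0] := eqVneq (l2norm v) 0.
by rewrite expr2 ler_pM2l// in H; rewrite lt_neqAle eq_sym vN0 l2norm_ge0.
Qed.

End VectorMean.

(** * Averaging a relative cocycle over vertical cubes *)

Definition vzero (I : finType) : vert I := [ffun=> false].

Definition alt_sum (V : zmodType) (Q : Type) l (f : Q -> V) (c : vert 'I_l -> Q) : V :=
  \sum_(w : vert 'I_l) f (c w) *~ (-1) ^+ weight w.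

Lemma mulrz_sign (V : zmodType) (x : V) n :
  x *~ (-1) ^+ n = if odd n then - x else x.
Proof. by rewrite -signr_odd; case: (odd n); rewrite ?expr1 ?expr0 ?mulrN1z ?mulr1z. Qed.

Lemma weight_vset l (i : 'I_l) (w : vert 'I_l) : w i = false ->
  weight (vset i true w) = (weight w).+1.
Proof.
move=> wi; rewrite /weight (bigD1 i)//= [in RHS](bigD1 i)//= vsetE eqxx wi add1n add0n.
by congr _.+1; apply: eq_bigr => j /negbTE ji; rewrite vsetE ji.
Qed.

Section RelativeCocycle.
Variables (R : realType) (d l : nat) (Q Y : Type) (C : cubesys Q) (b : Q -> Y).
Hypothesis ax : cubespace_axioms C b.

Definition fibered (I : finType) (c c' : vert I -> Q) : Prop :=
  [/\ C c, C c' & forall v, b (c v) = b (c' v)].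

Definition vglue (I : finType) (i : I) (p q : vert I -> Q) (v : vert I) : Q :=
  if v i then q v else p v.

(* [r c c'] plays the role of [rho c' - rho c]; the cocycle identity of [rho] under
   glueing becomes [rc_glue]. *)
Record relative_cocycle (r : (vert 'I_l -> Q) -> (vert 'I_l -> Q) -> 'rV[R]_d) :
    Prop := {
  rc_trans : forall p q t, fibered p q -> fibered q t -> r p q + r q t = r p t;
  rc_glue : forall (i : 'I_l) p q p' q', fibered p p' -> fibered q q' ->
    (forall v, p (vset i true v) = q (vset i false v)) ->
    (forall v, p' (vset i true v) = q' (vset i false v)) ->
    r (vglue i p q) (vglue i p' q') = r p p' + r q q'
}.

Variable r : (vert 'I_l -> Q) -> (vert 'I_l -> Q) -> 'rV[R]_d.
Hypothesis rc : relative_cocycle r.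

Lemma fibered_refl (I : finType) (c : vert I -> Q) : C c -> fibered c c.
Proof. by move=> Cc; split. Qed.

Lemma fibered_sym (I : finType) (c c' : vert I -> Q) : fibered c c' -> fibered c' c.
Proof. by case=> Cc Cc' cc'; split=> // v; rewrite cc'. Qed.

Lemma fibered_trans (I : finType) (c e t : vert I -> Q) :
  fibered c e -> fibered e t -> fibered c t.
Proof. by move=> [Cc Ce ce] [_ Ct et]; split=> // v; rewrite ce. Qed.

Lemma fibered_comp (I J : finType) (phi : vert I -> vert J) (c c' : vert J -> Q) :
  vert_morphism phi -> fibered c c' ->
  fibered (fun v => c (phi v)) (fun v => c' (phi v)).
Proof. by move=> mphi [Cc Cc' cc']; split=> //; exact: (ax_comp ax mphi). Qed.

Lemma rc_refl p : C p -> r p p = 0.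
Proof.
move=> Cp; have := rc_trans rc (fibered_refl Cp) (fibered_refl Cp).
by move/eqP; rewrite -subr_eq0 addrK => /eqP.
Qed.

Lemma rc_sub p q t : fibered t p -> fibered p q -> r p q = r t q - r t p.
Proof. by move=> tp pq; rewrite -(rc_trans rc tp pq) addrC addKr. Qed.

(** Glueing such a pair to itself gives it back, so its value equals its double. *)
Lemma rc_degenerate i p p' : fibered p p' ->
  (forall v, p (vset i true v) = p (vset i false v)) ->
  (forall v, p' (vset i true v) = p' (vset i false v)) -> r p p' = 0.
Proof.
move=> pp' pi p'i; have := rc_glue rc pp' pp' pi p'i.
have E (q : vert 'I_l -> Q) : vglue i q q = q.
  by apply/funext => v; rewrite /vglue; case: ifP.
by rewrite !E => /esym/eqP; rewrite -subr_eq0 addrK => /eqP.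
Qed.

(** A pair glued to its mirror image is degenerate in direction [i]. *)
Lemma rc_flip i p p' : fibered p p' ->
  r (fun v => p (vflip i v)) (fun v => p' (vflip i v)) = - r p p'.
Proof.
move=> pp'; have mf := vert_morphism_flip i.
have fE (q : vert 'I_l -> Q) v : q (vset i true v) = q (vflip i (vset i false v)).
  by rewrite /vflip vsetE eqxx vset_vset.
have := rc_glue rc (i := i) pp' (fibered_comp mf pp') (fE p) (fE p').
have E (q : vert 'I_l -> Q) : vglue i q (fun v => q (vflip i v)) =
    fun v => q (vset i false v).
  apply/funext => v; rewrite /vglue /vflip; case vi: (v i) => //.
  by rewrite -{1}(vset_id i v) vi.
rewrite !E (rc_degenerate (i := i)).
- by move/esym/eqP; rewrite addr_eq0 => /eqP ->; rewrite opprK.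
- exact: (fibered_comp (vert_morphism_vset i false)).
- by move=> v; rewrite !vset_vset.
by move=> v; rewrite !vset_vset.
Qed.

(** Cuts a pair along an intermediate face: [p] runs from the lower face to the middle and [q] from
    the upper face back to the middle, so the second half is traversed backwards. *)
Lemma rc_split i p q p' q' : fibered p p' -> fibered q q' ->
  (forall v, p (vset i true v) = q (vset i true v)) ->
  (forall v, p' (vset i true v) = q' (vset i true v)) ->
  r (vglue i p (fun v => q (vset i false v))) (vglue i p' (fun v => q' (vset i false v))) =
    r p p' - r q q'.
Proof.
move=> pp' qq' pq p'q'; have mf := vert_morphism_flip i.
rewrite -(rc_flip i qq') -(rc_glue rc (i := i) pp' (fibered_comp mf qq')).
- have E (t u : vert 'I_l -> Q) :
      vglue i t (fun v => u (vset i false v)) = vglue i t (fun v => u (vflip i v)).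
    by apply/funext => v; rewrite /vglue /vflip; case: (v i).
  by rewrite !E.
- by move=> v; rewrite pq /vflip vsetE eqxx vset_vset.
by move=> v; rewrite p'q' /vflip vsetE eqxx vset_vset.
Qed.

End RelativeCocycle.

Section Averaging.
Variables (R : realType) (s d l : nat) (Q Y : Type) (C : cubesys Q) (b : Q -> Y).
Hypotheses (ax : cubespace_axioms C b) (deg : has_degree s C b) (s_gt0 : (0 < s)%N).
Variable r : (vert 'I_l -> Q) -> (vert 'I_l -> Q) -> 'rV[R]_d.
Hypothesis rc : relative_cocycle C b r.

Local Notation translation := (translation s C b).
Local Notation vertical := (vertical s C b).
Local Notation shift := (shift s C b).
Local Notation fibered := (fibered C b).

Definition act (I : finType) (h : vert I -> Q -> Q) (c : vert I -> Q) : vert I -> Q :=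
  fun v => h v (c v).

Lemma fibered_act (I : finType) (h : vert I -> Q -> Q) (c : vert I -> Q) :
  shift h -> C c -> fibered c (act h c).
Proof.
by move=> Sh Cc; split=> [//||v]; [exact: (shift_cube Sh Cc)|rewrite /act (proj1 (proj1 Sh v))].
Qed.

(* The subcube at the corner [w] of the subdivision of [c] in the directions of [D],
   whose new vertices are moved by [h]. *)
Definition subcube (D : {set 'I_l}) (w : vert 'I_l) (h : vert 'I_l -> Q -> Q)
    (c : vert 'I_l -> Q) (v : vert 'I_l) : Q :=
  h [ffun i => v i && (i \in D)]
    (c [ffun i => if i \in D then ~~ v i && w i else v i]).

Lemma fibered_subcube D w h c c' : shift h -> fibered c c' ->
  fibered (subcube D w h c) (subcube D w h c').
Proof.
move=> Sh cc'.
have m1 : vert_morphism (fun v : vert 'I_l => [ffun i => v i && (i \in D)]).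
  move=> j; case jD: (j \in D).
    by constructor 3; exists j => v; rewrite ffunE jD andbT.
  by constructor 1 => v; rewrite ffunE jD andbF.
have m2 : vert_morphism
    (fun v : vert 'I_l => [ffun i => if i \in D then ~~ v i && w i else v i]).
  move=> j; case jD: (j \in D); last by constructor 3; exists j => v; rewrite ffunE jD.
  case wj: (w j); first by constructor 4; exists j => v; rewrite ffunE jD wj andbT.
  by constructor 1 => v; rewrite ffunE jD wj andbF.
have [Cc Cc' bcc'] := fibered_comp ax m2 cc'.
have Sh1 := shift_comap m1 Sh.
apply: (fibered_trans (fibered_sym (fibered_act Sh1 Cc))).
by apply: (fibered_trans _ (fibered_act Sh1 Cc')); split.
Qed.

(** Adding a direction [i] to [D] cuts every term by [rc_split]; the half at a corner with
    [w i = true] is reversed, whence the sign. Since [h] is trivial at vertex 0, the original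
    vertices stay in place and the empty [D] gives back [r c c']. *)
Lemma subdivision h c c' (D : {set 'I_l}) : shift h -> h (vzero _) = id ->
  fibered c c' ->
  r c c' = \sum_(w : vert 'I_l | vsupp w \subset D)
    r (subcube D w h c) (subcube D w h c') *~ (-1) ^+ weight w.
Proof.
move=> Sh h0 cc'; have [n] := ubnP #|D|; elim: n D => // n IH D; rewrite ltnS => Dn.
have [->|[i iD]] := finset.set_0Vmem D.
  rewrite (big_pred1 (vzero 'I_l)) => [|w]; last first.
    rewrite finset.subset0; apply/eqP/eqP => [w0|->].
      by apply/ffunP => j; have := finset.in_set0 j; rewrite -w0 inE ffunE => ->.
    by apply/setP => j; rewrite finset.in_set0 inE ffunE.
  have -> : weight (vzero 'I_l) = 0%N.
    by rewrite /weight big1// => j _; rewrite ffunE.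
  rewrite expr0 mulr1z.
  have E (e : vert 'I_l -> Q) : subcube finset.set0 (vzero _) h e = e.
    apply/funext => v; rewrite /subcube.
    have -> : [ffun j => v j && (j \in finset.set0)] = vzero 'I_l.
      by apply/ffunP => j; rewrite !ffunE finset.in_set0 andbF.
    rewrite h0; congr e; apply/ffunP => j.
    by rewrite ffunE finset.in_set0.
  by rewrite !E.
have {n Dn} IH := IH (D :\ i) (leq_trans (proper_card (properD1 iD)) Dn).
rewrite IH [RHS](bigID (fun w : vert 'I_l => w i))/=.
rewrite [in RHS](reindex_onto (vset i true) (vset i false))/=; last first.
  by move=> w0 /andP[_ wi]; rewrite vset_vset -[X in vset i X w0]wi vset_id.
have sub0 w : (vsupp w \subset D) && ~~ w i = (vsupp w \subset D :\ i).
  by rewrite finset.subsetD1 inE.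
have sub1 w : ((vsupp (vset i true w) \subset D) && vset i true w i) &&
    (vset i false (vset i true w) == w) = (vsupp w \subset D :\ i).
  rewrite vsetE eqxx andbT vset_vset finset.subsetD1 inE.
  case wi: (w i); first by rewrite andbF; apply/negP => /andP[_ /eqP/ffunP/(_ i)];
    rewrite vsetE eqxx wi.
  rewrite -[X in vset i X w == w]wi vset_id eqxx !andbT.
  apply/fintype.subsetP/fintype.subsetP => sub j; rewrite inE => wj; last first.
    by move: wj; rewrite vsetE; case: eqP => [->//|_ wj]; apply: sub; rewrite inE.
  by apply: sub; rewrite inE vsetE; case: eqP.
rewrite [in RHS](eq_bigl _ _ sub1) (eq_bigl _ _ sub0) addrC -big_split/=; apply: eq_bigr => w.
rewrite finset.subsetD1 inE => /andP[wD /negbTE wi].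
have split_i e v : subcube (D :\ i) w h e v =
    vglue i (subcube D w h e) (fun v => subcube D (vset i true w) h e (vset i false v)) v.
  rewrite /vglue /subcube; case vi: (v i); congr (h _ (e _)); apply/ffunP => j;
    by rewrite !ffunE !inE; case: eqP => [->|]; rewrite ?vi ?iD ?wi ?andbF.
have splitE e : subcube (D :\ i) w h e = vglue i (subcube D w h e)
    (fun v => subcube D (vset i true w) h e (vset i false v)).
  by apply/funext => v; exact: split_i.
have agree e v : subcube D w h e (vset i true v) = subcube D (vset i true w) h e (vset i true v).
  rewrite /subcube; congr (h _ (e _)); apply/ffunP => j.
  by rewrite !ffunE; case: eqP => [->|]; rewrite ?iD.
rewrite !splitE (rc_split ax rc (fibered_subcube D w Sh cc') (fibered_subcube D (vset i true w) Sh cc')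
  (agree c) (agree c')).
rewrite weight_vset// !mulrz_sign /=; case: (odd _); first by rewrite opprB addrC.
by [].
Qed.

Definition base_shift : Type :=
  {h : vert 'I_l -> Q -> Q | shift h /\ forall x, h (vzero _) x = x}.

Lemma base_shift_mul (k h : base_shift) :
  shift (fun v => sval k v \o sval h v) /\
  forall x, (sval k (vzero _) \o sval h (vzero _)) x = x.
Proof.
have [[Sk k0] [Sh h0]] := (svalP k, svalP h); split; first exact: shift_comp.
by move=> x; rewrite /= h0 k0.
Qed.

Definition base_mul (k h : base_shift) : base_shift :=
  exist _ (fun v => sval k v \o sval h v) (base_shift_mul k h).

Lemma base_one_proof : shift (fun _ : vert 'I_l => id) /\ forall x : Q, id x = x.
Proof. by split=> //; exact: shift_id. Qed.

Definition base_one : base_shift := exist _ (fun _ => id) base_one_proof.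

Lemma base_mulC (k k' h : base_shift) :
  base_mul k (base_mul k' h) = base_mul k' (base_mul k h).
Proof.
apply: eq_exist; apply/funext => v; apply/funext => x /=.
by apply: (translationC ax deg); case: (svalP k) => -[]; case: (svalP k') => -[].
Qed.

Section Average.
Variable M : (base_shift -> 'rV[R]_d) -> 'rV[R]_d.
Hypotheses
  (MD : forall F G, l2bounded F -> l2bounded G -> M (fun h => F h + G h) = M F + M G)
  (MN : forall F, l2bounded F -> M (fun h => - F h) = - M F)
  (Mcst : forall v, M (fun=> v) = v)
  (Mmul : forall k F, l2bounded F -> M (F \o base_mul k) = M F)
  (Mle : forall F B, (forall h, l2norm (F h) <= B) -> l2norm (M F) <= B).
Variable delta : R.
Hypothesis r_le : forall c c', fibered c c' -> l2norm (r c c') <= delta.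

Lemma l2boundedN (F : base_shift -> 'rV[R]_d) : l2bounded F -> l2bounded (fun h => - F h).
Proof. by move=> [B FB]; exists B => h; rewrite l2normN. Qed.

Lemma mean_sub F G : l2bounded F -> l2bounded G ->
  M (fun h => F h - G h) = M F - M G.
Proof. by move=> lF lG; rewrite MD ?MN//; exact: l2boundedN. Qed.

Lemma mean_sum (I : Type) (k : seq I) (P : pred I) (F : I -> base_shift -> 'rV[R]_d)
    (m : I -> nat) : (forall i, l2bounded (F i)) ->
  M (fun h => \sum_(i <- k | P i) F i h *~ (-1) ^+ m i) =
    \sum_(i <- k | P i) M (F i) *~ (-1) ^+ m i.
Proof.
move=> lF; have lS i : l2bounded (fun h => F i h *~ (-1) ^+ m i).
  have [B FB] := lF i; exists B => h; rewrite mulrz_sign.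
  by case: ifP; rewrite ?l2normN.
have lsum j : l2bounded (fun h => \sum_(i <- j | P i) F i h *~ (-1) ^+ m i).
  elim: j => [|i j [B' jB']]; first by exists 0 => h; rewrite big_nil l2norm0.
  have [B FB] := lS i; exists (if P i then B + B' else B') => h; rewrite big_cons.
  by case: ifP => // _; apply: le_trans (ler_l2normD _ _) _; exact: lerD.
elim: k => [|i k IH].
  by rewrite big_nil -[RHS]Mcst; congr M; apply/funext => h; rewrite big_nil.
rewrite big_cons -IH; case: ifP => Pi; last first.
  by congr M; apply/funext => h; rewrite big_cons Pi.
have <- : M (fun h => F i h *~ (-1) ^+ m i) = M (F i) *~ (-1) ^+ m i.
  rewrite mulrz_sign; case mi: (odd (m i)).
    by rewrite -MN//; congr M; apply/funext => h; rewrite mulrz_sign mi.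
  by congr M; apply/funext => h; rewrite mulrz_sign mi.
by rewrite -MD//; congr M; apply/funext => h; rewrite big_cons Pi.
Qed.

Lemma fibered_base (h : base_shift) (p c : vert 'I_l -> Q) : fibered p c -> fibered p (act (sval h) c).
Proof.
move=> pc; apply: (fibered_trans pc); apply: fibered_act; [|by case: pc].
by case: (svalP h).
Qed.

Definition average (p c : vert 'I_l -> Q) : 'rV[R]_d :=
  M (fun h : base_shift => r p (act (sval h) c)).

Lemma bounded_act p c : fibered p c -> l2bounded (fun h : base_shift => r p (act (sval h) c)).
Proof. by move=> pc; exists delta => h; apply: r_le; exact: fibered_base. Qed.

Lemma average_act (k : base_shift) p c : fibered p c -> average p (act (sval k) c) = average p c.
Proof.
move=> pc; rewrite /average -[RHS](Mmul k); last exact: bounded_act.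
congr M; apply/funext => h /=; congr r; apply/funext => v.
rewrite /act /=; apply: (translationC ax deg); case: (svalP k) => -[];
  by case: (svalP h) => -[].
Qed.

Definition vertical_mean (x : Q) : 'rV[R]_d := average (fun=> x) (fun=> x).

(** The mean cost of applying [g] to all of [c] after a base shift. It turns out to depend on [c]
    only through its value at vertex 0. *)
Definition displacement (g : Q -> Q) (c : vert 'I_l -> Q) : 'rV[R]_d :=
  M (fun h : base_shift => r (act (sval h) c) (act (sval h) (fun v => g (c v)))).

Lemma fibered_translate g (I : finType) (c : vert I -> Q) : translation g -> C c ->
  fibered c (fun v => g (c v)).
Proof. by move=> Tg Cc; exact: (fibered_act (shift_cst I Tg) Cc). Qed.

Lemma displacementE g c : translation g -> C c ->
  displacement g c = average c (fun v => g (c v)) - average c c.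
Proof.
move=> Tg Cc; have cg := fibered_translate Tg Cc; have cc := fibered_refl b Cc.
rewrite /average -mean_sub; [|exact: bounded_act|exact: bounded_act].
congr M; apply/funext => h; apply: (rc_sub rc); first exact: fibered_base.
by apply: (fibered_trans (fibered_sym (fibered_base h cc))); exact: fibered_base.
Qed.

(** Cut [act h c] in direction [i] into a piece where [c] is collapsed along [i] and a piece [up]
    that only sees [h] on the upper face. In the latter [g] can be absorbed into [h] by invariance
    of the mean, so its contribution vanishes. *)
Lemma displacement_vset g c i : translation g -> C c ->
  displacement g c = displacement g (fun v => c (vset i false v)).
Proof.
move=> Tg Cc; have cg := fibered_translate Tg Cc; have cc := fibered_refl b Cc.
have m0 := vert_morphism_vset i false; have m1 := vert_morphism_vset i true.
pose up (h : base_shift) (e : vert 'I_l -> Q) v := sval h (vset i true v) (e v).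
have up_fibered h e : fibered c e -> fibered c (up h e).
  move=> ce; have [_ Ce _] := ce; apply: (fibered_trans ce).
  exact: (fibered_act (shift_comap m1 (proj1 (svalP h))) Ce).
have up_bounded e : fibered c e -> l2bounded (fun h : base_shift => r c (up h e)).
  by move=> ce; exists delta => h; apply: r_le; exact: up_fibered.
have cs := fibered_comp ax m0 cg; have [Cs Cgs _] := cs.
have ss := fibered_refl b Cs; have gs := fibered_refl b Cgs.
pose act0 (h : base_shift) (e : vert 'I_l -> Q) :=
  act (sval h) (fun v => e (vset i false v)).
have split (h : base_shift) : r (act (sval h) c) (act (sval h) (fun v => g (c v))) =
    r (act0 h c) (act0 h (fun v => g (c v))) +
    (r c (up h (fun v => g (c v))) - r c (up h c)).
  rewrite -(rc_sub rc (up_fibered h _ cc)); last first.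
    by apply: (fibered_trans (fibered_sym (up_fibered h _ cc))); exact: up_fibered.
  rewrite -(rc_glue rc (i := i)).
  - congr r; apply/funext => v; rewrite /vglue /act0 /act /up; case vi: (v i);
      by rewrite -[X in vset i X v]vi vset_id.
  - apply: (fibered_trans (fibered_sym (fibered_base h ss))).
    by apply: fibered_base.
  - by apply: (fibered_trans (fibered_sym (up_fibered h _ cc))); exact: up_fibered.
  - by move=> v; rewrite /act0 /act /up !vset_vset.
  - by move=> v; rewrite /act0 /act /up !vset_vset.
have -> : displacement g c = M (fun h : base_shift => r (act0 h c) (act0 h (fun v => g (c v))) +
    (r c (up h (fun v => g (c v))) - r c (up h c))).
  by congr M; apply/funext => h.
rewrite MD; last 2 first.
- exists delta => h; apply: r_le.
  apply: (fibered_trans (fibered_sym (fibered_base h ss))).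
  by apply: fibered_base.
- exists (delta + delta) => h; apply: le_trans (ler_l2normD _ _) _.
  by rewrite l2normN lerD// r_le//; exact: up_fibered.
rewrite mean_sub; [|exact: up_bounded|exact: up_bounded].
suff -> : M (fun h : base_shift => r c (up h (fun v => g (c v)))) = M (fun h : base_shift => r c (up h c)).
  by rewrite subrr addr0.
(* As [s > 0], applying [g] on the face [v i = true] is a shift; the face misses vertex 0, so it is
   a base shift. *)
have Si : (#|[set i]%SET| <= s)%N by rewrite cards1.
have Sk : shift (fun v => if [set i]%SET \subset vsupp v then g else id) /\
    forall x, (if [set i]%SET \subset vsupp (vzero 'I_l) then g else id) x = x.
  split; first exact: shift_face.
  by move=> x; rewrite finset.sub1set inE ffunE.
pose k : base_shift := exist _ _ Sk.
rewrite -[RHS](Mmul k); last exact: up_bounded.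
congr M; apply/funext => h /=; congr r; apply/funext => v.
rewrite /up /= finset.sub1set inE vsetE eqxx /=.
exact: (translationC ax deg (c v) s_gt0 (proj1 (proj1 (svalP h)) _) Tg).
Qed.

Lemma displacement_cst g c : translation g -> C c ->
  displacement g c = displacement g (fun=> c (vzero _)).
Proof.
move=> Tg; have H (k : seq 'I_l) : forall e : vert 'I_l -> Q, C e ->
    displacement g e = displacement g (fun v => e (foldr (fun i => vset i false) v k)).
  elim: k => [//|i k IH] e Ce /=; rewrite (displacement_vset i Tg Ce).
  by apply: IH; exact: (ax_comp ax (vert_morphism_vset i false)).
move=> Cc; rewrite (H (enum 'I_l) _ Cc); congr (displacement g); apply/funext => v.
congr c; apply/ffunP => i; rewrite [RHS]ffunE.
have : i \in enum 'I_l by rewrite mem_enum.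
elim: (enum _) => //= j k IH; rewrite inE vsetE; case: eqP => //= _; exact: IH.
Qed.

Hypothesis l_gt0 : (0 < l)%N.

(** Replacing the reference cube [x] by [g x] costs [r] of a pair of constant cubes, which is
    degenerate because [l > 0]. *)
Lemma displacement_mean g x : translation g ->
  displacement g (fun=> x) = vertical_mean (g x) - vertical_mean x.
Proof.
move=> Tg; have Cx := cube_cst ax 'I_l x; have Cgx := cube_cst ax 'I_l (g x).
rewrite displacementE//; congr (_ - _); congr M; apply/funext => h.
have xgx := fibered_translate Tg Cx; have gg := fibered_refl b Cgx.
rewrite -(rc_trans rc xgx (fibered_base h gg)).
by rewrite (rc_degenerate rc (i := Ordinal l_gt0) xgx)// add0r.
Qed.

(* Every term of the subdivision of [c'] is, up to a base shift, the translate of the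
   term of [c] by the translation moving [c w] to [c' w]. *)
Lemma vertical_coboundary c c' : C c -> C c' -> (forall v, vertical (c v) (c' v)) ->
  r c c' = alt_sum vertical_mean c' - alt_sum vertical_mean c.
Proof.
move=> Cc Cc' vcc'; have [h0 Sh0 h0c] := vertical_shift ax deg Cc Cc' vcc'.
have cc' : fibered c c'.
  by split=> // v; rewrite h0c (proj1 (proj1 Sh0 v)).
pose phi (w v : vert 'I_l) : vert 'I_l := [ffun i => ~~ v i && w i].
have mphi w : vert_morphism (phi w).
  move=> j; case wj: (w j); first by constructor 4; exists j => v; rewrite ffunE wj andbT.
  by constructor 1 => v; rewrite ffunE wj andbF.
pose F w (h : base_shift) :=
  r (act (sval h) (fun v => c (phi w v))) (act (sval h) (fun v => c' (phi w v))).
have F_fib w (h : base_shift) : fibered (act (sval h) (fun v => c (phi w v)))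
    (act (sval h) (fun v => c' (phi w v))).
  have ff := fibered_comp ax (mphi w) cc'; have [Cf _ _] := ff.
  apply: (fibered_trans (fibered_sym (fibered_base h (fibered_refl b Cf)))).
  exact: fibered_base.
have rF (h : base_shift) : r c c' = \sum_(w : vert 'I_l) F w h *~ (-1) ^+ weight w.
  have [Sh hid] := svalP h.
  have hz : sval h (vzero _) = id by apply/funext.
  rewrite (subdivision finset.setT Sh hz cc'); apply: eq_big => [w|w _].
    by rewrite finset.subsetT.
  have E e : subcube finset.setT w (sval h) e = act (sval h) (fun v => e (phi w v)).
    apply/funext => v; rewrite /subcube /act; congr (sval h _ (e _)); apply/ffunP => j.
      by rewrite ffunE finset.in_setT andbT.
    by rewrite !ffunE finset.in_setT.
  by rewrite !E.
rewrite -[LHS]Mcst (_ : (fun=> r c c') =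
  fun h => \sum_(w : vert 'I_l) F w h *~ (-1) ^+ weight w); last by apply/funext.
rewrite mean_sum => [|w]; last by exists delta => h; exact: r_le.
rewrite /alt_sum -sumrB; apply: eq_bigr => w _; rewrite -mulrzBl; congr (_ *~ _).
have [g0 Tg0 g0K] := translation_inverse ax deg (c w) (proj1 Sh0 w).
have Tg := proj1 Sh0 w; set g := h0 w in Tg g0K.
pose e v := c (phi w v); have Ce : C e by exact: (ax_comp ax (mphi w) Cc).
have ee := fibered_refl b Ce; have ege := fibered_translate Tg Ce.
have phi0 : phi w (vzero _) = w by apply/ffunP => j; rewrite !ffunE.
(* Dividing the shift from [c] to [c'] by its value at [w] leaves a base shift, since [phi w] sends
   vertex 0 to [w]. *)
have Sk : shift (fun v => h0 (phi w v) \o g0) /\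
    forall x, (h0 (phi w (vzero _)) \o g0) x = x.
  split=> [|x].
    apply: (shift_comp (shift_comap (mphi w) Sh0)); exact: shift_cst.
  rewrite /= phi0; have := translationC ax deg x s_gt0 Tg Tg0.
  by rewrite g0K.
pose k : base_shift := exist _ (fun v => h0 (phi w v) \o g0) Sk.
have -> : M (F w) = average e (fun v => c' (phi w v)) - average e e.
  rewrite -mean_sub; [|apply: bounded_act|exact: bounded_act].
    congr M; apply/funext => h; apply: (rc_sub rc); first exact: fibered_base.
    exact: F_fib.
  exact: (fibered_comp ax (mphi w) cc').
have -> : (fun v => c' (phi w v)) = act (sval k) (fun v => g (e v)).
  by apply/funext => v; rewrite /act /= g0K h0c.
rewrite average_act// -displacementE// displacement_cst// displacement_mean//.
by rewrite /e phi0 h0c.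
Qed.

Lemma vertical_mean_le x : l2norm (vertical_mean x) <= delta.
Proof.
apply: Mle => h; apply: r_le; apply: fibered_base; apply: fibered_refl.
exact: (cube_cst ax).
Qed.

Lemma vertical_mean_close x y eps :
  (forall h : vert 'I_l -> Q -> Q, shift h -> l2norm (r (fun=> x) (act h (fun=> x)) -
     r (fun=> y) (act h (fun=> y))) <= eps) ->
  l2norm (vertical_mean x - vertical_mean y) <= eps.
Proof.
move=> H; have fx z := fibered_refl b (cube_cst ax 'I_l z).
rewrite -mean_sub; [|exact: bounded_act|exact: bounded_act].
by apply: Mle => h; apply: H; case: (svalP h).
Qed.

End Average.

Lemma vertical_average delta : (0 < l)%N ->
  (forall c c', fibered c c' -> l2norm (r c c') <= delta) ->
  exists f : Q -> 'rV[R]_d,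
    [/\ forall x, l2norm (f x) <= delta,
        forall c c', C c -> C c' -> (forall v, vertical (c v) (c' v)) ->
          r c c' = alt_sum f c' - alt_sum f c &
        forall x y eps,
          (forall h : vert 'I_l -> Q -> Q, shift h ->
             l2norm (r (fun=> x) (act h (fun=> x)) -
                     r (fun=> y) (act h (fun=> y))) <= eps) ->
          l2norm (f x - f y) <= eps].
Proof.
move=> l0 rle.
have [|M [MD MN Mcst MT Mle]] := @vector_mean_exists R d _ base_one (range base_mul).
  by move=> t u x [k _ <-] [k' _ <-]; exact: base_mulC.
have Mmul k F : l2bounded F -> M (F \o base_mul k) = M F.
  by apply: MT; exists k.
exists (vertical_mean M); split.
- by move=> x; exact: (vertical_mean_le Mle rle).
- by move=> c c' Cc Cc' vcc'; exact: (vertical_coboundary MD MN Mcst Mmul rle l0).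
by move=> x y eps; exact: (vertical_mean_close MD MN Mle rle).
Qed.

End Averaging.

(** * Continuity of the averages *)

Lemma near_compact (T K : topologicalType) (t0 : T) (P : T -> K -> Prop) :
  compact [set: K] -> (forall k : K, \forall tk \near (t0, k), P tk.1 tk.2) ->
  \forall t \near t0, forall k, P t k.
Proof.
move=> /compact_near_coveringP cK H.
have cov (k : K) : [set: K] k -> \forall k' \near nbhs k & t \near nbhs t0, P t k'.
  move=> _; have [[A B] [At0 Bk] AB] := H k.
  by exists (B, A) => // -[k' t] [Bk' At]; exact: (AB (t, k')).
by apply: filterS (cK T (nbhs t0) P _ cov) => t sub k; exact: sub.
Qed.

(** Tube lemma relative to a closed set: near a point outside [Z] the condition is vacuous. *)
Lemma near_compact_within (T K : topologicalType) (t0 : T) (Z : set (T * K))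
    (P : T -> K -> Prop) : compact [set: K] -> closed Z ->
  (forall k : K, Z (t0, k) -> \forall tk \near (t0, k), Z tk -> P tk.1 tk.2) ->
  \forall t \near t0, forall k, Z (t, k) -> P t k.
Proof.
move=> cK cZ H; apply: near_compact => // k.
have [Zk|nZk] := pselect (Z (t0, k)); first by apply: filterS (H k Zk) => -[].
have : nbhs (t0, k) (~` Z) by apply: open_nbhs_nbhs; split=> //; exact: closed_openC.
by apply: filterS => -[].
Qed.

Lemma closed_proj (T K : topologicalType) (Z : set (T * K)) :
  compact [set: K] -> closed Z -> closed [set t | exists k, Z (t, k)].
Proof.
move=> cK cZ; rewrite -openC openE => t /= nt.
have : \forall t' \near t, forall k, Z (t', k) -> False.
  apply: near_compact_within => // k Zk; exfalso; apply: nt; by exists k.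
by apply: filterS => t' H [k]; exact: H.
Qed.

Lemma continuous_to_prod (T K : topologicalType) (I : Type)
    (f : T -> prod_topology (fun _ : I => K)) :
  (forall i, continuous (fun t => f t i)) -> continuous f.
Proof.
move=> cf t; apply/cvg_sup => i U [V] [[W oW <-] Wft WU].
apply: (filterS WU); rewrite nbhs_simpl /=.
by apply: (cf i t W); apply: open_nbhs_nbhs.
Qed.

Lemma continuous_prod_coord (K : topologicalType) (I : eqType) (i : I) :
  continuous (fun k : prod_topology (fun _ : I => K) => k i).
Proof. exact: (@proj_continuous I (fun _ => K) i). Qed.

Lemma closed_continuous_preimage (T U : topologicalType) (f : T -> U) (A : set U) :
  continuous f -> closed A -> closed (f @^-1` A).
Proof. by move=> /continuous_closedP cf; exact: cf. Qed.

Lemma closed_forall (T : topologicalType) (I : Type) (A : I -> set T) :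
  (forall i, closed (A i)) -> closed [set t | forall i, A i t].
Proof.
move=> cA; have := @closed_bigI _ _ setT A (fun i _ => cA i).
by congr closed; apply/seteqP; split=> [t H i|t H i _]; exact: H.
Qed.

(** Pair each vertex with its neighbour in direction [i]; the terms of the common face cancel. *)
Lemma alt_sum_glue (V : zmodType) (Q : Type) l (f : Q -> V) (i : 'I_l)
    (p q : vert 'I_l -> Q) : (forall v, p (vset i true v) = q (vset i false v)) ->
  alt_sum f (vglue i p q) = alt_sum f p + alt_sum f q.
Proof.
move=> pq; rewrite /alt_sum.
have split (g : vert 'I_l -> V) : \sum_w g w *~ (-1) ^+ weight w =
    \sum_(w : vert 'I_l | ~~ w i) (g w - g (vset i true w)) *~ (-1) ^+ weight w.
  rewrite (bigID (fun w : vert 'I_l => w i))/= addrC.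
  rewrite [X in _ + X](reindex_onto (vset i true) (vset i false))/=; last first.
    by move=> w wi; rewrite vset_vset -[X in vset i X w]wi vset_id.
  have E (w : vert 'I_l) : vset i true w i && (vset i false (vset i true w) == w) = ~~ w i.
    rewrite vsetE eqxx vset_vset /=; case wi: (w i).
      by apply/eqP => /ffunP/(_ i); rewrite vsetE eqxx wi.
    by rewrite -[X in vset i X w]wi vset_id eqxx.
  rewrite (eq_bigl _ _ E) -big_split; apply: eq_bigr => w /negbTE wi /=.
  by rewrite weight_vset// exprS mulN1r mulrNz mulrzBl.
rewrite !split -big_split; apply: eq_bigr => w /negbTE wi /=.
rewrite -mulrzDl; congr (_ *~ _).
have fw : vset i false w = w by rewrite -[X in vset i X w]wi vset_id.
rewrite /vglue vsetE eqxx wi pq fw.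
by rewrite addrA subrK.
Qed.


Lemma l2norm_alt_sum (R : realType) d l (Q : Type) (f : Q -> 'rV[R]_d) B
    (c : vert 'I_l -> Q) : (forall v, l2norm (f (c v)) <= B) ->
  l2norm (alt_sum f c) <= (2 ^ l)%:R * B.
Proof.
move=> fB; apply: le_trans (ler_l2norm_sum _ _) _.
apply: (@le_trans _ _ (\sum_(v : vert 'I_l) B)).
  by apply: ler_sum => v _; rewrite mulrz_sign; case: ifP; rewrite ?l2normN.
by rewrite sumr_const card_ffun card_bool card_ord mulr_natl.
Qed.

Section Presentation.
Variables (R : realType) (d l : nat).

Local Notation Conf K I := (prod_topology (fun _ : vert I => K)).

(* The topology of [Q] is only used through the compact space [K] that maps onto it. *)
Record presentation (K : topologicalType) (Q Y : Type) (C : cubesys Q) (b : Q -> Y)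
    (p : K -> Q) : Prop := {
  pr_compact : compact [set: K];
  pr_surj : forall q, exists k, p k = q;
  pr_cubes : forall I : finType, closed [set k : Conf K I | C I (fun v => p (k v))];
  pr_fiber : closed [set k : K * K | b (p k.1) = b (p k.2)]
}.

Definition rel_continuous (K : topologicalType) (Q Y : Type) (C : cubesys Q) (b : Q -> Y)
    (p : K -> Q) (r : (vert 'I_l -> Q) -> (vert 'I_l -> Q) -> 'rV[R]_d) : Prop :=
  forall k0 : Conf K 'I_l * Conf K 'I_l, fibered C b (p \o k0.1) (p \o k0.2) ->
  forall e, 0 < e -> \forall k \near k0, fibered C b (p \o k.1) (p \o k.2) ->
    l2norm (r (p \o k.1) (p \o k.2) - r (p \o k0.1) (p \o k0.2)) < e.

Definition l2_continuous (K : topologicalType) (F : K -> 'rV[R]_d) : Prop :=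
  forall k0 e, 0 < e -> \forall k \near k0, l2norm (F k - F k0) < e.

Lemma compact_conf (K : topologicalType) (I : finType) :
  compact [set: K] -> compact [set: Conf K I].
Proof.
move=> cK; have := @tychonoff _ (fun _ : vert I => K) (fun _ => setT) (fun _ => cK).
by congr compact; apply/seteqP; split.
Qed.

Lemma compact_conf2 (K : topologicalType) (I : finType) :
  compact [set: K] -> compact [set: Conf K I * Conf K I].
Proof.
move=> /(@compact_conf K I) cK; have := compact_setX cK cK.
by congr compact; apply/seteqP; split.
Qed.

Section Closedness.
Variables (K : topologicalType) (Q Y : Type) (C : cubesys Q) (b : Q -> Y) (p : K -> Q).
Hypothesis pr : presentation C b p.

Lemma lift_conf (I : finType) (c : vert I -> Q) : exists k : Conf K I, p \o k = c.
Proof.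
have /choice[k kP] : forall v, exists k, p k = c v by move=> v; exact: pr_surj pr _.
by exists k; apply/funext.
Qed.

Lemma closed_cubes (T : topologicalType) (I : finType) (f : T -> Conf K I) :
  continuous f -> closed [set t | C (fun v => p (f t v))].
Proof. by move=> cf; exact: (closed_continuous_preimage cf (pr_cubes pr (I := I))). Qed.

Lemma closed_fiber_eq (T : topologicalType) (f g : T -> K) :
  continuous f -> continuous g -> closed [set t | b (p (f t)) = b (p (g t))].
Proof.
move=> cf cg; have cfg : continuous (fun t => (f t, g t)).
  by move=> t; exact: (cvg_pair (cf t) (cg t)).
exact: (closed_continuous_preimage cfg (pr_fiber pr)).
Qed.

Lemma closed_fibered (T : topologicalType) (I : finType) (f g : T -> Conf K I) :
  continuous f -> continuous g -> closed [set t | fibered C b (p \o f t) (p \o g t)].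
Proof.
move=> cf cg.
have cv (h : T -> Conf K I) v : continuous h -> continuous (fun t => h t v).
  by move=> ch t; exact: (continuous_comp (ch t) (@continuous_prod_coord K _ v _)).
have c3 : closed [set t | forall v, b (p (f t v)) = b (p (g t v))].
  by apply: closed_forall => v; apply: closed_fiber_eq; exact: cv.
have := closedI (closedI (closed_cubes cf) (closed_cubes cg)) c3.
by congr closed; apply/seteqP; split=> t /=; [case=> -[? ?] ?; split|case=> ? ? ?; split].
Qed.

Lemma closed_vertical s (ax : cubespace_axioms C b) (deg : has_degree s C b)
    (T : topologicalType) (f g : T -> K) :
  continuous f -> continuous g -> closed [set t | vertical s C b (p (f t)) (p (g t))].
Proof.
move=> cf cg.
have cF : continuous (fun t => (fun v => if v == vone 'I_s then g t else f t) : Conf K 'I_s).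
  by apply: continuous_to_prod => v; case: (v == _).
have := closedI (closed_fiber_eq cg cf) (closed_cubes cF).
congr closed; apply/seteqP; split=> t /=; rewrite (verticalP ax deg) => -[bt Ct];
  by split=> //; have := Ct; congr C; apply/funext => v; rewrite /set_top; case: ifP.
Qed.

End Closedness.

(** In one step the mean is bounded by delta and [r - d f] by [1 + 2 * 2 ^ l] times delta; the bound
    of lower degree is applied to the latter. *)
Definition step_bound (s : nat) : R := iter s (fun c => 1 + c * (1 + 2 * (2 ^ l)%:R)) 0.

Lemma step_bound_ge0 s : 0 <= step_bound s.
Proof.
by elim: s => //= s IH; rewrite addr_ge0// mulr_ge0// addr_ge0// mulr_ge0.
Qed.

Section Step.
Variables (s : nat) (K : topologicalType) (Q Y : Type) (C : cubesys Q) (b : Q -> Y)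
  (p : K -> Q).
Hypotheses (pr : presentation C b p) (ax : cubespace_axioms C b)
  (deg : has_degree s.+1 C b).

Local Notation fibered := (fibered C b).
Local Notation shift := (shift s.+1 C b).
Local Notation vertical := (vertical s.+1 C b).

Section Modulus.
Variables (r : (vert 'I_l -> Q) -> (vert 'I_l -> Q) -> 'rV[R]_d).
Hypotheses (rcont : rel_continuous C b p r).

(* Compactness makes the continuity of [r] uniform over all shifts [h]; that two
   configurations are moved by the same [h] is a closed condition, expressed by squares. *)
Lemma shift_modulus (k0 : K) e : 0 < e -> \forall k \near k0,
  forall h : vert 'I_l -> Q -> Q, shift h ->
  l2norm (r (fun=> p k) (act h (fun=> p k)) -
          r (fun=> p k0) (act h (fun=> p k0))) <= e.
Proof.
move=> e0.
pose cst (k : K) : Conf K 'I_l := fun=> k.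
pose Z := [set t : K * (Conf K 'I_l * Conf K 'I_l) |
  [/\ fibered (p \o cst t.1) (p \o t.2.1), fibered (p \o cst k0) (p \o t.2.2) &
   forall v, C (square (s := s.+1) (p t.1) (p (t.2.1 v)) (p k0) (p (t.2.2 v)))]].
have c1 : continuous (fun t : K * (Conf K 'I_l * Conf K 'I_l) => t.1).
  by move=> t; exact: cvg_fst.
have c2 : continuous (fun t : K * (Conf K 'I_l * Conf K 'I_l) => t.2).
  by move=> t; exact: cvg_snd.
have c21 : continuous (fun t : K * (Conf K 'I_l * Conf K 'I_l) => t.2.1).
  by move=> t; exact: (continuous_comp (c2 t) cvg_fst).
have c22 : continuous (fun t : K * (Conf K 'I_l * Conf K 'I_l) => t.2.2).
  by move=> t; exact: (continuous_comp (c2 t) cvg_snd).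
have cK (T : topologicalType) (f : T -> K) : continuous f ->
    continuous (fun t => cst (f t)).
  by move=> cf; apply: continuous_to_prod.
have ck0 (T : topologicalType) : continuous (fun _ : T => k0) by move=> t; exact: cvg_cst.
have cv (T : topologicalType) (h : T -> Conf K 'I_l) v :
    continuous h -> continuous (fun t => h t v).
  by move=> ch t; exact: (continuous_comp (ch t) (@continuous_prod_coord K _ v _)).
have cZ : closed Z.
  have F1 := closed_fibered pr (cK _ _ c1) c21.
  have F2 := closed_fibered pr (cK _ _ (ck0 _)) c22.
  have F3 : closed [set t : K * (Conf K 'I_l * Conf K 'I_l) |
      forall v, C (square (s := s.+1) (p t.1) (p (t.2.1 v)) (p k0) (p (t.2.2 v)))].
    apply: closed_forall => v.
    have csq : continuous (fun t : K * (Conf K 'I_l * Conf K 'I_l) =>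
        square (s := s.+1) t.1 (t.2.1 v) k0 (t.2.2 v) : Conf K (unit + 'I_s.+1)%type).
      apply: continuous_to_prod => u; rewrite /square.
      by case: (vinr u == _); case: (u (inl tt));
        [exact: (cv _ _ v c22)|exact: (cv _ _ v c21)|exact: ck0|exact: c1].
    have := closed_cubes pr csq; congr closed; apply/seteqP; split=> t /=;
      congr C; apply/funext => u; rewrite /square; by case: (vinr u == _); case: (u (inl tt)).
  have := closedI (closedI F1 F2) F3.
  by congr closed; apply/seteqP; split=> t /=; [case=> -[? ?] ?; split|case=> ? ? ?; split].
have e2 : 0 < e / 2 by rewrite divr_gt0.
have H := near_compact_within (t0 := k0) (P := fun k (kk : Conf K 'I_l * Conf K 'I_l) =>
  l2norm (r (p \o cst k) (p \o kk.1) - r (p \o cst k0) (p \o kk.2)) < e)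
  (compact_conf2 (pr_compact pr)) cZ _.
apply: filterS (H _) => {H} [k Hk h Sh|[x y] [/= Fx Fy Sq]].
  have [x hx] := lift_conf pr (act h (fun=> p k)).
  have [y hy] := lift_conf pr (act h (fun=> p k0)).
  have := Hk (x, y); rewrite /= hx hy; move=> H; apply: ltW; apply: H.
  split=> /=.
  - by rewrite hx; exact: (fibered_act Sh (cube_cst ax _ (p k))).
  - by rewrite hy; exact: (fibered_act Sh (cube_cst ax _ (p k0))).
  move=> v; have -> : p (x v) = h v (p k) by rewrite -[LHS]/((p \o x) v) hx.
  have -> : p (y v) = h v (p k0) by rewrite -[LHS]/((p \o y) v) hy.
  by apply: (square_translation ax); case: Sh.
(* Over [k0] itself the square has equal base points, so its two ends coincide. *)
have xy : p \o x = p \o y.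
  apply/funext => v /=; have [_ _ bx] := Fx; have [_ _ by_] := Fy.
  apply: (square_unique ax deg _ _ (Sq v)); first by rewrite -bx -by_.
  have mr := @vert_morphism_pair unit 'I_s.+1 _ _ _
    (vert_morphism_cst _ (vzero unit)) (@vert_morphism_inr unit 'I_s.+1).
  have := ax_comp ax mr (Sq v); congr C; apply/funext => u.
  by rewrite /square vpairr !ffunE; case: (u (inl tt)).
have N1 : \forall t \near (k0, (x, y)), fibered (p \o cst t.1) (p \o t.2.1) ->
    l2norm (r (p \o cst t.1) (p \o t.2.1) - r (p \o cst k0) (p \o x)) < e / 2.
  have cc : continuous (fun t : K * (Conf K 'I_l * Conf K 'I_l) => (cst t.1, t.2.1)).
    by move=> t; exact: (cvg_pair (cK _ _ c1 t) (c21 t)).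
  exact: (cc (k0, (x, y)) _ (rcont (k0 := (cst k0, x)) Fx e2)).
have N2 : \forall t \near (k0, (x, y)), fibered (p \o cst k0) (p \o t.2.2) ->
    l2norm (r (p \o cst k0) (p \o t.2.2) - r (p \o cst k0) (p \o y)) < e / 2.
  have cc : continuous (fun t : K * (Conf K 'I_l * Conf K 'I_l) => (cst k0, t.2.2)).
    by move=> t; exact: (cvg_pair (cvg_cst _) (c22 t)).
  exact: (cc (k0, (x, y)) _ (rcont (k0 := (cst k0, y)) Fy e2)).
apply: filterS2 N1 N2 => t H1 H2 [/= F1 F2 _].
rewrite -[X in l2norm X](subrKA (r (p \o cst k0) (p \o x))).
apply: le_lt_trans (ler_l2normD _ _) _; rewrite (splitr e) ltrD//.
  exact: H1.
rewrite -l2normN opprB xy; exact: H2.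
Qed.

End Modulus.
End Step.
End Presentation.

(** * Induction on the degree *)

Lemma exists_quotient (Q : choiceType) (e : Q -> Q -> Prop) :
  (forall x, e x x) -> (forall x y, e x y -> e y x) ->
  (forall x y z, e x y -> e y z -> e x z) ->
  exists (Q' : choiceType) (m : Q -> Q') (sec : Q' -> Q),
    cancel sec m /\ forall x y, m x = m y <-> e x y.
Proof.
move=> er es et; pose eb : rel Q := fun x y => `[< e x y >].
have ebr : reflexive eb by move=> x; exact/asboolP.
have ebs : symmetric eb by move=> x y; apply/asboolP/asboolP; exact: es.
have ebt : transitive eb.
  by move=> y x z /asboolP xy /asboolP yz; apply/asboolP; exact: et yz.
pose eq := EquivRel eb ebr ebs ebt.
exists {eq_quot eq}%qT, (fun x => \pi_({eq_quot eq}) x)%qT, (fun q => repr q).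
split=> [q|x y]; first exact: reprK.
split=> [/eqmodP/asboolP//|xy]; by apply/eqmodP/asboolP.
Qed.

Lemma l2norm_alt_sumB (R : realType) d l (Q : Type) (f : Q -> 'rV[R]_d) B
    (c c' : vert 'I_l -> Q) : (forall v, l2norm (f (c v) - f (c' v)) <= B) ->
  l2norm (alt_sum f c - alt_sum f c') <= (2 ^ l)%:R * B.
Proof.
move=> fB; rewrite /alt_sum -sumrB.
apply: le_trans (ler_l2norm_sum _ _) _.
apply: (@le_trans _ _ (\sum_(v : vert 'I_l) B)).
  apply: ler_sum => v _; rewrite -mulrzBl mulrz_sign.
  by case: ifP; rewrite ?l2normN.
by rewrite sumr_const card_ffun card_bool card_ord mulr_natl.
Qed.

Section SubtractCoboundary.
Variables (R : realType) (d l : nat) (Q Y : Type) (C : cubesys Q) (b : Q -> Y).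
Variables (r : (vert 'I_l -> Q) -> (vert 'I_l -> Q) -> 'rV[R]_d) (f : Q -> 'rV[R]_d).
Hypothesis rc : relative_cocycle C b r.

Definition sub_coboundary (c c' : vert 'I_l -> Q) : 'rV[R]_d :=
  r c c' - (alt_sum f c' - alt_sum f c).

Lemma sub_coboundary_cocycle : relative_cocycle C b sub_coboundary.
Proof.
split=> [p q t pq qt|i p q p' q' pp' qq' pq p'q']; rewrite /sub_coboundary.
  rewrite -(rc_trans rc pq qt) addrACA -opprD; congr (_ - _).
  by rewrite addrC subrKA.
rewrite (rc_glue rc pp' qq' pq p'q') !alt_sum_glue//.
by rewrite [RHS]addrACA -opprD; congr (_ - _); rewrite [RHS]addrACA -opprD.
Qed.

Lemma sub_coboundary_le delta :
  (forall c c', fibered C b c c' -> l2norm (r c c') <= delta) ->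
  (forall x, l2norm (f x) <= delta) ->
  forall c c', fibered C b c c' ->
    l2norm (sub_coboundary c c') <= (1 + 2 * (2 ^ l)%:R) * delta.
Proof.
move=> rle fle c c' cc'; rewrite mulrDl mul1r -mulrA mulr_natl mulr2n.
apply: le_trans (ler_l2normD _ _) _; rewrite lerD ?rle// l2normN.
apply: le_trans (ler_l2normD _ _) _; rewrite l2normN.
by rewrite lerD// l2norm_alt_sum.
Qed.

Lemma sub_coboundary_continuous (K : topologicalType) (p : K -> Q) :
  rel_continuous C b p r -> l2_continuous (f \o p) ->
  rel_continuous C b p sub_coboundary.
Proof.
move=> rcont fcont.
have acont (k0 : prod_topology (fun _ : vert 'I_l => K)) e : 0 < e ->
    \forall k \near k0, l2norm (alt_sum f (p \o k) - alt_sum f (p \o k0)) < e.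
  move=> e0; pose N : R := (2 ^ l)%:R.
  have N0 : 0 < N by rewrite ltr0n expn_gt0.
  have eN : 0 < e / (2 * N) by rewrite divr_gt0// mulr_gt0.
  have H : \forall k \near k0, forall v, l2norm (f (p (k v)) - f (p (k0 v))) < e / (2 * N).
    apply: (@filter_forall _ _ (fun (v : vert 'I_l) (k : prod_topology (fun _ : vert 'I_l => K)) =>
      l2norm (f (p (k v)) - f (p (k0 v))) < e / (2 * N)) (nbhs k0) _) => v.
    exact: (@continuous_prod_coord K _ v k0 _ (fcont (k0 v) _ eN)).
  have FF : Filter (nbhs k0) by exact: nbhs_filter.
  apply: filterS H => k Hk.
  apply: le_lt_trans (l2norm_alt_sumB (B := e / (2 * N)) (fun v => ltW (Hk v))) _.
  rewrite -/N (_ : N * (e / (2 * N)) = e / 2); last by field; rewrite gt_eqF.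
  lra.
move=> k0 k0P e e0; have e3 : 0 < e / 3 by lra.
have N1 := rcont k0 k0P _ e3.
have N2 : \forall k \near k0, l2norm (alt_sum f (p \o k.1) - alt_sum f (p \o k0.1)) < e / 3.
  exact: (@cvg_fst _ _ (nbhs k0.1) (nbhs k0.2) _ _ (acont k0.1 _ e3)).
have N3 : \forall k \near k0, l2norm (alt_sum f (p \o k.2) - alt_sum f (p \o k0.2)) < e / 3.
  exact: (@cvg_snd _ _ (nbhs k0.1) (nbhs k0.2) _ _ (acont k0.2 _ e3)).
apply: filterS3 N1 N2 N3 => k H1 H2 H3 kP; rewrite /sub_coboundary.
set r1 := r _ _; set r0 := r _ _; set a1 := alt_sum f (p \o k.1).
set a2 := alt_sum f (p \o k.2).
have -> : r1 - (a2 - a1) - (r0 - (alt_sum f (p \o k0.2) - alt_sum f (p \o k0.1))) =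
    (r1 - r0) + ((a1 - alt_sum f (p \o k0.1)) - (a2 - alt_sum f (p \o k0.2))).
  by apply/rowP => j; rewrite !mxE; ring.
apply: le_lt_trans (ler_l2normD _ _) _.
have := ler_l2normD (a1 - alt_sum f (p \o k0.1)) (- (a2 - alt_sum f (p \o k0.2))).
by rewrite l2normN; have := H1 kP; rewrite -/r1 -/r0; lra.
Qed.

End SubtractCoboundary.

(** * Descent of the relative cocycle to the quotient of lower degree *)

Section QuotientCocycle.
Variables (R : realType) (d l s : nat) (Q Y : Type) (C : cubesys Q) (b : Q -> Y).
Hypotheses (ax : cubespace_axioms C b) (deg : has_degree s.+1 C b).
Variables (Q' : Type) (m : Q -> Q') (sec : Q' -> Q).
Hypotheses (secK : cancel sec m) (mP : forall x y, m x = m y <-> vertical s.+1 C b x y).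
Variable r : (vert 'I_l -> Q) -> (vert 'I_l -> Q) -> 'rV[R]_d.
Hypotheses (rc : relative_cocycle C b r)
  (r0 : forall c c', C c -> C c' -> (forall v, vertical s.+1 C b (c v) (c' v)) -> r c c' = 0).

Local Notation C' := (quotient_cubes C m).
Local Notation b' := (b \o sec).

Lemma fiber_sec x : b' (m x) = b x.
Proof.
have /mP xv : m (sec (m x)) = m x by rewrite secK.
by rewrite /= (vertical_fiber ax deg xv).
Qed.

Definition cube_lift (c : vert 'I_l -> Q') : vert 'I_l -> Q :=
  if pselect (C' c) is left H then s2val (cid2 H) else sec \o c.

Lemma cube_liftP c : C' c -> C (cube_lift c) /\ forall v, m (cube_lift c v) = c v.
Proof.
move=> H; rewrite /cube_lift; case: pselect => // {}H.
by split; [exact: (s2valP (cid2 H))|exact: (s2valP' (cid2 H))].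
Qed.

Definition quotient_cocycle (c c' : vert 'I_l -> Q') : 'rV[R]_d :=
  r (cube_lift c) (cube_lift c').

Lemma fibered_lift c c' : fibered C' b' c c' ->
  fibered C b (cube_lift c) (cube_lift c').
Proof.
move=> [/cube_liftP[Cc mc] /cube_liftP[Cc' mc'] cc']; split=> // v.
by rewrite -!fiber_sec mc mc'.
Qed.

(** Two lifts of a cube differ vertically, and there [r] vanishes by [r0]; so the choice made in
    [cube_lift] is harmless. *)
Lemma quotient_cocycleE c c' : fibered C b c c' ->
  quotient_cocycle (m \o c) (m \o c') = r c c'.
Proof.
move=> [Cc Cc' cc']; have [|C1 m1] := @cube_liftP (m \o c); first by exists c.
have [|C2 m2] := @cube_liftP (m \o c'); first by exists c'.
have V1 v : vertical s.+1 C b (cube_lift (m \o c) v) (c v) by apply/mP; exact: m1.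
have V2 v : vertical s.+1 C b (c' v) (cube_lift (m \o c') v).
  by apply/mP; rewrite m2.
have F1 : fibered C b (cube_lift (m \o c)) c.
  by split=> // v; rewrite (vertical_fiber ax deg (V1 v)).
have F2 : fibered C b c' (cube_lift (m \o c')).
  by split=> // v; rewrite (vertical_fiber ax deg (V2 v)).
have F : fibered C b c c' by [].
rewrite /quotient_cocycle -(rc_trans rc F1 (fibered_trans F F2)) -(rc_trans rc F F2).
by rewrite (r0 C1 Cc V1) (r0 Cc' C2 V2) add0r addr0.
Qed.

(** The chosen lifts of two glueable cubes need not match on the common face; [quotient_glue_lift]
    provides lifts that do. *)
Lemma quotient_cocycle_cocycle : relative_cocycle C' b' quotient_cocycle.
Proof.
split=> [p q t pq qt|i p q p' q' [Cp Cp' pp'] [Cq Cq' qq'] pq p'q'].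
  exact: (rc_trans rc (fibered_lift pq) (fibered_lift qt)).
have [p1 [q1 [Cp1 Cq1 mp mq pq1]]] := quotient_glue_lift ax deg mP Cp Cq pq.
have [p1' [q1' [Cp1' Cq1' mp' mq' pq1']]] := quotient_glue_lift ax deg mP Cp' Cq' p'q'.
have Fp : fibered C b p1 p1' by split=> // v; rewrite -!fiber_sec mp mp'.
have Fq : fibered C b q1 q1' by split=> // v; rewrite -!fiber_sec mq mq'.
have E (t u : vert 'I_l -> Q') t1 u1 : (forall v, m (t1 v) = t v) ->
    (forall v, m (u1 v) = u v) -> vglue i t u = m \o vglue i t1 u1.
  by move=> mt mu; apply/funext => v; rewrite /vglue /=; case: ifP.
rewrite (E _ _ _ _ mp mq) (E _ _ _ _ mp' mq') quotient_cocycleE; last first.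
  split; [exact: (ax_glue ax Cp1 Cq1 pq1)|exact: (ax_glue ax Cp1' Cq1' pq1')|].
  move=> v; have [_ _ bp] := Fp; have [_ _ bq] := Fq.
  by rewrite /vglue; case: ifP.
rewrite (rc_glue rc Fp Fq pq1 pq1') -!quotient_cocycleE//.
by congr (quotient_cocycle _ _ + quotient_cocycle _ _); apply/funext.
Qed.

End QuotientCocycle.

Section QuotientTopology.
Variables (R : realType) (d l s : nat) (K : topologicalType) (Q Y : Type)
  (C : cubesys Q) (b : Q -> Y) (p : K -> Q).
Hypotheses (pr : presentation C b p) (ax : cubespace_axioms C b)
  (deg : has_degree s.+1 C b).
Variables (Q' : Type) (m : Q -> Q') (sec : Q' -> Q).
Hypotheses (secK : cancel sec m) (mP : forall x y, m x = m y <-> vertical s.+1 C b x y).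

Local Notation C' := (quotient_cubes C m).
Local Notation b' := (b \o sec).
Local Notation Conf I := (prod_topology (fun _ : vert I => K)).

Lemma quotient_cubesP (I : finType) (k : Conf I) : C' (fun v => m (p (k v))) <->
  exists k1 : Conf I, C (fun v => p (k1 v)) /\
    forall v, vertical s.+1 C b (p (k v)) (p (k1 v)).
Proof.
split=> [[c Cc mc]|[k1 [Ck1 kk1]]].
  have [k1 k1c] := lift_conf pr c; exists k1.
  have pk1 v : p (k1 v) = c v by rewrite -k1c.
  split=> [|v]; first by have := Cc; congr C; apply/funext.
  by rewrite pk1; apply/mP; rewrite mc.
by exists (fun v => p (k1 v)) => // v; apply/esym/mP.
Qed.

Lemma continuous_coord (T : topologicalType) (I : finType) (f : T -> Conf I) v :
  continuous f -> continuous (fun t => f t v).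
Proof. by move=> cf t; exact: (continuous_comp (cf t) (@continuous_prod_coord K _ v _)). Qed.

Lemma quotient_presentation : presentation C' b' (m \o p).
Proof.
split.
- exact: pr_compact pr.
- by move=> q; have [k pk] := pr_surj pr (sec q); exists k; rewrite /= pk secK.
- move=> I.
  have c1 : continuous (fun t : Conf I * Conf I => t.1) by move=> t; exact: cvg_fst.
  have c2 : continuous (fun t : Conf I * Conf I => t.2) by move=> t; exact: cvg_snd.
  have cV : closed [set t : Conf I * Conf I | forall v,
      vertical s.+1 C b (p (t.1 v)) (p (t.2 v))].
    by apply: closed_forall => v; apply: closed_vertical => //; exact: continuous_coord.
  have := closed_proj (compact_conf (I := I) (pr_compact pr)) (closedI (closed_cubes pr c2) cV).
  congr closed; apply/seteqP; split=> k /=; first by move/quotient_cubesP.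
  by move=> Ck; apply/quotient_cubesP.
have E x : b (sec (m x)) = b x by exact: (fiber_sec ax deg secK mP).
by have := pr_fiber pr; congr closed; apply/seteqP; split=> k /=; rewrite !E.
Qed.

Variable r : (vert 'I_l -> Q) -> (vert 'I_l -> Q) -> 'rV[R]_d.
Hypotheses (rc : relative_cocycle C b r)
  (r0 : forall c c', C c -> C c' -> (forall v, vertical s.+1 C b (c v) (c' v)) -> r c c' = 0)
  (rcont : rel_continuous C b p r).

(** The pairs of lifts form a closed set over a compact space, and [r] is continuous at each lift of
    [k0] with the same value there; the tube lemma then covers all lifts of nearby pairs. *)
Lemma quotient_cocycle_continuous :
  rel_continuous C' b' (m \o p) (quotient_cocycle C m sec r).
Proof.
move=> k0 F0 e e0.
pose T := (Conf 'I_l * Conf 'I_l)%type.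
have c1 : continuous (fun t : T * T => t.1) by move=> t; exact: cvg_fst.
have c2 : continuous (fun t : T * T => t.2) by move=> t; exact: cvg_snd.
have c11 : continuous (fun t : T * T => t.1.1).
  by move=> t; exact: (continuous_comp (c1 t) cvg_fst).
have c12 : continuous (fun t : T * T => t.1.2).
  by move=> t; exact: (continuous_comp (c1 t) cvg_snd).
have c21 : continuous (fun t : T * T => t.2.1).
  by move=> t; exact: (continuous_comp (c2 t) cvg_fst).
have c22 : continuous (fun t : T * T => t.2.2).
  by move=> t; exact: (continuous_comp (c2 t) cvg_snd).
pose Z := [set t : T * T | [/\ fibered C b (p \o t.2.1) (p \o t.2.2),
  forall v, vertical s.+1 C b (p (t.1.1 v)) (p (t.2.1 v)) &
  forall v, vertical s.+1 C b (p (t.1.2 v)) (p (t.2.2 v))]].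
have cZ : closed Z.
  have F1 := closed_fibered pr c21 c22.
  have F2 : closed [set t : T * T | forall v, vertical s.+1 C b (p (t.1.1 v)) (p (t.2.1 v))].
    apply: closed_forall => v.
    have c1v := continuous_coord (v := v) c11; have c2v := continuous_coord (v := v) c21.
    exact: (closed_vertical pr ax deg c1v c2v).
  have F3 : closed [set t : T * T | forall v, vertical s.+1 C b (p (t.1.2 v)) (p (t.2.2 v))].
    by apply: closed_forall => v; exact: (closed_vertical pr ax deg (continuous_coord (v := v) c12) (continuous_coord (v := v) c22)).
  have := closedI (closedI F1 F2) F3.
  by congr closed; apply/seteqP; split=> t /=; [case=> -[? ?] ?; split|case=> ? ? ?; split].
have rE (t : T * T) : Z t -> r (p \o t.2.1) (p \o t.2.2) =
    quotient_cocycle C m sec r (m \o p \o t.1.1) (m \o p \o t.1.2).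
  move=> [F V1 V2]; rewrite -(quotient_cocycleE ax deg sec mP rc r0 F).
  congr (quotient_cocycle _ _ _ _ _ _); apply/funext => v; apply/esym/mP => //=.
have H := near_compact_within (t0 := k0) (P := fun (k k1 : T) =>
  l2norm (r (p \o k1.1) (p \o k1.2) -
    quotient_cocycle C m sec r (m \o p \o k0.1) (m \o p \o k0.2)) < e)
  (compact_conf2 (pr_compact pr)) cZ _.
apply: filterS (H _) => {H} [k Hk Fk|k1 Zk1].
  have [k1 k1E] := lift_conf pr (cube_lift C m sec (m \o p \o k.1)).
  have [k2 k2E] := lift_conf pr (cube_lift C m sec (m \o p \o k.2)).
  have := Hk (k1, k2); rewrite /= k1E k2E; apply.
  have F := fibered_lift ax deg secK mP Fk.
  have [Ck1 Ck2 _] := Fk.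
  have [_ m1] := cube_liftP sec Ck1; have [_ m2] := cube_liftP sec Ck2.
  split=> /=; first by rewrite k1E k2E.
    move=> v; apply/mP; rewrite -[p (k1 v)]/((p \o k1) v) k1E.
    by rewrite m1.
  move=> v; apply/mP; rewrite -[p (k2 v)]/((p \o k2) v) k2E.
  by rewrite m2.
have [F1 _ _] := Zk1; rewrite -(rE _ Zk1).
have N : \forall t \near (k0, k1), fibered C b (p \o t.2.1) (p \o t.2.2) ->
    l2norm (r (p \o t.2.1) (p \o t.2.2) - r (p \o k1.1) (p \o k1.2)) < e.
  exact: (c2 (k0, k1) _ (rcont (k0 := k1) F1 e0)).
by apply: filterS N => t Ht [Ft _ _]; exact: Ht.
Qed.

End QuotientTopology.

Lemma fiber_cocycle_trivial (R : realType) (d l : nat) : (0 < l)%N ->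
  forall s (K : topologicalType) (Q : choiceType) (Y : Type) (C : cubesys Q)
    (b : Q -> Y) (p : K -> Q) (r : (vert 'I_l -> Q) -> (vert 'I_l -> Q) -> 'rV[R]_d)
    (delta : R),
  presentation C b p -> cubespace_axioms C b -> has_degree s C b ->
  relative_cocycle C b r -> rel_continuous C b p r ->
  (forall c c', fibered C b c c' -> l2norm (r c c') <= delta) -> 0 <= delta ->
  exists f : Q -> 'rV[R]_d,
    [/\ forall x, l2norm (f x) <= step_bound R l s * delta,
        l2_continuous (f \o p) &
        forall c c', fibered C b c c' -> r c c' = alt_sum f c' - alt_sum f c].
Proof.
move=> l0; elim=> [|s IH] K Q Y C b p r delta pr ax deg rc rcont rle delta0.
  exists (fun=> 0); split.
  - by move=> x; rewrite l2norm0 /step_bound /= mul0r.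
  - move=> k0 e e0; apply: nearW => k /=.
    by rewrite subrr l2norm0.
  move=> c c' [Cc Cc' cc'].
  (* In degree 0 the fibres are points: the edges from [c v] to [c v] and to [c' v] agree off the
     top. *)
  have -> : c' = c.
    apply/funext => v; have := deg _ _ (edge_cube ax (ord0 : 'I_1) (c v) (c v))
      (edge_cube ax (ord0 : 'I_1) (c v) (c' v)).
    rewrite !ffunE => -> // w; first by case: ifP.
    by move=> /neq_vone[i]; rewrite (ord1 i) => ->.
  by rewrite subrr (rc_refl rc).
have [f [fle fvert fclose]] := vertical_average ax deg isT rc l0 rle.
have fcont : l2_continuous (f \o p).
  move=> k0 e e0; have e2 : 0 < e / 2 by rewrite divr_gt0.
  apply: filterS (shift_modulus pr ax deg rcont k0 e2) => k Hk.
  by apply: (le_lt_trans (fclose _ _ _ Hk)); lra.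
pose r1 := sub_coboundary r f.
have rc1 : relative_cocycle C b r1 by exact: sub_coboundary_cocycle.
have r1cont : rel_continuous C b p r1 by exact: sub_coboundary_continuous.
have r1le := sub_coboundary_le rle fle.
have r10 c c' : C _ c -> C _ c' -> (forall v, vertical s.+1 C b (c v) (c' v)) -> r1 c c' = 0.
  by move=> Cc Cc' V; rewrite /r1 /sub_coboundary fvert// subrr.
have [Q' [m [sec [secK mP]]]] := exists_quotient (@vertical_refl s.+1 Q Y C b)
  (@vertical_sym _ _ _ _ _ ax deg) (@vertical_trans _ _ _ _ _).
have m_surj q : exists x, m x = q by exists (sec q).
have b'm := fiber_sec ax deg secK mP.
have delta1 : 0 <= (1 + 2 * (2 ^ l)%:R) * delta by rewrite mulr_ge0// addr_ge0// mulr_ge0.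
have [|f1 [f1le f1cont f1P]] := IH K Q' Y _ _ _ _ _ (quotient_presentation pr ax deg secK mP)
  (quotient_axioms ax deg m_surj mP b'm) (quotient_degree ax deg mP b'm)
  (quotient_cocycle_cocycle ax deg secK mP rc1 r10)
  (quotient_cocycle_continuous pr ax deg secK mP rc1 r10 r1cont) _ delta1.
  by move=> c c' cc'; apply: r1le; exact: (fibered_lift ax deg secK mP).
exists (fun x => f x + f1 (m x)); split.
- move=> x; apply: le_trans (ler_l2normD _ _) _.
  rewrite /step_bound iterS -/(step_bound R l s) mulrDl mul1r lerD//.
  by rewrite -mulrA; exact: f1le.
- move=> k0 e e0; have e2 : 0 < e / 2 by rewrite divr_gt0.
  apply: filterS2 (fcont k0 _ e2) (f1cont k0 _ e2) => k H1 H2 /=.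
  rewrite opprD addrACA (splitr e); apply: le_lt_trans (ler_l2normD _ _) _.
  exact: ltrD.
move=> c c' cc'.
have altD (e : vert 'I_l -> Q) : alt_sum (fun x => f x + f1 (m x)) e =
    alt_sum f e + alt_sum f1 (m \o e).
  by rewrite /alt_sum -big_split; apply: eq_bigr => v _; rewrite mulrzDl.
have [Cc Cc' bcc'] := cc'.
have := f1P (m \o c) (m \o c').
rewrite (quotient_cocycleE ax deg sec mP rc1 r10 cc') => H.
have {}H : r1 c c' = alt_sum f1 (m \o c') - alt_sum f1 (m \o c).
  by apply: H; split=> [||v]; [exists c|exists c'|rewrite !b'm].
rewrite !altD opprD addrACA -H /r1 /sub_coboundary addrC subrK.
by [].
Qed.

(** * Cubes of a compact cubespace *)

Lemma vins_vdel n (i : 'I_n) (w : vertex n) : vins i (w i) (vdel i w) = w.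
Proof.
apply/ffunP => j; rewrite ffunE; case: unliftP => [k ->|->//].
by rewrite ffunE.
Qed.

Lemma vins_vset n (i : 'I_n) a b (v : vertex n.-1) :
  vset i a (vins i b v) = vins i a v.
Proof.
apply/ffunP => j; rewrite !ffunE; case: unliftP => [k ->|->]; last by rewrite eqxx.
by rewrite eq_sym (negbTE (neq_lift _ _)).
Qed.

Lemma vins_coord n (i : 'I_n) a (v : vertex n.-1) : vins i a v i = a.
Proof. by rewrite ffunE unlift_none. Qed.

Lemma vert_morphism_vins n (i : 'I_n) a :
  vert_morphism (vins i a : vert 'I_n.-1 -> vert 'I_n).
Proof.
move=> j; case E: (unlift i j) => [k|].
  by constructor 3; exists k => w; rewrite ffunE E.
by case: a; [constructor 2|constructor 1] => w; rewrite ffunE E.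
Qed.

Lemma concat_vins (X : topologicalType) n (i : 'I_n) (c : config n X) :
  concat i (c \o vins i false) (c \o vins i true) = c.
Proof.
apply/funext => w; rewrite /concat /=.
by rewrite -[in RHS](vins_vdel i w); case: (w i).
Qed.

Lemma concat_vset (X : topologicalType) n (i : 'I_n) (c c' : config n X) :
  concat i (c \o vins i false) (c' \o vins i true) =
    fun w => if w i then c' w else c w.
Proof.
apply/funext => w; rewrite /concat /=.
by case wi: (w i); rewrite -[in RHS](vins_vdel i w) wi.
Qed.

Section Bridge.
Variable R : realType.
Implicit Types X Y : compact_cubespace R.

Definition of_ord (I : finType) (w : vertex #|I|) : vert I := [ffun i => w (enum_rank i)].

Definition to_ord (I : finType) (v : vert I) : vertex #|I| := [ffun k => v (enum_val k)].

Lemma to_ordK (I : finType) : cancel (@to_ord I) (@of_ord I).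
Proof. by move=> v; apply/ffunP => i; rewrite !ffunE enum_rankK. Qed.

Lemma of_ordK (I : finType) : cancel (@of_ord I) (@to_ord I).
Proof. by move=> v; apply/ffunP => i; rewrite !ffunE enum_valK. Qed.

Definition fcubes X : cubesys X := fun I c => cubes X #|I| (fun w => c (of_ord w)).

Lemma fcubes_comp X (I J : finType) (phi : vert I -> vert J) (c : vert J -> X) :
  vert_morphism phi -> fcubes c -> fcubes (fun v => c (phi v)).
Proof.
move=> mphi Cc.
have m : cube_morphism (fun w : vertex #|I| => to_ord (phi (of_ord w))).
  move=> k; have [H|H|[i H]|[i H]] := mphi (enum_val k).
  - by constructor 1 => w; rewrite ffunE.
  - by constructor 2 => w; rewrite ffunE.
  - by constructor 3; exists (enum_rank i) => w; rewrite ffunE H ffunE.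
  - by constructor 4; exists (enum_rank i) => w; rewrite ffunE H ffunE.
have := cubes_comp Cc m; congr (cubes X _); apply/funext => w /=.
by rewrite to_ordK.
Qed.

Lemma fcubes_ord X n (c : vert 'I_n -> X) : fcubes c <-> cubes X n c.
Proof.
split=> Cc.
  have m : cube_morphism (@to_ord 'I_n).
    by move=> k; constructor 3; exists (enum_val k) => w; rewrite ffunE.
  have := cubes_comp Cc m; congr (cubes X _); apply/funext => w /=.
  by rewrite to_ordK.
have m : cube_morphism (@of_ord 'I_n).
  by move=> k; constructor 3; exists (enum_rank k) => w; rewrite ffunE.
exact: (cubes_comp Cc m).
Qed.

Lemma fcubes_edge X : ergodic X -> forall x y : X, fcubes (edge x y).
Proof.
move=> eX x y.
have C1 : fcubes (fun v : vert 'I_1 => if v ord0 then y else x).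
  by apply/fcubes_ord; rewrite (eX : cubes X 1 = setT).
have := fcubes_comp (vert_morphism_comap (fun _ : 'I_1 => tt)) C1.
congr (@fcubes X _ _); apply/funext => v.
by rewrite /edge ffunE.
Qed.

Lemma fcubes_glue X : glueing_axiom X -> forall (I : finType) (i : I) (p q : vert I -> X),
  fcubes p -> fcubes q -> (forall v, p (vset i true v) = q (vset i false v)) ->
  fcubes (fun v => if v i then q v else p v).
Proof.
move=> gX I i p q Cp Cq pq; pose k := enum_rank i.
pose P : config #|I| X := fun w => p (of_ord w).
pose Q : config #|I| X := fun w => q (of_ord w).
have PQ : P \o vins k true = Q \o vins k false.
  apply/funext => v; rewrite /P /Q /=.
  have E a (u : vertex #|I|) : of_ord (vset k a u) = vset i a (of_ord u).
    by apply/ffunP => j; rewrite !ffunE (inj_eq enum_rank_inj).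
  by have := pq (of_ord (vins k true v)); rewrite -!E !vins_vset.
have := gX #|I| k (P \o vins k false) (P \o vins k true) (Q \o vins k true).
rewrite concat_vins => /(_ Cp); rewrite PQ concat_vins => /(_ Cq).
by rewrite concat_vset; congr (cubes X _); apply/funext => w; rewrite ffunE.
Qed.

Lemma fcubes_fib X Y (beta : X -> Y) : fibration beta ->
  forall (I : finType) (lam : vert I -> X) (e : vert I -> Y),
  (forall i : I, fcubes (fun v => lam (vset i false v))) -> fcubes e ->
  (forall v, v != vone I -> beta (lam v) = e v) ->
  exists2 w, beta w = e (vone I) & fcubes (set_top lam w).
Proof.
move=> [_ fib] I lam e Clam Ce lame.
have of1 (w : vertex #|I|) : (of_ord w == vone I) = (w == vtop _).
  apply/eqP/eqP => [w1|->]; last by apply/ffunP => i; rewrite !ffunE.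
  by rewrite -(of_ordK w) w1; apply/ffunP => k; rewrite !ffunE.
pose L (w : punctured #|I|) := lam (of_ord (val w)).
have [] := fib #|I| L (fun w => e (of_ord w)) _ Ce.
- move=> i; have := cubes_comp (Clam (enum_val i)) (@vert_morphism_vins _ i false).
  congr (cubes X _); apply/funext => u; rewrite /L /=; congr lam.
  by rewrite -[RHS](vset_id (enum_val i)) [of_ord _ _]ffunE enum_valK vins_coord.
- by move=> w; rewrite /L lame// of1; exact: valP w.
move=> c' [Cc' c'L bc']; exists (c' (vtop _)).
  have := congr1 (@^~ (vtop _)) bc'; rewrite /= => ->; congr e.
  by apply/eqP; rewrite of1.
have := Cc'; congr (cubes X _); apply/funext => w; rewrite /set_top of1.
by case: eqP => [->//|/eqP wN1]; rewrite -[w]/(val (exist _ w wN1 : punctured _)) c'L.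
Qed.

Lemma fcubes_axioms X Y (beta : X -> Y) : ergodic X -> glueing_axiom X ->
  fibration beta -> cubespace_axioms (@fcubes X) beta.
Proof.
move=> eX gX fb; split.
- exact: fcubes_comp.
- exact: fcubes_edge.
- exact: fcubes_glue.
move=> I lam e Clam Ce; apply: (fcubes_fib fb Clam (e := beta \o e)).
by have [[_ bC] _] := fb; exact: bC Ce.
Qed.

Lemma fcubes_degree X Y (beta : X -> Y) s : fibration_of_degree s beta ->
  has_degree s (@fcubes X) beta.
Proof.
move=> [_ dg] c c' /fcubes_ord Cc /fcubes_ord Cc' bcc' cc'.
by rewrite (dg c c' Cc Cc' _ cc')//; apply/funext.
Qed.

Lemma closed_diagonal (T : topologicalType) : hausdorff_space T ->
  closed [set xy : T * T | xy.1 = xy.2].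
Proof.
rewrite open_hausdorff => hT; rewrite -openC openE => -[x y] /= /eqP xy.
have [[A B] [/set_mem Ax /set_mem By] [oA oB /eqP AB]] := hT x y xy.
exists (A, B); first by split; exact: open_nbhs_nbhs.
move=> [x' y'] [/= Ax' By'] e; have : (A `&` B) x' by split=> //; rewrite e.
by rewrite AB.
Qed.

Lemma fcubes_presentation X Y (beta : X -> Y) : cubespace_morphism beta ->
  presentation (@fcubes X) beta (@id X).
Proof.
move=> [cb _]; split.
- exact: cs_compact.
- by move=> q; exists q.
- move=> I.
  have cf : continuous (fun k : prod_topology (fun _ : vert I => X) =>
      (fun w => k (of_ord w)) : config #|I| X).
    by apply: continuous_to_prod => w; exact: continuous_prod_coord.
  exact: (closed_continuous_preimage cf (@cubes_closed _ X #|I|)).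
have cf : continuous (fun k : X * X => (beta k.1, beta k.2)).
  move=> k; apply: cvg_pair.
    exact: (continuous_comp (@cvg_fst _ _ (nbhs k.1) (nbhs k.2) _) (cb _)).
  exact: (continuous_comp (@cvg_snd _ _ (nbhs k.1) (nbhs k.2) _) (cb _)).
exact: (closed_continuous_preimage cf (closed_diagonal (@metric_hausdorff _ Y))).
Qed.

End Bridge.

(** * Logarithms in a compact abelian Lie group *)

Section Circle.
Variable R : realType.

Lemma to_circleD (x y : R) : to_circle (x + y) = to_circle x + to_circle y.
Proof. exact: (Quotient.pi_add _ x y). Qed.

Lemma to_circle0 : to_circle (0 : R) = 0.
Proof. by apply: (addrI (to_circle 0)); rewrite -to_circleD !addr0. Qed.

Lemma to_circleN (x : R) : to_circle (- x) = - to_circle x.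
Proof. by apply: (addrI (to_circle x)); rewrite -to_circleD !subrr to_circle0. Qed.

Lemma to_circle_surj (t : circle R) : exists x, to_circle x = t.
Proof. by exists (repr (t : circle_quot R)); exact: (@reprK _ (circle_quot R)). Qed.

Lemma to_circle_eq (x y : R) : to_circle x = to_circle y -> exists n : int, x - y = n%:~R.
Proof.
move=> xy; apply/intrP.
have := Quotient.idealrBE (GRing.ZmodClosed.clone R (@Num.int_num_subdef R) _) x y.
by have /eqP -> : (\pi_(circle_quot R) x = \pi_(circle_quot R) y)%qT by exact: xy.
Qed.

Lemma to_circle_inj_small (x y : R) : to_circle x = to_circle y -> `|x - y| < 1 -> x = y.
Proof.
move=> /to_circle_eq[n xy]; rewrite xy -intr_norm.
rewrite -[1]/(1%:~R) ltr_int => n1; apply/eqP; rewrite -subr_eq0 xy intr_eq0.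
by rewrite -absz_eq0; lia.
Qed.

Lemma to_circle_continuous : continuous (@to_circle R).
Proof. exact: (@pi_continuous R (circle_quot R)). Qed.

Lemma to_circle_open (e : R) : 0 < e ->
  nbhs (0 : circle R) [set t | exists2 y : R, `|y| < e & t = to_circle y].
Proof.
move=> e0; apply: open_nbhs_nbhs; split; last first.
  by exists 0; rewrite ?normr0// to_circle0.
rewrite /open /= /quotient_open.
have -> : \pi_(circle_quot R)%qT @^-1` [set t | exists2 y : R, `|y| < e & t = to_circle y] =
    [set x : R | exists2 y : R, `|y| < e & to_circle x = to_circle y] by [].
rewrite openE => x [y ye xy].
have ey : 0 < e - `|y| by rewrite subr_gt0.
exists (e - `|y|) => // z /= xz; exists (y + (z - x)).
  apply: le_lt_trans (ler_normD _ _) _; rewrite distrC; lra.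
by rewrite !to_circleD to_circleN xy addrCA subrr addr0.
Qed.

End Circle.

Section LieGroup.
Variables (R : realType) (A : compact_abelian_lie_group R).
Local Notation d := (lie_dim A).

Lemma lie_iso0 : lie_iso (0 : A) = 0.
Proof. by apply: (addrI (lie_iso (0 : A))); rewrite -lie_isoD !addr0. Qed.

Lemma lie_isoB (a b : A) : lie_iso (a - b) = lie_iso a - lie_iso b.
Proof.
apply: (addIr (lie_iso b)); rewrite -lie_isoD !subrK.
by [].
Qed.

Definition lie_exp (u : 'rV[R]_d) : A := lie_inv (map_mx (@to_circle R) u, 0).

Lemma lie_iso_exp u : lie_iso (lie_exp u) = (map_mx (@to_circle R) u, 0).
Proof. exact: lie_invK. Qed.

Lemma lie_expD u v : lie_exp (u + v) = lie_exp u + lie_exp v.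
Proof.
apply: (can_inj (@lie_isoK _ A)); rewrite lie_isoD !lie_iso_exp.
congr pair; last by rewrite /= addr0.
by apply/matrixP => i j; rewrite !mxE to_circleD.
Qed.

Lemma lie_exp0 : lie_exp 0 = 0.
Proof. by apply: (addrI (lie_exp 0)); rewrite -lie_expD !addr0. Qed.

Lemma lie_expN u : lie_exp (- u) = - lie_exp u.
Proof. by apply: (addrI (lie_exp u)); rewrite -lie_expD !subrr lie_exp0. Qed.

Lemma lie_expB u v : lie_exp (u - v) = lie_exp u - lie_exp v.
Proof. by rewrite lie_expD lie_expN. Qed.

(** The kernel of the exponential is Z^d, whose nonzero vectors have norm at least 1. *)
Lemma lie_exp_inj_small u v : lie_exp u = lie_exp v -> l2norm (u - v) < 1 -> u = v.
Proof.
move=> /(congr1 (fun a => (lie_iso a).1)); rewrite !lie_iso_exp /= => uv lt1.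
apply/rowP => j; apply: to_circle_inj_small.
  by have := congr1 (fun M : 'rV_d => M 0 j) uv; rewrite !mxE.
by apply: le_lt_trans lt1; have := l2norm_coord (u - v) j; rewrite !mxE.
Qed.

Lemma torus_set_nonempty (t t' : 'rV[circle R]_d) :
  [set r | exists x x' : 'rV[R]_d, [/\ map_mx (@to_circle R) x = t,
    map_mx (@to_circle R) x' = t' & r = l2norm (x - x')]] !=set0.
Proof.
have H (s : 'rV[circle R]_d) : exists x : 'rV[R]_d, map_mx (@to_circle R) x = s.
  have /choice[x xP] : forall j, exists x, to_circle x = s 0 j.
    by move=> j; exact: to_circle_surj.
  by exists (\row_j x j); apply/rowP => j; rewrite !mxE.
have [[x xt] [x' xt']] := (H t, H t').
by exists (l2norm (x - x')), x, x'.
Qed.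

Lemma torus_dist_ge0 (t t' : 'rV[circle R]_d) : 0 <= torus_dist t t'.
Proof.
apply: lb_le_inf; first exact: torus_set_nonempty.
by move=> r [x [x' [_ _ ->]]]; exact: l2norm_ge0.
Qed.

Lemma lie_dist_exp_le u v : lie_dist (lie_exp u) (lie_exp v) <= l2norm (u - v).
Proof.
rewrite /lie_dist !lie_iso_exp eqxx subrr add0r; apply: ge_inf; last by exists u, v.
by exists 0 => r [x [x' [_ _ ->]]]; exact: l2norm_ge0.
Qed.

(** Distance below 1 forces the same component. The factor 2 leaves room to pick representatives
    close to the infimum, whether or not it is attained. *)
Lemma lie_log_exists (a b : A) delta : 0 < delta -> delta < 1 -> lie_dist a b <= delta ->
  exists u, lie_exp u = a - b /\ l2norm u < 2 * delta.
Proof.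
move=> d0 d1 ab.
have t0 := torus_dist_ge0 (lie_iso a).1 (lie_iso b).1.
have ab2 : (lie_iso a).2 = (lie_iso b).2.
  apply/eqP; apply: contraTT ab => /negbTE nab; rewrite /lie_dist nab -ltNge.
  by rewrite subr0; lra.
move: ab; rewrite /lie_dist ab2 eqxx subrr add0r => ab.
have ab2d : torus_dist (lie_iso a).1 (lie_iso b).1 < 2 * delta by lra.
have [r [x [x' [xa xb ->]]] lt2] := inf_lt (torus_set_nonempty _ _) ab2d.
exists (x - x'); split=> //; apply: (can_inj (@lie_isoK _ A)).
rewrite lie_iso_exp lie_isoB; case: (lie_iso a) (lie_iso b) xa xb ab2 => [a1 a2] [b1 b2] /=.
move=> <- <- ->; congr pair; last by rewrite /= subrr.
by apply/matrixP => i j; rewrite !mxE to_circleD to_circleN.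
Qed.

Lemma lie_exp_open (e : R) : 0 < e ->
  nbhs (0 : A) [set a | exists2 u : 'rV[R]_d, l2norm u < e & a = lie_exp u].
Proof.
(* The norm is at most the sum of the [d] coordinates; [d.+1] also covers dimension 0. *)
move=> e0; pose e1 := e / d.+1%:R.
have e10 : 0 < e1 by rewrite divr_gt0.
pose B := [set t : 'rV[circle R]_d * discrete_topology (lie_comp A) |
      (forall i j, exists2 y : R, `|y| < e1 & t.1 i j = to_circle y) /\ t.2 = 0].
have N2 : nbhs (lie_iso (0 : A)) B.
  rewrite lie_iso0; exists ([set t : 'rV[circle R]_d |
    forall i j, exists2 y : R, `|y| < e1 & t i j = to_circle y], [set 0]) => //=.
  split; last exact: discrete_set1.
  exists (fun _ _ => [set t | exists2 y : R, `|y| < e1 & t = to_circle y]) => // i j.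
  by rewrite mxE; exact: to_circle_open.
have N : nbhs (0 : A) (lie_iso (c := A) @^-1` B) by exact: (@lie_iso_continuous _ A 0 _ N2).
apply: filterS N => a /= [H a2].
have /choice[y yP] : forall j, exists y, `|y| < e1 /\ (lie_iso a).1 0 j = to_circle y.
  by move=> j; have [y ye yE] := H 0 j; exists y.
exists (\row_j y j).
  apply: (@le_lt_trans _ _ (\sum_(j < d) e1)).
    apply: le_trans (l2norm_le_sum _) _; apply: ler_sum => j _.
    by rewrite mxE ltW//; case: (yP j).
  rewrite sumr_const card_ord -[_ *+ _]mulr_natl /e1 mulrA ltr_pdivrMr ?ltr0n//.
  by rewrite mulrC ltr_pM2l// ltr_nat.
apply: (can_inj (@lie_isoK _ A)); rewrite lie_iso_exp.
rewrite [lie_iso a]surjective_pairing a2; congr pair; apply/rowP => j.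
by rewrite !mxE; case: (yP j).
Qed.

Lemma lie_exp_continuous (T : topologicalType) (f : T -> 'rV[R]_d) :
  l2_continuous f -> continuous (lie_exp \o f).
Proof.
move=> cf t.
suff H : continuous (fun t => (map_mx (@to_circle R) (f t), 0 : discrete_topology (lie_comp A))).
  exact: (continuous_comp (H t) (@lie_inv_continuous _ A _)).
move=> {}t.
suff c1 : (map_mx (@to_circle R) (f x) @[x --> t] --> map_mx (@to_circle R) (f t)).
  exact: (cvg_pair c1 (cvg_cst _)).
move=> U [P Pf PU]; rewrite nbhs_simpl /=.
have H : \forall t' \near t, forall ij : 'I_1 * 'I_d,
    P ij.1 ij.2 (to_circle (f t' ij.1 ij.2)).
  apply: (@filter_forall _ _ (fun (ij : 'I_1 * 'I_d) t' =>
    P ij.1 ij.2 (to_circle (f t' ij.1 ij.2))) (nbhs t) _) => -[i j] /=.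
  have := Pf i j; rewrite mxE => /to_circle_continuous /nbhs_ballP[e /= e0 eP].
  apply: filterS (cf t e e0) => t' lt; apply: eP; rewrite /ball /= distrC.
  apply: le_lt_trans lt; have := l2norm_coord (f t' - f t) j.
  by rewrite !mxE (ord1 i).
by apply: filterS H => t' H; apply: PU => i j; rewrite mxE; exact: (H (i, j)).
Qed.

End LieGroup.

(** * Descent of the cocycle *)

Section Concat.
Variables (X : topologicalType) (n : nat) (i : 'I_n).
Implicit Types c : config n.-1 X.

Lemma vdel_vset a (w : vertex n) : vdel i (vset i a w) = vdel i w.
Proof.
by apply/ffunP => j; rewrite !ffunE eq_sym (negbTE (neq_lift _ _)).
Qed.

Lemma concat_vset_coord c0 c1 a w :
  concat i c0 c1 (vset i a w) = if a then c1 (vdel i w) else c0 (vdel i w).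
Proof. by rewrite /concat vsetE eqxx vdel_vset. Qed.

Lemma vglue_concat c0 c1 c1' c2 :
  vglue i (concat i c0 c1) (concat i c1' c2) = concat i c0 c2.
Proof. by apply/funext => w; rewrite /vglue /concat; case: (w i). Qed.

Lemma concat_flip c0 c1 : (fun w => concat i c0 c1 (vflip i w)) = concat i c1 c0.
Proof.
apply/funext => w; rewrite /vflip concat_vset_coord /concat.
by case: (w i).
Qed.

End Concat.

Section Descent.
Variables (R : realType) (l : nat) (A : compact_abelian_lie_group R).
Variables (X Y : compact_cubespace R) (beta : X -> Y).
Hypotheses (eX : ergodic X) (gX : glueing_axiom X) (fb : fibration beta).
Variable rho : config l X -> A.
Hypothesis rho_cocycle : cocycle rho.

Local Notation C := (@fcubes R X).
Local Notation CY := (@fcubes R Y).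

Lemma cocycle_vglue i (p q : config l X) : cubes X l p -> cubes X l q ->
  (forall v, p (vset i true v) = q (vset i false v)) ->
  rho (vglue i p q) = rho p + rho q.
Proof.
move=> Cp Cq pq; have [add _ _] := proj2 rho_cocycle i.
have := add (p \o vins i false) (p \o vins i true) (q \o vins i true).
have E : p \o vins i true = q \o vins i false.
  by apply/funext => v /=; rewrite -(vins_vset i true false) pq vins_vset.
rewrite concat_vins E concat_vins concat_vset; apply=> //.
have := fcubes_glue gX (i := i) (p := p) (q := q).
by move=> H; apply/fcubes_ord; apply: H => //; apply/fcubes_ord.
Qed.

Section Lift.
Variable delta : R.
Hypotheses (delta_gt0 : 0 < delta) (delta_small : delta <= 16^-1).
Hypothesis rho_close : forall c c' : config l X, cubes X l c -> cubes X l c' ->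
  beta \o c = beta \o c' -> lie_dist (rho c) (rho c') <= delta.

(* The junk value [0] is irrelevant: the logarithm exists for fibered cubes. *)
Definition log_difference (c c' : vert 'I_l -> X) : 'rV[R]_(lie_dim A) :=
  if pselect (exists u, lie_exp u = rho c' - rho c /\ l2norm u < 2 * delta)
  is left H then sval (cid H) else 0.

Lemma log_differenceP c c' : fibered C beta c c' ->
  lie_exp (log_difference c c') = rho c' - rho c /\ l2norm (log_difference c c') < 2 * delta.
Proof.
move=> [Cc Cc' cc']; rewrite /log_difference; case: pselect => [H|nH].
  exact: (svalP (cid H)).
have d1 : delta < 1 by apply: le_lt_trans delta_small _; lra.
exfalso; apply: nH; apply: (lie_log_exists delta_gt0 d1).
apply: rho_close; [exact/fcubes_ord|exact/fcubes_ord|].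
by apply/funext => v /=; rewrite cc'.
Qed.

(** Both identities hold after exponentiation and compare three logarithms, each of norm below 2
    delta, at most 1/8; so the two sides differ by less than 1. *)
Lemma log_difference_cocycle : relative_cocycle C beta log_difference.
Proof.
split=> [p q t pq qt|i p q p' q' pp' qq' pq p'q'].
  have [[Epq npq] [Eqt nqt]] := (log_differenceP pq, log_differenceP qt).
  have [Ept npt] := log_differenceP (fibered_trans pq qt).
  apply: lie_exp_inj_small.
    by rewrite lie_expD Epq Eqt Ept addrC subrKA.
  apply: le_lt_trans (ler_l2normD _ _) _; rewrite l2normN.
  have := ler_l2normD (log_difference p q) (log_difference q t); have := delta_small; lra.
have [[Ep np] [Eq nq]] := (log_differenceP pp', log_differenceP qq').
have [/fcubes_ord Cp /fcubes_ord Cp' bp] := pp'.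
have [/fcubes_ord Cq /fcubes_ord Cq' bq] := qq'.
have gg : fibered C beta (vglue i p q) (vglue i p' q').
  split; first by apply: (fcubes_glue gX) => //; exact/fcubes_ord.
    by apply: (fcubes_glue gX) => //; exact/fcubes_ord.
  by move=> v; rewrite /vglue; case: ifP.
have [Eg ng] := log_differenceP gg.
apply: lie_exp_inj_small.
  rewrite lie_expD Ep Eq Eg !cocycle_vglue//.
  by rewrite opprD addrACA.
apply: le_lt_trans (ler_l2normD _ _) _; rewrite l2normN.
have := ler_l2normD (log_difference p p') (log_difference q q'); have := delta_small; lra.
Qed.

Lemma log_difference_continuous : rel_continuous C beta id log_difference.
Proof.
(* A small logarithm [u] of the change of [rho c' - rho c] is to be identified with the change of
   [log_difference]. The bound 1/2 on [u], with two logarithms below 1/8, keeps the total below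
   1. *)
move=> k0 F0 e e0; pose e1 := Num.min e 2^-1.
have e10 : 0 < e1 by rewrite lt_min e0; lra.
have [E0 n0] := log_differenceP F0.
have [/fcubes_ord Ck1 /fcubes_ord Ck2 _] := F0.
have /subspace_continuousP rcont := proj1 rho_cocycle.
pose a0 := rho k0.1; pose b0 := rho k0.2.
pose G (ab : A * A) := ab.2 - ab.1 - (b0 - a0).
have cG : continuous G.
  move=> ab; have c1 : (x.2 - x.1 @[x --> ab] --> ab.2 - ab.1).
    have c2 : ((x.2, x.1) @[x --> ab] --> (ab.2, ab.1)).
      exact: (cvg_pair (@cvg_snd _ _ (nbhs ab.1) (nbhs ab.2) _)
        (@cvg_fst _ _ (nbhs ab.1) (nbhs ab.2) _)).
    exact: (cvg_comp _ _ c2 (@sub_continuous A (ab.2, ab.1))).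
  have c3 : ((x.2 - x.1, b0 - a0) @[x --> ab] --> (ab.2 - ab.1, b0 - a0)).
    exact: (cvg_pair c1 (cvg_cst (b0 - a0))).
  exact: (cvg_comp _ _ c3 (@sub_continuous A (ab.2 - ab.1, b0 - a0))).
have G0 : G (a0, b0) = 0 by rewrite /G subrr.
have [[U V] [/= Ua Vb] UV] : nbhs (a0, b0)
    (G @^-1` [set a | exists2 u : 'rV[R]_(lie_dim A), l2norm u < e1 & a = lie_exp u]).
  by apply: cG; rewrite G0; exact: lie_exp_open.
have N1 : \forall k \near k0, cubes X l k.1 -> U (rho k.1).
  exact: (@cvg_fst _ _ (nbhs k0.1) (nbhs k0.2) _ _ (rcont _ Ck1 U Ua)).
have N2 : \forall k \near k0, cubes X l k.2 -> V (rho k.2).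
  exact: (@cvg_snd _ _ (nbhs k0.1) (nbhs k0.2) _ _ (rcont _ Ck2 V Vb)).
apply: filterS2 N1 N2 => k H1 H2 Fk; have [/fcubes_ord C1 /fcubes_ord C2 _] := Fk.
have [E n] := log_differenceP Fk.
have [u ulte uE] := UV (rho k.1, rho k.2) (conj (H1 C1) (H2 C2)).
have ue : l2norm u < e by move: ulte; rewrite lt_min => /andP[].
have u2 : l2norm u < 2^-1 by move: ulte; rewrite lt_min => /andP[].
rewrite (_ : log_difference _ _ - _ = u)//; apply: lie_exp_inj_small.
  by rewrite lie_expB E E0 -uE.
apply: le_lt_trans (ler_l2normD _ _) _; rewrite l2normN.
have := ler_l2normD (log_difference (id \o k.1) (id \o k.2))
  (- log_difference (id \o k0.1) (id \o k0.2)).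
by rewrite l2normN; have := delta_small; lra.
Qed.

End Lift.

Section Quotient.
Variable f : X -> A.
Hypotheses (f_continuous : continuous f)
  (f_coboundary : forall c c', fibered C beta c c' ->
     rho c' - rho c = coboundary f c' - coboundary f c).

Definition reduced (c : config l X) : A := rho c - coboundary f c.

Lemma reduced_fiber c c' : fibered C beta c c' -> reduced c = reduced c'.
Proof.
move=> /f_coboundary; rewrite /reduced => /eqP.
rewrite subr_eq => /eqP ->.
by rewrite addrAC [coboundary f c' - _]addrC addrK addrC.
Qed.

Lemma reduced_vglue i (p q : config l X) : cubes X l p -> cubes X l q ->
  (forall v, p (vset i true v) = q (vset i false v)) ->
  reduced (vglue i p q) = reduced p + reduced q.
Proof.
move=> Cp Cq pq; rewrite /reduced cocycle_vglue//.
rewrite (_ : coboundary f (vglue i p q) = coboundary f p + coboundary f q).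
  by rewrite opprD addrACA.
exact: (alt_sum_glue f pq).
Qed.

Definition descended (d : config l Y) : A :=
  if pselect (exists c, cubes X l c /\ beta \o c = d) is left H
  then reduced (sval (cid H)) else 0.

Lemma descendedE c : cubes X l c -> descended (beta \o c) = reduced c.
Proof.
move=> Cc; rewrite /descended; case: pselect => [H|[]]; last by exists c.
have [Cc' e] := svalP (cid H); apply: reduced_fiber; split.
- exact/fcubes_ord.
- exact/fcubes_ord.
by move=> v; have := congr1 (@^~ v) e.
Qed.

(** A corner of dimension 0 is empty, so filling it over [y] gives a preimage. *)
Lemma fibration_surj (y : Y) : exists x, beta x = y.
Proof.
have no (w : punctured 0) : False.
  by have := valP w; case: (val w) => ? /=; apply/negP; rewrite negbK; apply/eqP/ffunP => -[].
have [] := proj2 fb 0%N (fun w => False_rect X (no w)) (fun=> y).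
- by case.
- by rewrite cubes_dim0.
- by move=> w; case: (no w).
move=> c [_ _ cy]; exists (c (vtop 0)).
by have := congr1 (@^~ (vtop 0)) cy.
Qed.

Lemma lift_cubes (d : config l Y) : cubes Y l d ->
  exists2 c, cubes X l c & beta \o c = d.
Proof.
move=> Cd; have /choice[lam lamP] : forall v, exists x, beta x = d v.
  by move=> v; exact: fibration_surj.
have [||c Cc cd] := lift_cube (@fcubes_comp R X) (@fcubes_comp R Y) (fcubes_fib fb) (d := d).
- by exists lam.
- exact/fcubes_ord.
by exists c; [exact/fcubes_ord|apply/funext].
Qed.

(** Lift [P] first, then lift [Q] with its lower face prescribed by the lift of [P]; the lifts can
    then be glued. *)
Lemma descended_vglue i (P Q : config l Y) : cubes Y l P -> cubes Y l Q ->
  (forall v, P (vset i true v) = Q (vset i false v)) ->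
  descended (vglue i P Q) = descended P + descended Q.
Proof.
move=> CP CQ PQ; have [p Cp pP] := lift_cubes CP.
have Cpf : C (fun v => p (vflip i v)).
  by apply: (fcubes_comp (vert_morphism_flip i)); exact/fcubes_ord.
have fE v : vflip i (vset i false v) = vset i true v.
  by rewrite /vflip vsetE eqxx vset_vset.
have [||q [Cq qQ qp]] := lift_cube_face (@fcubes_comp R X) (@fcubes_comp R Y)
    (fcubes_fib fb) (i := i) (d := Q) _ Cpf.
- exact/fcubes_ord.
- by move=> v; rewrite fE -PQ -pP.
have {}Cq : cubes X l q by exact/fcubes_ord.
have {}qQ : beta \o q = Q by exact/funext.
have pq v : p (vset i true v) = q (vset i false v) by rewrite qp fE.
have -> : vglue i P Q = beta \o vglue i p q.
  by apply/funext => v; rewrite /vglue -pP -qQ /=; case: ifP.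
rewrite descendedE; last first.
  by apply/fcubes_ord; apply: (fcubes_glue gX) => //; exact/fcubes_ord.
by rewrite reduced_vglue// -!descendedE// pP qQ.
Qed.

Lemma coboundary_continuous : continuous (@coboundary X A l f).
Proof.
suff H (k : seq (vertex l)) :
    continuous (fun c : config l X => \sum_(w <- k) f (c w) *~ (-1) ^+ weight w).
  exact: H.
elim: k => [|v k IH].
  have -> : (fun c : config l X => \sum_(w <- [::]) f (c w) *~ (-1) ^+ weight w) =
      fun=> 0 by apply/funext => c; rewrite big_nil.
  exact: cst_continuous.
have -> : (fun c : config l X => \sum_(w <- v :: k) f (c w) *~ (-1) ^+ weight w) =
    fun c => f (c v) *~ (-1) ^+ weight v + \sum_(w <- k) f (c w) *~ (-1) ^+ weight w.
  by apply/funext => c; rewrite big_cons.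
have cv : continuous (fun c : config l X => f (c v)).
  have cp : continuous (fun c : config l X => c v) by exact: continuous_prod_coord.
  by move=> c; apply: (continuous_comp (cp c)); exact: f_continuous.
have cs : continuous (fun c : config l X => f (c v) *~ (-1) ^+ weight v).
  have -> : (fun c : config l X => f (c v) *~ (-1) ^+ weight v) =
      fun c => if odd (weight v) then - f (c v) else f (c v).
    by apply/funext => c; rewrite mulrz_sign.
  by case: (odd _) => // c; exact: (continuous_comp (cv c) (@opp_continuous A _)).
by move=> c; exact: (cvg_comp _ _ (cvg_pair (cs c) (IH c)) (@add_continuous A (_, _))).
Qed.

Lemma reduced_continuous : {within cubes X l, continuous reduced}.
Proof.
have /subspace_continuousP rcont := proj1 rho_cocycle.
apply/subspace_continuousP => c Cc.
have cf : (coboundary f x @[x --> within (cubes X l) (nbhs c)] --> coboundary f c).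
  move=> U Uc; have N : nbhs c (coboundary f (l := l) @^-1` U).
    exact: (coboundary_continuous Uc).
  have FF : Filter (nbhs c) by exact: nbhs_filter.
  by rewrite /within /=; apply: filterS N => c' Hc' _.
exact: (cvg_comp _ _ (cvg_pair (rcont c Cc) cf) (@sub_continuous A (_, _))).
Qed.

(** The lifts of a cube form a compact set on which [reduced] is constant, so a tube neighbourhood
    controls every lift of every nearby cube. *)
Lemma descended_continuous : {within cubes Y l, continuous descended}.
Proof.
have /subspace_continuousP rcont := reduced_continuous.
apply/subspace_continuousP => d0 Cd0 V Vd0.
have pr := fcubes_presentation (proj1 fb).
pose T := (config l Y * config l X)%type.
pose Z := [set t : T | cubes X l t.2 /\ forall v, beta (t.2 v) = t.1 v].
have c1 : continuous (fun t : T => t.1) by move=> t; exact: cvg_fst.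
have c2 : continuous (fun t : T => t.2) by move=> t; exact: cvg_snd.
have cZ : closed Z.
  apply: closedI; first exact: (closed_continuous_preimage c2 (@cubes_closed _ X l)).
  apply: closed_forall => v.
  have cv : continuous (fun t : T => (beta (t.2 v), t.1 v)).
    move=> t; apply: cvg_pair.
      apply: (continuous_comp _ (proj1 (proj1 fb) _)).
      exact: (continuous_comp (c2 t) (@continuous_prod_coord X _ v _)).
    exact: (continuous_comp (c1 t) (@continuous_prod_coord Y _ v _)).
  exact: (closed_continuous_preimage cv (closed_diagonal (@metric_hausdorff _ Y))).
have cK : compact [set: config l X].
  exact: (@compact_conf _ 'I_l (@cs_compact _ X)).
have H : \forall d \near d0, forall c, Z (d, c) -> V (reduced c).
  apply: (near_compact_within (P := fun (d : config l Y) c => V (reduced c)) cK cZ).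
  move=> c [/= Cc cd]; have cd0 : beta \o c = d0 by exact/funext.
  have Vc : nbhs (reduced c) V by rewrite -descendedE// cd0.
  have N : \forall t \near (d0, c), cubes X l t.2 -> V (reduced t.2).
    exact: (c2 (d0, c) _ (rcont c Cc V Vc)).
  have FF : Filter (nbhs (d0, c)) by exact: nbhs_filter.
  by apply: filterS N => t Ht [/= Ct _]; exact: Ht.
rewrite /within /=.
apply: filterS H => d Hd Cd; have [c Cc cd] := lift_cubes Cd.
suff : V (descended d) by [].
by rewrite -cd descendedE//; apply: Hd; split=> //= v; rewrite -cd.
Qed.

Lemma descended_cocycle : cocycle descended.
Proof.
split; first exact: descended_continuous.
move=> i.
(* Vanishing on degenerate cubes and antisymmetry are consequences of this additivity. *)
have add c0 c1 c2 : cubes Y l (concat i c0 c1) -> cubes Y l (concat i c1 c2) ->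
    descended (concat i c0 c2) = descended (concat i c0 c1) + descended (concat i c1 c2).
  move=> C01 C12; rewrite -(vglue_concat i c0 c1 c1 c2) descended_vglue// => v.
  by rewrite !concat_vset_coord.
have zero c0 : cubes Y l (concat i c0 c0) -> descended (concat i c0 c0) = 0.
  by move=> C00; apply: (addrI (descended (concat i c0 c0))); rewrite -add// addr0.
split=> [c0 c1 c2 C01 C12 _|c0 c1 C01|]; [exact: add| |exact: zero].
have C10 : cubes Y l (concat i c1 c0).
  rewrite -concat_flip; apply/fcubes_ord.
  by apply: (fcubes_comp (vert_morphism_flip i)); exact/fcubes_ord.
have C00 : cubes Y l (concat i c0 c0).
  have -> : concat i c0 c0 = fun v => concat i c0 c1 (vset i false v).
    by apply/funext => v; rewrite concat_vset_coord /concat; case: ifP.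
  by apply/fcubes_ord; apply: (fcubes_comp (vert_morphism_vset i false)); exact/fcubes_ord.
by apply/eqP; rewrite -addr_eq0 -add// zero.
Qed.

End Quotient.
End Descent.

Theorem theorem5p1 (R : realType) (s l : nat) (l_ge1 : (1 <= l)%N) :
  exists2 C : R, 0 < C &
  forall A : compact_abelian_lie_group R,
  exists2 eps : R, 0 < eps &
  forall (X Y : compact_cubespace R) (beta : X -> Y),
    ergodic X -> ergodic Y -> glueing_axiom X -> glueing_axiom Y ->
    fibration_of_degree s beta ->
  forall (rho : config l X -> A) (delta : R),
    cocycle rho -> 0 < delta -> delta <= eps ->
    (forall c c' : config l X, cubes X l c -> cubes X l c' ->
       beta \o c = beta \o c' -> lie_dist (rho c) (rho c') <= delta) ->
  exists (f : X -> A) (rhot : config l Y -> A),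
    [/\ continuous f,
        forall x y : X, beta x = beta y -> lie_dist (f x) (f y) <= C * delta,
        cocycle rhot &
        forall c : config l X, cubes X l c ->
          rho c = coboundary f c + rhot (beta \o c)].
Proof.
have sb0 := step_bound_ge0 R l s.
(* The logarithms are bounded by 2 delta and a difference of two values of [f] doubles the bound;
   the summand 1 keeps the constant positive when [s = 0]. *)
exists (4 * step_bound R l s + 1); first by lra.
move=> A; exists 16^-1; first by lra.
move=> X Y beta eX eY gX gY fs rho delta rhoc d0 ds rho_close.
have fb := proj1 fs.
have rc := log_difference_cocycle gX rhoc d0 ds rho_close.
have rcont := log_difference_continuous rhoc d0 ds rho_close.
have [||f [fle fcont fE]] := @fiber_cocycle_trivial R (lie_dim A) l l_ge1 s X X Y _ beta id _
    (2 * delta) (fcubes_presentation (proj1 fb)) (fcubes_axioms eX gX fb) (fcubes_degree fs)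
    rc rcont.
- by move=> c c' cc'; apply: ltW; case: (log_differenceP d0 ds rho_close cc').
- by lra.
pose F := @lie_exp R A \o f.
have cF : continuous F by exact: lie_exp_continuous.
have FE c : coboundary F c = lie_exp (alt_sum f c).
  rewrite /alt_sum (big_morph _ (@lie_expD R A) (@lie_exp0 R A)).
  apply: eq_bigr => w _; rewrite !mulrz_sign; case: ifP => // _.
  by rewrite lie_expN.
have F_cob c c' : fibered (@fcubes R X) beta c c' ->
    rho c' - rho c = coboundary F c' - coboundary F c.
  move=> cc'; rewrite !FE -lie_expB -fE//.
  by case: (log_differenceP d0 ds rho_close cc').
exists F, (descended beta rho F); split=> //.
- move=> x y _; apply: le_trans (lie_dist_exp_le _ _) _.
  apply: le_trans (ler_l2normD _ _) _; rewrite l2normN.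
  rewrite (_ : _ * delta = step_bound R l s * (2 * delta) +
    step_bound R l s * (2 * delta) + delta); last by ring.
  by have := fle x; have := fle y; lra.
- exact: descended_cocycle.
by move=> c Cc; rewrite descendedE// /reduced addrC subrK.
Qed.
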